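(* For every $\epsilon>0$ there exist a constant $C>0$ and an integer $n_0$ such that for every $n\ge n_0$ there exists a $2$-dimensional simplicial complex $X$ on $n$ vertices, with complete $1$-skeleton (i.e. $X$ contains all $\binom{n}{2}$ edges), with the property that every affine map $\phi: X\to\mathcal{H}$ into a Hilbert space $\mathcal{H}$ satisfies $$\delta_1(\phi)\ \ge\ C\, n^{\frac{1-2\epsilon}{4}}.$$
   Context: A map $\phi:X\to\mathcal H$ from (the geometric realization of) a simplicial complex is affine if its restriction to each simplex is affine; it is determined by the images of the vertices. $C_kX$ denotes the simplicial $k$-chains of $X$ with $\mathbb{Z}_2$-coefficients, $\partial: C_kX\to C_{k-1}X$ the boundary map, and for $y\in C_kX$, $\|y\|$ is the number of non-zero coefficients of $y$ (the size of its support). $B_1X=\partial(C_2X)\subset C_1X$ is the set of $\mathbb{Z}_2$ $1$-boundaries. For $z\in B_1X$, $$\mathrm{Fill}_X(z)=\min\{\|y\| : y\in C_2X,\ \partial y=z\}.$$ For a $\mathbb{Z}_2$ Lipschitz $1$-cycle $w$ in $\mathcal H$, $$\mathrm{Fill}_{\mathcal H}(w)=\inf\{\mathrm{vol}_2(y) : y \text{ a } \mathbb{Z}_2 \text{ Lipschitz } 2\text{-chain in } \mathcal H,\ \partial y=w\},$$ where a $\mathbb Z_2$ Lipschitz $k$-chain is a finite formal $\mathbb{Z}_2$-sum of Lipschitz maps of the standard $k$-simplex into $\mathcal H$, and $\mathrm{vol}_2$ is the total ($2$-dimensional) area counted over its simplices. $\phi_*z$ denotes the image Lipschitz cycle of $z$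 under $\phi$. The filling distortion of $\phi$ is $$\delta_1(\phi)=\sup_{z\in B_1X}\frac{\mathrm{Fill}_{\mathcal H}(\phi_*z)}{\mathrm{Fill}_X(z)}\cdot\sup_{z\in B_1X}\frac{\mathrm{Fill}_X(z)}{\mathrm{Fill}_{\mathcal H}(\phi_*z)},$$ with suprema over non-zero $z$; if $\mathrm{Fill}_{\mathcal H}(\phi_*z)=0$ for some non-zero $z\in B_1X$, then $\delta_1(\phi)=\infty$. *)

(* Defs.v *)
From HB Require Import structures.
From mathcomp Require Import all_boot all_order all_algebra.
Set Implicit Arguments.
Unset Strict Implicit.
Unset Printing Implicit Defensive.
Import Order.TTheory GRing.Theory Num.Theory.
Local Open Scope ring_scope.

Section Complexes.
Variable n : nat.
Implicit Type X : {set {set 'I_n}}.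

Definition simplicial_complex X : Prop :=
  [/\ set0 \notin X, (forall v : 'I_n, [set v] \in X)
    & forall s t : {set 'I_n}, s \in X -> t \subset s -> t != set0 -> t \in X].

Definition complex_dim X : nat := (\max_(s in X) #|s|).-1.

Definition complete_1skeleton X : Prop :=
  forall u v : 'I_n, u != v -> [set u; v] \in X.

Definition simplices X (k : nat) : Type :=
  {s : {set 'I_n} | (s \in X) && (#|s| == k.+1)}.
HB.instance Definition _ X k := Finite.on (simplices X k).

Definition chain X k : Type := {ffun simplices X k -> 'F_2}.
HB.instance Definition _ X k := GRing.Zmodule.on (chain X k).
HB.instance Definition _ X k := Finite.on (chain X k).

(* By cardinality, the t summed over are the cofaces of s of codimension 1. *)
Definition chain_boundary X k (y : chain X k.+1) : chain X k :=
  [ffun s : simplices X k =>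
     \sum_(t : simplices X k.+1 | val s \subset val t) y t].

Definition chain_norm X k (y : chain X k) : nat :=
  #|[set s : simplices X k | y s != 0]|.

Definition boundaries1 X : {set chain X 1} :=
  [set chain_boundary y | y : chain X 2].

(* The default value of the minimum, the number of 2-simplices, bounds every
   norm, so it never affects the minimum over a non-empty set of fillings. *)
Definition fill_complex X (z : chain X 1) : nat :=
  \big[minn/#|{: simplices X 2}|]_(y : chain X 2 | chain_boundary y == z)
     chain_norm y.

Lemma card_simplex X k (s : simplices X k) : k.+1 = #|val s|.
Proof. by case/andP: (valP s) => _ /eqP. Qed.

(* The j-th vertex of s, for the natural order on 'I_n. *)
Definition simplex_vertex X k (s : simplices X k) (j : 'I_k.+1) : 'I_n :=
  enum_val (cast_ord (card_simplex s) j).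

End Complexes.

(* Loaded only now: it shadows the notations for finite sets used above. *)
From mathcomp Require Import all_classical all_reals all_analysis.
Import numFieldNormedType.Exports.
Local Open Scope classical_set_scope.

(* Real Hilbert spaces, of arbitrary (possibly finite) dimension; a complex one
   is covered through the real part of its inner product, which induces the
   same norm. *)
Record hilbertType (R : realType) := HilbertType {
  hilbert_sort :> completeNormedModType R;
  hdot : {dot hilbert_sort for idfun};
  hdot_norm : forall x : hilbert_sort, `|x| ^+ 2 = hdot x x }.

Section Realization.
Variable R : realType.

(* The simplex spanned by the basis vectors e_i, i in s. *)
Definition geom_simplex n (s : {set 'I_n}) : set 'rV[R]_n :=
  [set x | [/\ forall i, 0 <= x 0 i, \sum_i x 0 i = 1
             & forall i, i \notin s -> x 0 i = 0]].

Definition std_simplex k : set 'rV[R]_k.+1 := geom_simplex [set: 'I_k.+1].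

(* The linear map e_j |-> e_(v j). *)
Definition vertex_map m n (v : 'I_m -> 'I_n) (x : 'rV[R]_m) : 'rV[R]_n :=
  \sum_(j < m) x 0 j *: delta_mx 0 (v j).

Variable H : hilbertType R.

(* The realization of X is the union of the geom_simplex s, s in X; the values
   of phi outside it play no role. *)
Definition affine_map n (X : {set {set 'I_n}}) (phi : 'rV[R]_n -> H) : Prop :=
  forall s : {set 'I_n}, s \in X ->
  forall (x y : 'rV[R]_n) (t : R), geom_simplex s x -> geom_simplex s y ->
    0 <= t <= 1 ->
    phi (t *: x + (1 - t) *: y) = t *: phi x + (1 - t) *: phi y.

(* Maps from the standard simplex to H are encoded, one-to-one, as total maps
   vanishing off the simplex. *)
Definition on_simplex k (f : 'rV[R]_k.+1 -> H) : 'rV[R]_k.+1 -> H :=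
  patch (fun=> 0) (@std_simplex k) f.

Definition lipschitz_simplex k (sigma : 'rV[R]_k.+1 -> H) : Prop :=
  [lipschitz sigma x | x in @std_simplex k] /\
  (forall x, ~ std_simplex x -> sigma x = 0).

Definition simplex_face k (i : 'I_k.+2) (sigma : 'rV[R]_k.+2 -> H) :
    'rV[R]_k.+1 -> H :=
  on_simplex (sigma \o vertex_map (lift i)).

Definition chain_supp k (c : ('rV[R]_k.+1 -> H) -> 'F_2) :
    set ('rV[R]_k.+1 -> H) :=
  [set sigma | c sigma != 0].

(* A finite formal sum is given by its coefficient function. *)
Definition lipschitz_chain k (c : ('rV[R]_k.+1 -> H) -> 'F_2) : Prop :=
  finite_set (chain_supp c) /\ chain_supp c `<=` @lipschitz_simplex k.

Definition lip_boundary k (c : ('rV[R]_k.+2 -> H) -> 'F_2) :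
    ('rV[R]_k.+1 -> H) -> 'F_2 :=
  fun tau => \sum_(sigma \in chain_supp c)
               \sum_(i < k.+2 | simplex_face i sigma == tau) c sigma.

Definition barycentric (p : R^o * R^o) : 'rV[R]_3 :=
  \row_(j < 3) [:: 1 - p.1 - p.2; p.1; p.2]`_j.

(* The Jacobian sqrt (E G - F^2) of p |-> sigma (barycentric p); for sigma
   Lipschitz the partial derivatives exist almost everywhere on the triangle
   (Rademacher), and the area does not depend on the parametrization. *)
Definition area_density (sigma : 'rV[R]_3 -> H) (p : R^o * R^o) : R :=
  let f := sigma \o barycentric in
  let f1 := 'D_((1, 0) : R^o * R^o) f p in
  let f2 := 'D_((0, 1) : R^o * R^o) f p in
  Num.sqrt (hdot H f1 f1 * hdot H f2 f2 - hdot H f1 f2 ^+ 2).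

Definition open_triangle : set (R * R) :=
  [set p | [/\ 0 < p.1, 0 < p.2 & p.1 + p.2 < 1]].

Definition area (sigma : 'rV[R]_3 -> H) : \bar R :=
  (\int[lebesgue_measure \x lebesgue_measure]_(p in open_triangle)
     (area_density sigma p)%:E)%E.

Definition vol2 (y : ('rV[R]_3 -> H) -> 'F_2) : \bar R :=
  (\sum_(sigma \in chain_supp y) area sigma)%E.

Definition fill_hilbert (w : ('rV[R]_2 -> H) -> 'F_2) : \bar R :=
  ereal_inf [set vol2 y | y in
    [set y | @lipschitz_chain 2 y /\ lip_boundary y = w]].

(* A k-simplex of X is turned into a singular simplex along the order of its
   vertices. *)
Definition push_simplex n (X : {set {set 'I_n}}) k (phi : 'rV[R]_n -> H)
    (s : simplices X k) : 'rV[R]_k.+1 -> H :=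
  on_simplex (phi \o vertex_map (simplex_vertex s)).

Definition push_chain n (X : {set {set 'I_n}}) k (phi : 'rV[R]_n -> H)
    (z : chain X k) : ('rV[R]_k.+1 -> H) -> 'F_2 :=
  fun tau => \sum_(s : simplices X k | push_simplex phi s == tau) z s.

Definition nonzero_boundaries1 n (X : {set {set 'I_n}}) : set (chain X 1) :=
  [set z | z \in boundaries1 X /\ z <> 0].

Definition filling_distortion n (X : {set {set 'I_n}}) (phi : 'rV[R]_n -> H) :
    \bar R :=
  if `[< exists2 z : chain X 1, nonzero_boundaries1 z
                              & fill_hilbert (push_chain phi z) = 0%E >]
  then +oo%E
  else (ereal_sup [set fill_hilbert (push_chain phi z)
                         / ((fill_complex z)%:R : R)%:E
                       | z in @nonzero_boundaries1 n X]
        * ereal_sup [set ((fill_complex z)%:R : R)%:E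
                         / fill_hilbert (push_chain phi z)
                       | z in @nonzero_boundaries1 n X])%E.

End Realization.

(* Main.v *)
(** The only constraint on the complex is its complete 1-skeleton, so the triangles can be
    chosen at random: put three disjoint classes of [q] vertices among the [n] vertices, with
    [q] of order [n], and let the triangles be a sparse random set [S] of triples
    transversal to the classes.

    In a Hilbert space the filling area of the boundary of an affine triangle is invariant
    under isometries, quadratic under scaling and additive enough to be [s] times the area of
    the triangle, where [s >= 0] does not depend on the triangle.  This [s] cancels in the
    distortion (if [s = 0] the distortion is infinite), so no lower bound on Hilbert fillings
    is ever needed.

    With high probability [S] has three properties.  Every set of triples of positive density
    on which some member of the space of coboundaries exceeds a threshold has many members in
    [S], since few sign patterns occur in a space of dimension [3 q ^ 2].  The boundaries of
    the triangles of [S] span the boundaries of almost all the triples, by a union bound over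
    the possible spans.  Finally, for most triples no set of at most [m] triangles of [S] has
    the same boundary, [m] being of order [n ^ (1 / 4)], by a first moment computation.

    For an affine map, twice the squared area of a triple is a sum of squares of coboundaries,
    the 2x2 minors of the coordinates.  A random signed sum of them is comparable to the area
    (Paley-Zygmund and Chebyshev), so the first property shows that at least half of the
    triples have an area at most a constant times the largest area of a triangle [t1] of [S].
    One of them, [t2], is the boundary of triangles of [S], but only of more than [m] of them;
    comparing [t1] and [t2] yields a distortion of order at least [m]. *)

From HB Require Import structures.
Require Import Defs.
From mathcomp Require Import all_boot all_order all_algebra.
From mathcomp Require Import boolp.
From mathcomp Require Import ring lra zify.
From Stdlib Require Import Btauto.
Set Implicit Arguments.
Unset Strict Implicit.
Unset Printing Implicit Defensive.
Import Order.TTheory GRing.Theory Num.Theory.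
Local Open Scope ring_scope.

(** * Random sets of triangles *)

(** The map is chosen after the complex, in a space of any dimension, so one [S] must serve a
    continuum of area functions. Random signs merge the minors into a single real cochain, and real
    cochains have finitely many sign patterns on the triples; only then does a union bound apply. It
    forces the density of [S] above [log q / q], whereas scarcity of short fillings asks for a
    sparse [S]. The three classes order the vertices of every triple, so cochains are plain
    functions on edges, and one of them has coboundary 1 everywhere. Invariance of filling areas has
    a price: [area] integrates formal directional derivatives, whose values at points of
    non-differentiability are arbitrary and need not commute with an isometry. Hence the part on
    almost everywhere differentiability. It is valid for any [H]: the energies of the piecewise
    linear interpolations of a Lipschitz curve are bounded, so some interpolation nearly exhausts
    them, and a covering argument controls the residual. *)

Lemma leq_expl m n e : (m <= n -> m ^ e <= n ^ e)%N.
Proof. by move=> mn; elim: e => // e IH; rewrite !expnS leq_mul. Qed.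

Lemma expnS_add n d : (n.+1 ^ d.+1 + n.+1 ^ d <= n.+2 ^ d.+1)%N.
Proof. by rewrite expnS -mulSnr expnS leq_mul2l leq_expl ?orbT. Qed.

(** * Sign patterns of linear forms *)

Section Patterns.
Variables (R : realFieldType) (W : vectType R).
Implicit Types (U : {vspace W}) (hs : seq 'Hom(W, R^o)).

Definition pattern hs (g : W) : seq bool := [seq (0 : R) < (h g : R) | h : 'Hom(W, R^o) <- hs].

(* Two functions with the same pattern on [hs] but opposite positivity for [h] have a convex
   combination in the kernel of [h], with the same pattern on [hs]. *)
Lemma pattern_convex hs (h : 'Hom(W, R^o)) g1 g2 : pattern hs g1 = pattern hs g2 ->
  (0 : R) < (h g1 : R) -> (h g2 : R) <= 0 ->
  exists a b : R, h (a *: g1 + b *: g2) = 0 /\ pattern hs (a *: g1 + b *: g2) = pattern hs g1.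
Proof.
move=> e12 p1 n2; exists (- h g2), (h g1); split.
  by rewrite linearD !linearZ /= /GRing.scale /=; ring.
have a0 : 0 <= - (h g2 : R) by rewrite oppr_ge0.
elim: hs e12 => //= h' hs IH [e1 e2]; rewrite {}IH //; congr (_ :: _).
rewrite linearD !linearZ /= /GRing.scale /=.
have [p|n] := ltP 0 (h' g1 : R).
  have p2 : 0 < (h' g2 : R) by rewrite -e1.
  by rewrite ltr_wpDl ?mulr_ge0 ?mulr_gt0 // ltW.
have n2' : (h' g2 : R) <= 0 by rewrite leNgt -e1 ltNge n.
by apply/negbTE; rewrite -leNgt; nra.
Qed.

(** The recursion of hyperplane arrangements: adding a form [h] creates at most as many new patterns
    as there are on the kernel of [h], since a pattern that extends in both ways is realized on that
    kernel, of smaller dimension unless [h] is nowhere positive on [U]. *)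
Lemma pattern_list hs U : exists L : seq (seq bool),
  (size L <= (size hs).+1 ^ \dim U)%N /\ forall g, g \in U -> pattern hs g \in L.
Proof.
elim: hs U => [|h hs IH] U.
  by exists [:: [::]]; split=> [|g _]; rewrite ?exp1n ?inE.
have [L1 [s1 m1]] := IH U.
have [[g0 [g0U g0p]]|none] := pselect (exists g, g \in U /\ (0 : R) < h g); last first.
  exists [seq false :: b | b <- L1]; split.
    by rewrite size_map (leq_trans s1) // leq_expl.
  move=> g gU; rewrite /=; have -> : (0 < (h g : R)) = false.
    by apply/negP => p; apply: none; exists g.
  by apply/mapP; exists (pattern hs g); rewrite ?m1.
have [L2 [s2 m2]] := IH (U :&: lker h)%VS.
(* A tail pattern is prefixed by [true] as soon as some function realizes it with [h] positive. If
   another one realizes it with [h] nonpositive, the extension by [false] comes from [L2]. *)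
pose hd b := `[< exists g, [/\ g \in U, (0 : R) < (h g : R) & pattern hs g = b] >].
exists ([seq hd b :: b | b <- L1] ++ [seq false :: b | b <- L2]); split.
  rewrite size_cat !size_map.
  have dlt : (\dim (U :&: lker h) < \dim U)%N.
    rewrite ltn_neqAle dimvS ?capvSl // andbT; apply: contraTneq g0p => /eqP.
    rewrite (dimv_leqif_eq (capvSl _ _)) => /eqP e; move: g0U; rewrite -e.
    by rewrite memv_cap memv_ker => /andP[_ /eqP ->]; rewrite ltxx.
  case: (\dim U) dlt s1 => // D dlt s1.
  have {}s2 : (size L2 <= (size hs).+1 ^ D)%N.
    by apply: leq_trans s2 _; rewrite leq_pexp2l.
  apply: leq_trans (leq_add s1 s2) _ => /=.
  exact: expnS_add.
move=> g gU; rewrite mem_cat /=.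
have [hg|hg] := ltP 0 (h g : R).
  apply/orP; left; apply/mapP; exists (pattern hs g); first exact: m1.
  by congr (_ :: _); symmetry; apply/asboolP; exists g.
case hdE : (hd (pattern hs g)); last first.
  by apply/orP; left; apply/mapP; exists (pattern hs g); rewrite ?m1 ?hdE.
apply/orP; right; apply/mapP; exists (pattern hs g) => //.
move: hdE => /asboolP[g1 [g1U p1 e1]].
have [a [b [k0 e]]] := pattern_convex e1 p1 hg.
rewrite -e1 -e; apply: m2; rewrite memv_cap memv_ker k0 eqxx andbT.
by rewrite rpredD // rpredZ.
Qed.

End Patterns.

(** * Counting the spans of subfamilies *)

Section Spans.
Variables (K : fieldType) (W : vectType K) (T : finType) (ev : T -> W).

Definition span_of (s : seq T) : {vspace W} := <<[seq ev t | t <- s]>>%VS.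

Lemma free_subseq (s : seq T) : exists s' : seq T,
  [/\ {subset s' <= s}, (size s' <= \dim {:W})%N & span_of s' = span_of s].
Proof.
suff [s' [ss fr e]] : exists s' : seq T,
    [/\ {subset s' <= s}, free [seq ev t | t <- s'] & span_of s' = span_of s].
  exists s'; split=> //; move: fr; rewrite /free size_map => /eqP <-.
  by rewrite dimvS ?subvf.
elim: s => [|t s [s' [ss fr e]]]; first by exists [::]; split; rewrite ?nil_free.
have [ts|nts] := boolP (ev t \in span_of s).
  exists s'; split=> //; first by move=> x /ss xs; rewrite inE xs orbT.
  rewrite e /span_of /= span_cons; apply/esym/addv_idPr; rewrite -memvE.
  exact: ts.
exists (t :: s'); split.
- by move=> x; rewrite !inE => /orP[->//|/ss ->]; rewrite orbT.
- by rewrite /= free_cons fr andbT -/(span_of s') e.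
- by rewrite /span_of /= !span_cons -!/(span_of _) e.
Qed.

(** A free subfamily has at most [\dim {:W}] members; padding with [None] encodes it as a tuple of
    that length. *)
Lemma span_list : exists L : seq {vspace W},
  (size L <= #|T|.+1 ^ \dim {:W})%N /\ forall s, span_of s \in L.
Proof.
set D := \dim {:W}.
exists [seq span_of (pmap id (tval t)) | t : D.-tuple (option T)]; split.
  by rewrite size_map -cardE card_tuple card_option.
move=> s; have [s' [_ sz <-]] := free_subseq s.
have szt : size ([seq Some t | t <- s'] ++ nseq (D - size s') None) == D.
  by rewrite size_cat size_map size_nseq subnKC.
apply/mapP; exists (Tuple szt); first by rewrite mem_enum.
congr span_of => /=; rewrite pmap_cat.
have -> : pmap id (nseq (D - size s') (@None T)) = [::] by elim: (D - _)%N.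
by rewrite cats0; elim: (s') => //= a l <-.
Qed.

End Spans.

(** * Counting small fillings mod 2 *)

Section Fillings.
Variables (T E : finType) (eds : T -> {set E}) (q : nat).
Hypothesis eds3 : forall t, #|eds t| = 3%N.
Hypothesis eds_inj : forall e e' t t', e != e' -> e \in eds t -> e' \in eds t ->
  e \in eds t' -> e' \in eds t' -> t = t'.
Hypothesis eds_codeg : forall e, (#|[set t | e \in eds t]| <= q)%N.

Definition vec := {ffun E -> ('F_2)^o}.
Implicit Types (z : vec) (y : {set T}).

Definition ev (t : T) : vec := [ffun e => (e \in eds t)%:R].
Definition bd y : vec := \sum_(t in y) ev t.
Definition supp z : {set E} := [set e | z e != 0].
Arguments supp z%_ring_scope.

Lemma vec_addK z : z + z = 0.
Proof. by apply/ffunP => e; rewrite !ffunE; apply/eqP; case: (z e) => -[|[|]]. Qed.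

Lemma suppD_ev z t : supp (z + ev t) = (supp z :\: eds t) :|: (eds t :\: supp z).
Proof.
apply/setP => e; rewrite !inE !ffunE negbK.
case: (e \in eds t); rewrite ?addr0 ?andbF ?andbT ?orbF //=.
by case: (z e) => -[|[|]].
Qed.

Lemma card_suppD z t :
  (#|supp (z + ev t)| + 2 * #|supp z :&: eds t| = #|supp z| + 3)%N.
Proof.
rewrite suppD_ev cardsU.
have -> : (supp z :\: eds t) :&: (eds t :\: supp z) = set0.
  by apply/setP => e; rewrite !inE; case: (e \in eds t); rewrite ?andbF.
rewrite cards0 subn0 -(eds3 t) -(cardsID (eds t) (supp z)) -(cardsID (supp z) (eds t)).
by rewrite (setIC (eds t) (supp z)); lia.
Qed.

Lemma supp_eq0 z : (supp z == set0) = (z == 0).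
Proof.
apply/eqP/eqP => [s0|->]; last by apply/setP => e; rewrite !inE ffunE eqxx.
apply/ffunP => e; apply/eqP; rewrite ffunE; have := in_set0 e.
by rewrite -s0 inE => /negbFE.
Qed.

Lemma bdU1 t y : t \notin y -> bd (t |: y) = ev t + bd y.
Proof. exact: big_setU1. Qed.

Lemma card_supp_bd y : (#|supp (bd y)| <= 3 * #|y|)%N.
Proof.
have [n] := ubnP #|y|; elim: n y => // n IH y yn.
have [->|/set0Pn[t ty]] := eqVneq y set0.
  by rewrite /bd big_set0 (eqP (_ : supp 0 == set0)) ?cards0 ?supp_eq0.
have yt : t \notin y :\ t by rewrite !inE eqxx.
rewrite -(setD1K ty) bdU1 // cardsU1 yt addrC.
have := card_suppD (bd (y :\ t)) t; have : (#|supp (bd (y :\ t))| <= 3 * #|y :\ t|)%N.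
  by apply: IH; move: yn; rewrite (cardsD1 t) ty.
rewrite /nat_of_bool; move: #|_| #|_| #|_| #|_| => *; lia.
Qed.

(** Minimal fillings are acyclic, so counting these suffices, and the count then stops as soon as
    the remaining boundary is zero. *)
Definition acyclic y := [forall y0 : {set T}, (y0 \subset y) && (bd y0 == 0) ==> (y0 == set0)].

Definition fillings r z := [set y : {set T} | [&& #|y| == r, bd y == z & acyclic y]].
Arguments fillings r%_nat_scope z%_ring_scope.

Lemma acyclicS y y' : y' \subset y -> acyclic y -> acyclic y'.
Proof.
move=> sub /forallP ac; apply/forallP => y0; apply/implyP => /andP[s b].
by have /implyP := ac y0; apply; rewrite b (subset_trans s).
Qed.

Lemma minimal_filling y z : bd y = z -> exists2 y' : {set T}, y' \subset y & bd y' = z /\ acyclic y'.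
Proof.
move=> yz; pose P (y' : {set T}) := (y' \subset y) && (bd y' == z).
have Py : P y by rewrite /P subxx yz eqxx.
case: (arg_minnP (fun y' : {set T} => #|y'|) Py) => y' /andP[sub /eqP b] mn.
exists y' => //; split=> //; apply/forallP => y0; apply/implyP => /andP[s /eqP b0].
have /mn : P (y' :\: y0).
  rewrite /P (subset_trans (subsetDl _ _) sub) /= -b.
  have : bd y' = bd (y' :&: y0) + bd (y' :\: y0) by rewrite /bd (big_setID y0).
  by rewrite (setIidPr s) b0 add0r => ->.
have := cardsID y0 y'; rewrite (setIidPr s) -cards_eq0; lia.
Qed.

Lemma card_fillings0 z : (#|fillings 0 z| <= (z == 0%R))%N.
Proof.
have sub : fillings 0 z \subset (if z == 0 then [set set0] else set0).
  apply/subsetP => y; rewrite inE => /and3P[/eqP/cards0_eq -> /eqP <- _].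
  by rewrite /bd big_set0 eqxx inE.
by apply: leq_trans (subset_leq_card sub) _; case: ifP; rewrite ?cards1 ?cards0.
Qed.

Lemma card_fillingsS0 r : #|fillings r.+1 0| = 0%N.
Proof.
apply/eqP; rewrite cards_eq0; apply/eqP/setP => y; rewrite !inE; apply/negbTE.
apply/negP => /and3P[/eqP yr b /forallP ac].
have /implyP := ac y; rewrite subxx b => /(_ isT) /eqP y0.
by move: yr; rewrite y0 cards0.
Qed.

Lemma card_fillingsS r z e : z e != 0 ->
  (#|fillings r.+1 z| <= \sum_(t | e \in eds t) #|fillings r (z + ev t)|)%N.
Proof.
move=> ze.
have sub : fillings r.+1 z \subset \bigcup_(t | e \in eds t) [set t |: y' | y' in fillings r (z + ev t)].
  apply/subsetP => y; rewrite inE => /and3P[/eqP yr /eqP b ac].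
  have [t ty et] : exists2 t, t \in y & e \in eds t.
    apply/exists_inP; apply: contraNT ze; rewrite negb_exists_in => /forall_inP none.
    rewrite -b /bd sum_ffunE big1 // => t ty; rewrite ffunE.
    by rewrite (negbTE (none t ty)).
  apply/bigcupP; exists t => //; apply/imsetP; exists (y :\ t); last by rewrite setD1K.
  rewrite inE (acyclicS (subD1set _ _) ac) andbT; apply/andP; split.
    by have := cardsD1 t y; rewrite ty yr add1n => -[->].
  rewrite -b -{2}(setD1K ty) bdU1; last by rewrite !inE eqxx.
  by rewrite addrAC vec_addK add0r.
apply: leq_trans (subset_leq_card sub) _.
elim/big_rec2: _ => [|t s A et IH]; first by rewrite cards0.
apply: leq_trans (leq_card_setU _ _) _; apply: leq_add => //.
exact: leq_imset_card.
Qed.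

(** Induction on [r], with an edge [e] of the support. Some triple [t] of the filling contains [e],
    and removing it leaves a filling of [z + ev t]. If [e] is the only edge of [t] in the support,
    the support grows by one while [r] drops by one, so the exponent of [kap] is unchanged; there
    are at most [q] such [t]. Any other [t] is determined by a second edge of the support, which has
    at most [3 m] edges, and costs at most [kap ^ 4]. By [3 m kap ^ 4 <= q] the total is at most
    [2 q]. *)
Lemma card_fillings (kap m r : nat) z : (0 < kap)%N -> (3 * m * kap ^ 4 <= q)%N -> (r <= m)%N ->
  (#|fillings r z| * kap ^ (#|supp z| + r) <= (2 * q) ^ r)%N.
Proof.
move=> k0 mq; elim: r z => [|r IH] z rm.
  have := card_fillings0 z; case: eqP => [->|_] /= le1.
    rewrite (eqP (_ : supp 0 == set0)) ?supp_eq0 // cards0 /= muln1; exact: le1.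
  by move: le1; rewrite leqn0 => /eqP ->.
have [->|z0] := eqVneq z 0; first by rewrite card_fillingsS0.
have [big|small] := ltnP (3 * r.+1) #|supp z|.
  rewrite (_ : #|_| = 0%N) //; apply/eqP; rewrite cards_eq0; apply/eqP/setP => y.
  rewrite !inE; apply/negbTE/negP => /and3P[/eqP yr /eqP b _].
  by move: big; rewrite -b -yr ltnNge card_supp_bd.
have /set0Pn[e] : supp z != set0 by rewrite supp_eq0.
rewrite inE => ze.
apply: leq_trans (leq_mul (card_fillingsS r ze) (leqnn _)) _.
rewrite big_distrl /=.
pose old t := #|supp z :&: eds t| != 1%N.
have bnd t : e \in eds t -> (#|fillings r (z + ev t)| * kap ^ (#|supp z| + r.+1) <=
    (2 * q) ^ r * (if old t then kap ^ 4 else 1))%N.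
  move=> et; have IHt := IH (z + ev t) (ltnW rm); have c := card_suppD z t.
  have i1 : (0 < #|supp z :&: eds t|)%N.
    by apply/card_gt0P; exists e; rewrite !inE ze.
  have i3 : (#|supp z :&: eds t| <= 3)%N by rewrite -(eds3 t) subset_leq_card // subsetIr.
  rewrite /old; case: eqP => /= i.
    rewrite muln1; apply: leq_trans IHt; rewrite leq_mul2l leq_pexp2l ?orbT //; lia.
  apply: leq_trans (leq_mul IHt (leqnn _)); rewrite -mulnA -expnD.
  rewrite leq_mul2l leq_pexp2l ?orbT //; lia.
apply: (@leq_trans (\sum_(t | e \in eds t) (2 * q) ^ r * (if old t then kap ^ 4 else 1))%N).
  exact: leq_sum.
rewrite -big_distrr /= (expnS _ r) [leqLHS]mulnC leq_mul2r; apply/orP; right.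
have old_le : (#|[set t | (e \in eds t) && old t]| <= #|supp z|)%N.
  (* A second edge of [t] in the support; the default [e] does not occur for an [old] triple
     containing [e]. *)
  pose other t := odflt e [pick e' | (e' != e) && (e' \in supp z :&: eds t)].
  have otherP t : (e \in eds t) && old t ->
      [/\ other t != e, other t \in supp z & other t \in eds t].
    case/andP=> et ot; rewrite /other; case: pickP => [e' /andP[ne]|none] /=.
      by rewrite inE => /andP[].
    case/negP: ot; apply/cards1P; exists e; apply/setP => e'; rewrite in_set1.
    have [->|ne] := eqVneq e' e; first by rewrite !inE ze.
    by have := none e'; rewrite ne /= => ->.
  have inj : {in [set t | (e \in eds t) && old t] &, injective other}.
    move=> t t'; rewrite !inE => h h' oo.
    have [ne _ o1] := otherP t h; have [_ _ o2] := otherP t' h'.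
    case/andP: h => et _; case/andP: h' => et' _.
    by apply: (eds_inj ne) => //; rewrite oo.
  rewrite -(card_in_imset inj); apply: subset_leq_card.
  apply/subsetP => e' /imsetP[t].
  by rewrite inE => h ->; case: (otherP t h).
apply: (@leq_trans (\sum_(t | e \in eds t) 1 + \sum_(t | (e \in eds t) && old t) kap ^ 4)%N).
  rewrite [X in (_ <= _ + X)%N]big_mkcondr -big_split /=; apply: leq_sum => t _.
  by case: (old t); rewrite ?leq_addl ?addn0.
rewrite sum1_card sum_nat_const mul2n -addnn leq_add //.
  by have := eds_codeg e; rewrite cardsE.
apply: leq_trans mq; rewrite leq_mul2r; apply/orP; right.
rewrite -cardsE; apply: leq_trans old_le _; apply: leq_trans small _.
by rewrite leq_mul2l rm orbT.
Qed.

End Fillings.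

(** * Moments of a random subset, multiplied by the number of colorings *)

Section RandomSubset.
Variables (T : finType) (Q' : nat).
Notation Q := Q'.+1.
Notation coloring := {ffun T -> 'I_Q}.

(* A uniformly random coloring makes [chosen] a random subset of density 1 / Q. *)
Definition chosen (c : coloring) : {set T} := [set t | c t == ord0].

Let N : rat := (Q ^ #|T|)%:R.

Lemma sum_coloring (g : T -> 'I_Q -> rat) :
  \sum_(c : coloring) \prod_t g t (c t) = \prod_t \sum_a g t a.
Proof. by rewrite bigA_distr_bigA. Qed.

Lemma sum_on_zero (x : rat) : \sum_(a < Q) (if a == ord0 then x else 1) = x + Q%:R - 1.
Proof.
rewrite big_ord_recl eqxx (eq_bigr (fun=> 1)) => [|i _]; last by [].
by rewrite sumr_const card_ord -natr1; ring.
Qed.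

Lemma prod_split (P : {set T}) (x y : rat) :
  \prod_t (if t \in P then x else y) = x ^+ #|P| * y ^+ #|~: P|.
Proof.
rewrite (bigID (mem P)) /=; congr (_ * _).
  by rewrite (eq_bigr (fun=> x)) ?prodr_const // => t ->.
rewrite (eq_bigr (fun=> y)) => [|t /negbTE -> //].
by rewrite -prodr_const; apply: eq_bigl => t; rewrite inE.
Qed.

Lemma sum_contains (y : {set T}) :
  \sum_(c : coloring) (y \subset chosen c)%:R = N / Q%:R ^+ #|y|.
Proof.
rewrite (eq_bigr (fun c : coloring => \prod_t (if t \in y then (c t == ord0)%:R else 1))); last first.
  move=> c _; have [sub|nsub] := boolP (y \subset chosen c).
    rewrite big1 // => t _; case: ifP => // ty.
    by have := subsetP sub t ty; rewrite inE => ->.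
  case/subsetPn: nsub => t ty; rewrite inE => nc.
  by rewrite (bigD1 t) //= ty (negbTE nc) mul0r.
rewrite (sum_coloring (fun t a => if t \in y then (a == ord0)%:R else 1)).
rewrite (eq_bigr (fun t => if t \in y then 1 else Q%:R)) => [|t _]; last first.
  case: ifP => _; last by rewrite sumr_const card_ord.
  by rewrite (bigD1 ord0) //= big1 ?addr0 // => i /negbTE ->.
rewrite prod_split expr1n mul1r /N -(cardsC y) natrX exprD.
by rewrite mulrAC divff ?mul1r // expf_neq0 // pnatr_eq0.
Qed.

Lemma sum_card_chosen : \sum_(c : coloring) #|chosen c|%:R = N * #|T|%:R / Q%:R.
Proof.
transitivity (\sum_(c : coloring) \sum_t ([set t] \subset chosen c)%:R : rat).
  apply: eq_bigr => c _; rewrite -sum1_card natr_sum [LHS]big_mkcond /=.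
  by apply: eq_bigr => t _; rewrite sub1set; case: ifP.
rewrite exchange_big /= (eq_bigr (fun=> N / Q%:R)) => [|t _]; last first.
  by rewrite sum_contains cards1 expr1.
by rewrite sumr_const -[LHS]mulr_natr mulrAC.
Qed.

(** The exponential moment behind the lower tail bound of [sum_missed]. *)
Lemma sum_hits (P : {set T}) :
  \sum_(c : coloring) (2^-1 : rat) ^+ #|chosen c :&: P| =
  N * (1 - (2 * Q%:R)^-1) ^+ #|P|.
Proof.
rewrite (eq_bigr (fun c : coloring => \prod_t (if t \in P then if c t == ord0 then 2^-1 else 1 else 1)));
  last first.
  move=> c _; rewrite -prodr_const [LHS]big_mkcond /=; apply: eq_bigr => t _.
  by rewrite !inE; case: (t \in P); rewrite ?andbF ?andbT.
rewrite (sum_coloring (fun t a => if t \in P then if a == ord0 then 2^-1 else 1 else 1)).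
rewrite (eq_bigr (fun t => if t \in P then Q%:R * (1 - (2 * Q%:R)^-1) else Q%:R)) => [|t _]; last first.
  case: ifP => _; last by rewrite sumr_const card_ord.
  have : (Q%:R : rat) != 0 by rewrite pnatr_eq0.
  by rewrite sum_on_zero; move: (Q%:R : rat) => x x0; field.
rewrite prod_split /N -(cardsC P) natrX exprD exprMn.
by ring.
Qed.

(** With [x = 1 / (2 Q)], Bernoulli gives [(1 + x) ^ (2 Q) >= 2], and [(1 - x) (1 + x) <= 1]. *)
Lemma half_power g : (1 - (2 * Q%:R)^-1 : rat) ^+ (2 * Q * g) <= 2^-1 ^+ g.
Proof.
rewrite exprM; have Q0 : 0 < (2 * Q%:R : rat) by rewrite mulr_gt0 // ltr0n.
have Q2 : (2 <= 2 * Q%:R :> rat) by rewrite ler_peMr // ler1n.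
have x0 : 0 < (2 * Q%:R)^-1 :> rat by rewrite invr_gt0.
have x1 : (2 * Q%:R)^-1 <= 2^-1 :> rat by rewrite lef_pV2 ?posrE.
have xQ : 2 * Q%:R * (2 * Q%:R)^-1 = 1 :> rat by rewrite divff // gt_eqF.
move: ((2 * Q%:R)^-1 : rat) x0 x1 xQ => x x0 x1 xQ.
have px : 0 <= 1 - x by lra.
apply: lerXn2r; rewrite ?nnegrE ?exprn_ge0 //.
have bern n : 1 + n%:R * x <= (1 + x) ^+ n.
  elim: n => [|n IH]; first by rewrite mul0r addr0 expr0.
  rewrite exprS -natr1; have n0 : 0 <= n%:R :> rat by rewrite ler0n.
  have := ler_wpM2l (_ : 0 <= 1 + x) IH; nra.
have two : 2 <= (1 + x) ^+ (2 * Q).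
  apply: le_trans (bern _); by rewrite natrM xQ.
have prod1 : (1 - x) ^+ (2 * Q) * (1 + x) ^+ (2 * Q) <= 1.
  by rewrite -exprMn exprn_ile1 //; nra.
have p0 : 0 <= (1 - x) ^+ (2 * Q) by rewrite exprn_ge0.
nra.
Qed.

Lemma N_gt0 : 0 < N.
Proof. by rewrite ltr0n expn_gt0. Qed.

End RandomSubset.

(** * The first moment argument *)

Section Existence.
Variables (T E : finType) (eds : T -> {set E}) (q : nat).
Hypothesis eds3 : forall t, #|eds t| = 3%N.
Hypothesis eds_inj : forall e e' t t', e != e' -> e \in eds t -> e' \in eds t ->
  e \in eds t' -> e' \in eds t' -> t = t'.
Hypothesis eds_codeg : forall e, (#|[set t | e \in eds t]| <= q)%N.
Variables (Q' kap m g h : nat) (PP : seq {set T}).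
Notation Q := Q'.+1.
Hypothesis T0 : (0 < #|T|)%N.
Hypothesis kap0 : (0 < kap)%N.
Hypothesis kapq : (3 * m * kap ^ 4 <= q)%N.
Hypothesis kapQ : (2 * q <= kap * Q)%N.
Hypothesis kapm : (64 * m <= kap ^ 3)%N.
Hypothesis PPg : (size PP * 2 ^ (h + 3) <= 2 ^ g)%N.

Let N : rat := (Q ^ #|T|)%:R.
Let N0 : 0 < N := N_gt0 T Q'.
Let Q0 : 0 < (Q%:R : rat) := ltr0Sn _ _.
Let TR : 0 < (#|T|%:R : rat).
Proof. by rewrite ltr0n. Qed.

Definition fillable (S : {set T}) t :=
  [exists y : {set T}, [&& y \subset S, (#|y| <= m)%N & bd eds y == ev eds t]].

Lemma fillable_le (S : {set T}) t : (fillable S t)%:R <=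
  \sum_(1 <= r < m.+1) \sum_(y in fillings eds r (ev eds t)) (y \subset S)%:R :> rat.
Proof.
have [/existsP[y /and3P[yS ym /eqP yb]]|_] := boolP (fillable S t); last first.
  by apply: sumr_ge0 => r _; apply: sumr_ge0 => y _; rewrite ler0n.
have [y' sub [b ac]] := minimal_filling yb.
have y'0 : (0 < #|y'|)%N.
  rewrite lt0n cards_eq0; apply/eqP => y0; move: b; rewrite y0 /bd big_set0 => e0.
  have /card_gt0P[e et] : (0 < #|eds t|)%N by rewrite eds3.
  by have := congr1 (fun z : vec E => z e) e0; rewrite !ffunE et.
have y'm : (#|y'| < m.+1)%N by rewrite ltnS (leq_trans (subset_leq_card sub)).
rewrite (bigD1_seq #|y'|) ?mem_index_iota ?y'0 ?iota_uniq //=.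
rewrite (bigD1 y') /=; last by rewrite inE eqxx b eqxx ac.
rewrite (subset_trans sub yS) -addrA lerDl addr_ge0 //.
  by apply: sumr_ge0 => y1 _; rewrite ler0n.
by apply: sumr_ge0 => r _; apply: sumr_ge0 => y1 _; rewrite ler0n.
Qed.

(** The mean number of fillings of size [r] inside the random set: there are at most
    [(2 q / kap) ^ r / kap ^ 3] candidates, the 3 being the support of [ev t], each is present with
    probability [1 / Q ^ r], and [2 q <= kap Q]. *)
Lemma fillings_weight r t : (0 < r <= m)%N ->
  #|fillings eds r (ev eds t)|%:R / Q%:R ^+ r <= (kap%:R ^+ 3)^-1 :> rat.
Proof.
case/andP=> r0 rm; have K0 : 0 < kap%:R :> rat by rewrite ltr0n.
have := card_fillings eds3 eds_inj eds_codeg (ev eds t) kap0 kapq rm.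
have -> : #|supp (ev eds t)| = 3%N.
  by rewrite -(eds3 t); apply: eq_card => e; rewrite !inE ffunE; case: (e \in eds t).
move=> c; rewrite ler_pdivrMr ?exprn_gt0 // ler_pdivlMl ?exprn_gt0 //.
rewrite -(ler_pM2r (exprn_gt0 r K0)) -!natrX -!natrM ler_nat.
apply: (@leq_trans ((2 * q) ^ r)); last by rewrite -expnMn leq_expl // [leqRHS]mulnC.
by move: c; rewrite expnD mulnA [(kap ^ 3 * _)%N]mulnC.
Qed.

Lemma sum_fillable : \sum_(c : {ffun T -> 'I_Q}) \sum_t (fillable (chosen c) t)%:R
  <= N * #|T|%:R / 64%:R :> rat.
Proof.
rewrite exchange_big /=; apply: le_trans (_ : \sum_(t : T) (N / 64%:R) <= _); last first.
  by rewrite sumr_const -[leLHS]mulr_natr mulrAC.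
apply: ler_sum => t _.
apply: le_trans (ler_sum _ (fun c _ => fillable_le (chosen c) t)) _.
rewrite exchange_big /=.
apply: le_trans (_ : \sum_(1 <= r < m.+1) N / kap%:R ^+ 3 <= _).
  rewrite big_nat [X in _ <= X]big_nat; apply: ler_sum => r r1.
  rewrite exchange_big /=.
  rewrite (eq_bigr (fun=> N / Q%:R ^+ r)); last first.
    by move=> y; rewrite inE => /andP[/eqP <- _]; rewrite sum_contains.
  rewrite sumr_const -[leLHS]mulr_natl mulrCA ler_pM2l //.
  by apply: fillings_weight; move: r1; rewrite ltnS.
rewrite sumr_const_nat subn1 -[m.+1.-1]/m -(mulr_natr _ m) -mulrA (ler_pM2l N0).
rewrite ler_pdivrMl ?exprn_gt0 ?ltr0n // ler_pdivlMr // -natrX -natrM ler_nat mulnC.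
exact: kapm.
Qed.

Definition missed (S : {set T}) (P : {set T}) := (2 * Q * g <= #|P|)%N && (#|S :&: P| <= h)%N.

(** Markov's inequality for [2 ^ (h - |S :&: P|)], whose mean is at most [2 ^ (h - g)] once [P] has
    [2 Q g] elements; the union over [PP] then costs at most [1 / 8] by [PPg]. *)
Lemma sum_missed : \sum_(c : {ffun T -> 'I_Q}) \sum_(P <- PP) (missed (chosen c) P)%:R
  <= N / 8%:R :> rat.
Proof.
rewrite exchange_big /=.
apply: le_trans (_ : \sum_(P <- PP) N * (2 ^+ h * 2^-1 ^+ g) <= _).
  apply: ler_sum => P _; rewrite /missed.
  case: (leqP (2 * Q * g) #|P|) => [gP|_] /=; last first.
    by rewrite big1 // mulr_ge0 ?mulr_ge0 ?exprn_ge0 ?invr_ge0 // ltW.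
  apply: le_trans (_ : \sum_(c : {ffun T -> 'I_Q}) 2 ^+ h * (2^-1 : rat) ^+ #|chosen c :&: P| <= _).
    apply: ler_sum => c _; case: leqP => [le|_]; last by rewrite mulr_ge0 ?exprn_ge0.
    rewrite exprVn ler_pdivlMr ?exprn_gt0 // mul1r.
    by rewrite ler_weXn2l // ler1n.
  rewrite -mulr_sumr sum_hits mulrCA ler_pM2l // ler_pM2l ?exprn_gt0 //.
  apply: le_trans (half_power Q' g).
  have x1 : (2 * Q%:R)^-1 <= 2^-1 :> rat by rewrite lef_pV2 ?posrE ?mulr_gt0 // ler_peMr // ler1n.
  have x0 : 0 < (2 * Q%:R)^-1 :> rat by rewrite invr_gt0 mulr_gt0.
  move: ((2 * Q%:R)^-1 : rat) x0 x1 => x x0 x1.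
  by apply: ler_wiXn2l => //; lra.
rewrite big_const_seq count_predT iter_addr_0 -[leLHS]mulr_natr -mulrA ler_pM2l //.
rewrite exprVn mulrAC ler_pdivrMr ?exprn_gt0 // ler_pdivlMl //.
rewrite -!natrX -!natrM ler_nat (_ : 8 = 2 ^ 3)%N // mulnA -expnD mulnC addnC.
exact: PPg.
Qed.

Theorem exists_subset : exists S : {set T},
  [/\ (#|S| * Q <= 4 * #|T|)%N,
      forall P, P \in PP -> (2 * Q * g <= #|P|)%N -> (h < #|S :&: P|)%N &
      (8 * #|[set t | fillable S t]| <= #|T|)%N].
Proof.
apply: contrapT => none.
(* Each failure of a required property makes its term at least 1, while the means of the terms are
   at most 1/4, 1/8 and 8/64, of sum 1/2. *)
pose bad (c : {ffun T -> 'I_Q}) : rat := #|chosen c|%:R * Q%:R / (4 * #|T|%:R) +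
  \sum_(P <- PP) (missed (chosen c) P)%:R +
  8 / #|T|%:R * \sum_t (fillable (chosen c) t)%:R.
have nn1 (c : {ffun T -> 'I_Q}) : 0 <= #|chosen c|%:R * Q%:R / (4 * #|T|%:R) :> rat.
  by rewrite divr_ge0 ?mulr_ge0 ?ler0n // ltW.
have nn2 (c : {ffun T -> 'I_Q}) : 0 <= \sum_(P <- PP) (missed (chosen c) P)%:R :> rat.
  by apply: sumr_ge0 => P _; rewrite ler0n.
have nn3 (c : {ffun T -> 'I_Q}) : 0 <= 8 / #|T|%:R * \sum_t (fillable (chosen c) t)%:R :> rat.
  by rewrite mulr_ge0 ?sumr_ge0 ?divr_ge0 // ltW.
have bad1 c : 1 <= bad c.
  rewrite leNgt; apply/negP => lt1; apply: none; exists (chosen c); rewrite /bad in lt1.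
  have := nn1 c; have := nn2 c; have := nn3 c.
  move=> n3 n2 n1; split.
  - have : #|chosen c|%:R * Q%:R / (4 * #|T|%:R) < 1 :> rat by lra.
    by rewrite ltr_pdivrMr ?mulr_gt0 // mul1r -!natrM ltr_nat => /ltnW.
  - move=> P PPP gP; rewrite ltnNge; apply/negP => le.
    have : \sum_(P <- PP) (missed (chosen c) P)%:R < 1 :> rat by lra.
    rewrite ltNge (big_rem P) //= /missed gP le /= lerDl.
    by rewrite sumr_ge0 // => ? _; rewrite ler0n.
  - have : 8 / #|T|%:R * \sum_t (fillable (chosen c) t)%:R < 1 :> rat by lra.
    have -> : \sum_t (fillable (chosen c) t)%:R = #|[set t | fillable (chosen c) t]|%:R :> rat.
      rewrite -sum1_card natr_sum [RHS]big_mkcond /=; apply: eq_bigr => t _.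
      by rewrite inE; case: (fillable _ _).
    by rewrite mulrAC ltr_pdivrMr // mul1r -natrM ltr_nat => /ltnW.
have lo : N <= \sum_c bad c.
  apply: le_trans (_ : \sum_(c : {ffun T -> 'I_Q}) 1 <= _); last exact: ler_sum.
  by rewrite sumr_const card_ffun card_ord.
have hi : \sum_c bad c <= N / 4 + N / 8 + N / 8.
  rewrite /bad !big_split /= -mulr_sumr.
  have -> : \sum_(c : {ffun T -> 'I_Q}) #|chosen c|%:R * Q%:R / (4 * #|T|%:R) = N / 4.
    rewrite -!mulr_suml sum_card_chosen -/N; have := TR; have := Q0.
    by move: (Q%:R : rat) (#|T|%:R : rat) (N) => x y z x0 y0; field; rewrite !gt_eqF.
  apply: lerD; first by rewrite lerD2l sum_missed.
  apply: le_trans (ler_wpM2l _ sum_fillable) _; first by rewrite divr_ge0 // ltW.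
  by rewrite le_eqVlt; apply/orP; left; apply/eqP; field; rewrite gt_eqF.
by have := N0; lra.
Qed.

End Existence.

(** * Random signs *)

Section Rademacher.
Variables (R : realFieldType) (I : finType).
Implicit Types (x : I -> R) (u : {ffun I -> bool}) (s : seq I).

Let M : R := #|{ffun I -> bool}|%:R.

Definition sgn u (i : I) : R := (-1) ^+ u i.
Definition rsum x s u : R := \sum_(i <- s) sgn u i * x i.

Definition flip (j : I) u : {ffun I -> bool} := [ffun i => if i == j then ~~ u i else u i].

Lemma flipK j : involutive (flip j).
Proof. by move=> u; apply/ffunP => i; rewrite !ffunE; case: eqP => _; rewrite ?negbK. Qed.

Lemma sgn_flip j u : sgn (flip j u) j = - sgn u j.
Proof. by rewrite /sgn ffunE eqxx; case: (u j); rewrite /= ?expr0 ?expr1 ?opprK. Qed.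

Lemma rsum_flip j x s u : j \notin s -> rsum x s (flip j u) = rsum x s u.
Proof.
move=> js; rewrite /rsum !big_seq; apply: eq_bigr => i is_; congr (_ * _).
by rewrite /sgn ffunE; case: eqP js => // <-; rewrite is_.
Qed.

Lemma sgn_sqr u i : sgn u i ^+ 2 = 1.
Proof. by rewrite /sgn sqrr_sign. Qed.

Lemma sum_odd j (G : {ffun I -> bool} -> R) : (forall u, G (flip j u) = G u) ->
  \sum_u sgn u j * G u = 0.
Proof.
move=> Gf; have : \sum_u sgn u j * G u = - \sum_u sgn u j * G u.
  rewrite {1}(reindex_inj (inv_inj (flipK j))) -sumrN /=; apply: eq_bigr => u _.
  by rewrite sgn_flip Gf mulNr.
by move=> h; lra.
Qed.

(** Flipping the sign [j] kills the odd powers of [sgn u j]. The fourth moment then gains at most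
    [x ^ 4 + 6 x ^ 2 S], which is below [3 (x ^ 2 + S) ^ 2 - 3 S ^ 2]. *)
Lemma moments x s : uniq s ->
  \sum_u rsum x s u ^+ 2 = M * \sum_(i <- s) x i ^+ 2 /\
  \sum_u rsum x s u ^+ 4 <= 3 * M * (\sum_(i <- s) x i ^+ 2) ^+ 2.
Proof.
elim: s => [_|j s IH /= /andP[js us]].
  have E u : rsum x [::] u = 0 by rewrite /rsum big_nil.
  by split; rewrite big_nil big1 => [|u _]; rewrite ?E ?expr0n ?mulr0 //=.
have [m2 m4] := IH us.
have rE u : rsum x (j :: s) u = sgn u j * x j + rsum x s u by rewrite /rsum big_cons.
have o1 := sum_odd (fun u => rsum_flip x u js).
have o3 : \sum_u sgn u j * rsum x s u ^+ 3 = 0.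
  by apply: sum_odd => u; rewrite rsum_flip.
have sumM : \sum_(u : {ffun I -> bool}) (1 : R) = M by rewrite sumr_const.
set S := \sum_(i <- s) x i ^+ 2 in m2 m4.
have S0 : 0 <= S by apply: sumr_ge0 => i _; exact: sqr_ge0.
have M0 : 0 <= M by rewrite ler0n.
split.
  rewrite big_cons (eq_bigr (fun u => x j ^+ 2 * 1 + 2 * x j * (sgn u j * rsum x s u) +
     rsum x s u ^+ 2)); last by move=> u _; rewrite rE; have := sgn_sqr u j; nra.
  by rewrite !big_split -!mulr_sumr o1 m2 sumM /= -/S; move: (M) (S) => ? ?; ring.
rewrite (eq_bigr (fun u => x j ^+ 4 * 1 + 4 * x j ^+ 3 * (sgn u j * rsum x s u) +
   6 * x j ^+ 2 * rsum x s u ^+ 2 + 4 * x j * (sgn u j * rsum x s u ^+ 3) + rsum x s u ^+ 4)).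
  rewrite !big_split -!mulr_sumr o1 o3 m2 sumM /= big_cons -/S.
  have h : 0 <= M * x j ^+ 4 by rewrite mulr_ge0 // exprn_even_ge0.
  by nra.
move=> u _; rewrite rE; have s2 := sgn_sqr u j.
have s3 : sgn u j ^+ 3 = sgn u j by rewrite exprS s2 mulr1.
have s4 : sgn u j ^+ 4 = 1 by rewrite -[4%N]/(2 * 2)%N exprM s2 expr1n.
transitivity (sgn u j ^+ 4 * x j ^+ 4 + 4 * x j ^+ 3 * (sgn u j ^+ 3 * rsum x s u) +
   6 * x j ^+ 2 * (sgn u j ^+ 2 * rsum x s u ^+ 2) + 4 * x j * (sgn u j * rsum x s u ^+ 3) +
   rsum x s u ^+ 4); first by ring.
by rewrite s2 s3 s4; ring.
Qed.

Definition rademacher x u : R := rsum x (enum I) u.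
Definition sqnorm x : R := \sum_i x i ^+ 2.

Lemma rademacherE x u : rademacher x u = \sum_i sgn u i * x i.
Proof. by rewrite /rademacher /rsum big_enum. Qed.

Lemma sum_rademacher2 x : \sum_u rademacher x u ^+ 2 = M * sqnorm x.
Proof. by have [-> _] := moments x (enum_uniq I); rewrite big_enum. Qed.

Lemma sum_rademacher4 x : \sum_u rademacher x u ^+ 4 <= 3 * M * sqnorm x ^+ 2.
Proof. by have [_] := moments x (enum_uniq I); rewrite big_enum. Qed.

Lemma chebyshev x (rho : R) : 0 < rho ->
  \sum_u (rho ^+ 2 < rademacher x u ^+ 2)%R%:R <= M * sqnorm x / rho ^+ 2.
Proof.
move=> r0; rewrite ler_pdivlMr ?exprn_gt0 // mulr_suml -sum_rademacher2.
apply: ler_sum => u _; case: ltP => [/ltW|_]; rewrite ?mul1r ?mul0r //.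
by rewrite sqr_ge0.
Qed.

(* Paley-Zygmund, through the parabola that is at most 1 and is negative on [0, 1/4]. *)
Lemma paley_zygmund x (rho : R) : 4 * rho ^+ 2 < sqnorm x ->
  3 / 16 * M <= \sum_u (rho ^+ 2 < rademacher x u ^+ 2)%R%:R.
Proof.
set S := sqnorm x => rS; have S0 : 0 < S by apply: le_lt_trans rS; rewrite mulr_ge0 // sqr_ge0.
have M0 : 0 <= M by rewrite ler0n.
have SS : 0 < S ^+ 2 by rewrite exprn_gt0.
rewrite -(ler_pM2l SS) mulr_sumr.
(* The roots of the parabola are [S / 4] and [7 S], its maximum is at [29 S / 8]. By the moments its
   mean is at least [160 / 729 * S ^ 2], above [3 / 16 * S ^ 2]. *)
apply: le_trans (_ : \sum_u (64 / 729) * ((29 / 4) * S * rademacher x u ^+ 2 -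
   rademacher x u ^+ 4 - 7 / 4 * S ^+ 2) <= _); last first.
  apply: ler_sum => u _; set v := rademacher x u ^+ 2.
  have -> : rademacher x u ^+ 4 = v ^+ 2 by rewrite -exprM.
  have v0 : 0 <= v by exact: sqr_ge0.
  case: ltP => h; rewrite ?mulr1 ?mulr0.
    have := sqr_ge0 (v - 29 / 8 * S); nra.
  nra.
rewrite -mulr_sumr !sumrB /= -mulr_sumr sum_rademacher2 sumr_const -[_ *+ _]mulr_natr -/M -/S.
have := sum_rademacher4 x; rewrite -/S => h4.
have MS : 0 <= M * S ^+ 2 by rewrite mulr_ge0 // ltW.
nra.
Qed.

End Rademacher.

(** * From vectors to real cochains by random signs *)

Section Projection.
Variables (R : rcfType) (I T : finType) (x : T -> I -> R) (S : {set T}) (Q : nat).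
Hypothesis T0 : (0 < #|T|)%N.
Hypothesis Q0 : (0 < Q)%N.
Hypothesis SQ : (#|S| * Q <= 4 * #|T|)%N.

Definition exceeds (rho : R) (u : {ffun I -> bool}) : {set T} :=
  [set t | rho ^+ 2 < rademacher (x t) u ^+ 2].

Lemma sum_card_exceeds (A : {set T}) rho :
  \sum_u #|A :&: exceeds rho u|%:R =
  \sum_(t in A) \sum_u (rho ^+ 2 < rademacher (x t) u ^+ 2)%R%:R :> R.
Proof.
rewrite exchange_big /=; apply: eq_bigr => u _.
rewrite -sum1_card natr_sum [LHS]big_mkcond [RHS]big_mkcond /=; apply: eq_bigr => t _.
by rewrite !inE; case: (t \in A) => //=; case: (_ < _).
Qed.

(** Take [rho ^ 2 = 16384 tau], a quarter of the threshold defining [B]. A random signed sum exceeds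
    [rho] with probability at least 3/16 at each triple of [B], but at most 1/16384 at a triple of
    [S]; averaging yields signs that show both effects. *)
Lemma exists_signs (tau : R) : 0 < tau ->
  (forall t, t \in S -> sqnorm (x t) <= tau) ->
  (#|T| <= 2 * #|[set t | ((65536%N)%:R * tau < sqnorm (x t))%R]|)%N ->
  exists rho, exists2 u, 0 < rho &
    (3 * #|T| <= 64 * #|exceeds rho u|)%N /\ (128 * Q * #|S :&: exceeds rho u| <= #|T|)%N.
Proof.
move=> t0 St; set B := [set t | _] => TB.
pose rho := Num.sqrt ((16384%N)%:R * tau).
have rho2 : rho ^+ 2 = (16384%N)%:R * tau by rewrite sqr_sqrtr // mulr_ge0 ?ler0n // ltW.
have rho0 : 0 < rho by rewrite sqrtr_gt0 mulr_gt0 ?ltr0n.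
pose M : R := #|{ffun I -> bool}|%:R.
have M0 : 0 < M by rewrite ltr0n; apply/card_gt0P; exists [ffun=> true].
have TR : 0 < (#|T|%:R : R) by rewrite ltr0n.
have QR : 0 < (Q%:R : R) by rewrite ltr0n.
exists rho; apply: contrapT => none.
(* If no signs work, this holds for all [u]; yet the mean on the left is at least 3/32 of [|T|], and
   the mean on the right at most [3/64 + 192 * 4 / 16384 = 3/32] of it. *)
have bad u : #|B :&: exceeds rho u|%:R < 3 / 64 * #|T|%:R + 192 * Q%:R * #|S :&: exceeds rho u|%:R :> R.
  rewrite ltNge; apply/negP => ge; apply: none; exists u => //.
  have e1 : (#|B :&: exceeds rho u| <= #|exceeds rho u|)%N by rewrite subset_leq_card // subsetIr.
  have e2 : (#|B :&: exceeds rho u| <= #|T|)%N by rewrite max_card.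
  have e3 : 0 <= (#|S :&: exceeds rho u|%:R : R) by rewrite ler0n.
  rewrite -!(ler_nat R) in e1 e2 *; rewrite !natrM.
  have e4 : 0 <= Q%:R * #|S :&: exceeds rho u|%:R :> R by rewrite mulr_ge0 // ltW.
  move: (#|exceeds rho u|%:R : R) (#|B :&: exceeds rho u|%:R : R) ge e1 e2 => v w.
  move=> ge e1 e2.
  by split; nra.
have lo : 3 / 16 * M * #|B|%:R <= \sum_u #|B :&: exceeds rho u|%:R :> R.
  rewrite sum_card_exceeds mulr_natr -sumr_const; apply: ler_sum => t.
  rewrite inE => tB; apply: paley_zygmund; rewrite rho2 (le_lt_trans _ tB) // mulrA -natrM.
  by rewrite ler_pM2r // ler_nat.
have up : \sum_u #|S :&: exceeds rho u|%:R <= M / (16384%N)%:R * #|S|%:R :> R.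
  rewrite sum_card_exceeds mulr_natr -sumr_const; apply: ler_sum => t tS.
  apply: le_trans (chebyshev (x t) rho0) _; rewrite rho2 ler_pdivrMr ?mulr_gt0 ?ltr0n //.
  rewrite [leRHS]mulrA divfK ?pnatr_eq0 // ler_pM2l //; exact: St.
have u0 : {ffun I -> bool} := [ffun=> true].
have : \sum_u #|B :&: exceeds rho u|%:R <
   \sum_u (3 / 64 * #|T|%:R + 192 * Q%:R * #|S :&: exceeds rho u|%:R) :> R.
  by apply: ltr_sum; [apply/hasP; exists u0 => //; rewrite mem_index_enum|move=> u _; exact: bad].
rewrite big_split /= -[X in _ < _ + X]mulr_sumr.
have -> : \sum_(u : {ffun I -> bool}) (3 / 64 * #|T|%:R : R) = 3 / 64 * #|T|%:R * M.
  by rewrite sumr_const [RHS]mulr_natr.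
move: SQ TB; rewrite -!(ler_nat R) !natrM => SQ' TB' lt.
have k1 : 192 * Q%:R * (\sum_u #|S :&: exceeds rho u|%:R) <=
    192 * Q%:R * (M / (16384%N)%:R * #|S|%:R) :> R by rewrite ler_pM2l ?mulr_gt0.
have k2 : M * (#|S|%:R * Q%:R) <= M * (4 * #|T|%:R) by rewrite ler_pM2l.
have k3 : M * #|T|%:R <= M * (2 * #|B|%:R) by rewrite ler_pM2l.
have k0 : 192 * Q%:R * (M / (16384%N)%:R * #|S|%:R) = 192 / (16384%N)%:R * (M * (#|S|%:R * Q%:R)).
  by ring.
rewrite k0 in k1.
have : 192 / (16384%N)%:R * (M * (#|S|%:R * Q%:R)) <= 192 / (16384%N)%:R * (M * (4 * #|T|%:R)).
  by rewrite ler_pM2l // divr_gt0 // ltr0n.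
have -> : 192 / (16384%N)%:R * (M * (4 * #|T|%:R)) = 3 / 64 * (M * #|T|%:R) by field.
move: lo lt k1 k3; rewrite -/M; move: (192 / (16384%N)%:R * (M * (#|S|%:R * Q%:R))) => y.
move: (192 * Q%:R * _) (\sum_u _) (M) (#|B|%:R : R) (#|T|%:R : R) => *. lra.
Qed.

End Projection.

(** * Triples on which coboundaries are controlled *)

Lemma dim_ffun (K : fieldType) (E : finType) : \dim {: {ffun E -> K^o}} = #|E|.
Proof. by rewrite dimvf /dim /= muln1. Qed.

Section GoodTriangles.
Variables (R : rcfType) (T E : finType) (eds : T -> {set E}) (q : nat).
Hypothesis eds3 : forall t, #|eds t| = 3%N.
Hypothesis eds_inj : forall e e' t t', e != e' -> e \in eds t -> e' \in eds t ->
  e \in eds t' -> e' \in eds t' -> t = t'.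
Hypothesis eds_codeg : forall e, (#|[set t | e \in eds t]| <= q)%N.
Variables (Q' kap m h : nat).
Notation Q := Q'.+1.
Notation W := {ffun E -> R^o}.
Variables (cob : T -> 'Hom(W, R^o)) (w1 : W).
(* Thresholds for [cob t] can thus be absorbed into its argument. *)
Hypothesis cob1 : forall t, cob t w1 = 1.
Hypothesis kap0 : (0 < kap)%N.
Hypothesis kapq : (3 * m * kap ^ 4 <= q)%N.
Hypothesis kapQ : (2 * q <= kap * Q)%N.
Hypothesis kapm : (64 * m <= kap ^ 3)%N.
Hypothesis h0 : (0 < h)%N.
Hypothesis Th : #|T| = (128 * Q * h)%N.
Hypothesis TE : (#|T|.+1 ^ (2 * #|E|) * 2 ^ 4 <= 2 ^ (2 * h))%N.

Definition positive_set (w : W) : {set T} := [set t | (0 : R) < (cob t w : R)].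
Definition outside_span (U : {vspace vec E}) : {set T} := [set t | ev eds t \notin U].

Lemma positive_sets : exists L : seq {set T},
  (size L <= #|T|.+1 ^ #|E|)%N /\ forall w, positive_set w \in L.
Proof.
have [L [sL mL]] := pattern_list [seq cob t | t <- enum T] {:W}.
exists [seq [set t | nth false b (enum_rank t)] | b <- L]; split.
  by rewrite size_map (leq_trans sL) // size_map -cardE dim_ffun.
move=> w; apply/mapP; exists (pattern [seq cob t | t <- enum T] w).
  exact/mL/memvf.
apply/setP => t; rewrite !inE /pattern -map_comp (nth_map t) ?nth_enum_rank //.
by rewrite -cardE.
Qed.

Lemma cob_sum (I : finType) (a : I -> W) (u : {ffun I -> bool}) t :
  rademacher (fun i => cob t (a i) : R) u = cob t (\sum_i (sgn R u i : R) *: a i).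
Proof.
by rewrite rademacherE linear_sum; apply: eq_bigr => i _; rewrite linearZ.
Qed.

(** An absolute value exceeds [rho] when one of two opposite values does, and [rho *: w1] shifts
    each comparison with [rho] to one with 0. Hence the unions [A :|: B] in the list [PP] below. *)
Lemma exceeds_positive (I : finType) (a : I -> W) (u : {ffun I -> bool}) rho : 0 < rho ->
  exists w w', exceeds (fun t i => cob t (a i) : R) rho u = positive_set w :|: positive_set w'.
Proof.
move=> r0; pose b : W := \sum_i (sgn R u i : R) *: a i.
exists (b - rho *: w1), (- b - rho *: w1); apply/setP => t; rewrite !inE cob_sum -/b.
have c x : cob t (x - rho *: w1) = (cob t x : R) - rho :> R.
  by rewrite linearB linearZ /= cob1; congr (_ - _); exact: mulr1.
rewrite !c linearN /=; move: (cob t b : R) => v; rewrite !subr_gt0 -[X in _ < X]real_normK ?num_real //.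
by rewrite ltr_pXn2r ?nnegrE ?normr_ge0 ?(ltW r0) // ltr_normr.
Qed.

(** With [g = 3 h] and [|T| = 128 Q h], the size [2 Q g] from which a listed set is hit more than
    [h] times is 3/64 of [|T|]. That is the size provided by [exists_signs], whose other bound
    allows at most [h] hits. *)
Theorem good_triangles : exists S : {set T},
  forall (I : finType) (a : I -> W) (tau : R), 0 < tau ->
  (forall t, t \in S -> \sum_i (cob t (a i) : R) ^+ 2 <= tau) ->
  exists t, [/\ ev eds t \in span_of (ev eds) (enum S), ~~ fillable eds m S t &
                \sum_i (cob t (a i) : R) ^+ 2 <= (65536%N)%:R * tau].
Proof.
have T0 : (0 < #|T|)%N by rewrite Th !muln_gt0 h0.
have [L [sL mL]] := positive_sets.
have [L' [sL' mL']] := span_list (ev eds).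
pose PP := [seq A :|: B | A <- L, B <- L] ++ [seq outside_span U | U <- L'].
have PPg : (size PP * 2 ^ (h + 3) <= 2 ^ (3 * h))%N.
  have sPP : (size PP <= 2 * #|T|.+1 ^ (2 * #|E|))%N.
    rewrite size_cat size_allpairs size_map mul2n -addnn leq_add //.
      by rewrite mul2n -addnn expnD leq_mul.
    rewrite (leq_trans sL') // dim_ffun leq_pexp2l // mul2n -addnn leq_addr //.
  apply: leq_trans (leq_mul sPP (leqnn _)) _.
  have -> : (3 * h = h + 2 * h)%N by lia.
  rewrite (expnD 2 h 3) (expnD 2 h (2 * h)) mulnCA leq_mul2l; apply/orP; right.
  by apply: leq_trans TE; rewrite mulnAC mulnC -expnS.
have [S [SQ Shit Sfill]] := exists_subset eds3 eds_inj eds_codeg T0 kap0 kapq kapQ kapm PPg.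
(* Less than half of the triples violate the last condition, less than 3/64 of them the
   first one and at most 1/8 of them the second one. *)
exists S => I a tau t0 Stau; set U := span_of _ _.
(* [S] is disjoint from the triples outside its own span, so that set must be too small for the
   hitting property to apply. *)
have US : (#|outside_span U| < 2 * Q * (3 * h))%N.
  have UP : outside_span U \in PP.
    by rewrite mem_cat; apply/orP; right; apply/map_f/mL'.
  rewrite ltnNge; apply/negP => /(Shit _ UP); rewrite (_ : S :&: _ = set0) ?cards0 //; apply/setP => t.
  rewrite !inE; apply/negP => /andP[tS /negP]; apply; rewrite /U /span_of memv_span //.
  by apply: map_f; rewrite mem_enum.
pose big := [set t | ((65536%N)%:R * tau < sqnorm (fun i => cob t (a i) : R))%R].
have bigT : (2 * #|big| < #|T|)%N.
  rewrite ltnNge; apply/negP => TB.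
  have [rho [u rho0 [P1 P2]]] := exists_signs T0 (ltn0Sn Q') SQ t0 Stau TB.
  have [w [w' e]] := exceeds_positive a u rho0.
  have /Shit : exceeds (fun t i => cob t (a i) : R) rho u \in PP.
    by rewrite e mem_cat; apply/orP; left; apply: allpairs_f.
  by move: P1 P2; move: #|_ :&: _| #|exceeds _ _ _| Th => v v' -> P1 P2; nia.
have [t tn] : exists t, t \notin outside_span U :|: big :|: [set t | fillable eds m S t].
  apply: contrapT => none.
  have e : outside_span U :|: big :|: [set t | fillable eds m S t] = [set: T].
    by apply/setP => t; rewrite in_setT; apply: contrapT => /negP tn; apply: none; exists t.
  have := leq_card_setU (outside_span U :|: big) [set t | fillable eds m S t].
  have := leq_card_setU (outside_span U) big.
  rewrite e cardsT => -[c1 _] [c2 _]; move: US bigT Sfill c1 c2.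
  move: #|_ :|: _| #|outside_span U| #|big| #|[set t | _]| Th => v1 v2 v3 v4 ->; nia.
exists t; move: tn; rewrite !inE !negb_or negbK -leNgt => /andP[/andP[tU tb] tf].
by split.
Qed.

End GoodTriangles.

(** * The complete tripartite system of triples *)

Section Tripartite.
Variable q : nat.

Definition tritri : finType := ('I_q * 'I_q * 'I_q)%type.
(** The first component tells which two classes are joined: 0 for the first and second, 1 for the
    second and third, 2 for the first and third. *)
Definition triedge : finType := ('I_3 * ('I_q * 'I_q))%type.
Implicit Types (t : tritri) (e : triedge).

Definition ab t : triedge := (0, (t.1.1, t.1.2)).
Definition bc t : triedge := (1, (t.1.2, t.2)).
Definition ac t : triedge := (2%:R, (t.1.1, t.2)).
Definition eds t : {set triedge} := [set ab t; bc t; ac t].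

Lemma eds3 t : #|eds t| = 3%N.
Proof. by rewrite /eds -setUA cardsU1 cards2 !inE. Qed.

Lemma eds_inj e e' t t' : e != e' -> e \in eds t -> e' \in eds t ->
  e \in eds t' -> e' \in eds t' -> t = t'.
Proof.
case: t t' => [[a b] c] [[a' b'] c']; rewrite !inE -!orbA.
by move=> ee' /or3P[]/eqP e1 /or3P[]/eqP e2; move: ee'; rewrite e1 e2 ?eqxx //= => _;
  rewrite /ab /bc /ac !xpair_eqE /= ?orbF => /andP[/eqP ? /eqP ?] /andP[/eqP ? /eqP ?]; subst.
Qed.

Lemma eds_codeg e : (#|[set t | e \in eds t]| <= q)%N.
Proof.
case: e => k [a b].
pose F (c : 'I_q) : tritri := if k == 0 then (a, b, c) else if k == 1 then (c, a, b) else (a, c, b).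
rewrite -[leqRHS]card_ord; apply: leq_trans (leq_imset_card F predT).
apply/subset_leq_card/subsetP => -[[a' b'] c']; rewrite !inE /ab /bc /ac !xpair_eqE /= -!orbA.
move=> /or3P[]/and3P[/eqP k0 /eqP ? /eqP ?]; subst.
- by apply/imsetP; exists c'.
- by apply/imsetP; exists a'.
- by apply/imsetP; exists b'.
Qed.

Variable R : rcfType.
Notation W := {ffun triedge -> R^o}.

Definition coboundary t (w : W) : R^o := w (ab t) + w (bc t) - w (ac t).

Lemma coboundary_linear t : linear (coboundary t).
Proof. by move=> r v w; rewrite /coboundary !ffunE /GRing.scale /=; ring. Qed.

HB.instance Definition _ t := GRing.isLinear.Build R W R^o _ (coboundary t) (coboundary_linear t).

(* With [k = 2 ^ j], the parameters are [q = k ^ 12], the density [1 / k ^ 11] of [S], and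
   [m = k ^ 3]. *)
Lemma tripartite_triangles j : (20 <= j)%N -> q = (2 ^ (12 * j))%N -> exists S : {set tritri},
  forall (I : finType) (w : I -> W) (tau : R), 0 < tau ->
  (forall t, t \in S -> \sum_i coboundary t (w i) ^+ 2 <= tau) ->
  exists t, [/\ ev eds t \in span_of (ev eds) (enum S), ~~ fillable eds (2 ^ (3 * j)) S t &
                \sum_i coboundary t (w i) ^+ 2 <= (65536%N)%:R * tau].
Proof.
move=> j20 qE.
have [Q' QE] : exists Q', Q'.+1 = (2 ^ (11 * j))%N.
  by exists (2 ^ (11 * j)).-1; rewrite prednK // expn_gt0.
have cobE t w : linfun (coboundary t) w = coboundary t w by rewrite lfunE.
have cardT : #|{: tritri}| = (2 ^ (36 * j))%N.
  by rewrite !card_prod !card_ord qE -!expnD; congr (2 ^ _)%N; lia.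
have cardE : #|{: triedge}| = (3 * 2 ^ (24 * j))%N.
  by rewrite !card_prod !card_ord qE -!expnD; congr (3 * 2 ^ _)%N; lia.
(* Here [kap = k ^ 2] and [h = |T| / (128 Q)]. The witness for [w1] is the indicator of the edges of
   kind 0, of which each triple has exactly one. *)
have [||||||||S HS] := @good_triangles R tritri triedge eds q eds3 eds_inj eds_codeg
  Q' (2 ^ (2 * j)) (2 ^ (3 * j)) (2 ^ (25 * j - 7)) (fun t => linfun (coboundary t))
  [ffun e => (e.1 == 0)%:R].
- by move=> t; rewrite cobE /coboundary !ffunE /= addr0 subr0.
- by rewrite expn_gt0.
- rewrite -expnM qE -mulnA -expnD; apply: (@leq_trans (2 ^ 2 * 2 ^ (3 * j + 2 * j * 4))).
    by rewrite leq_mul2r orbT.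
  by rewrite -expnD leq_exp2l //; lia.
- by rewrite QE qE -expnS -expnD leq_exp2l //; lia.
- by rewrite -expnM (_ : 64 = 2 ^ 6)%N // -expnD leq_exp2l //; lia.
- by rewrite expn_gt0.
- by rewrite cardT QE (_ : 128 = 2 ^ 7)%N // -!expnD; congr (2 ^ _)%N; lia.
- rewrite cardT cardE.
  have l1 : ((2 ^ (36 * j)).+1 <= 2 ^ (36 * j + 1))%N.
    by rewrite expnD expn1 muln2 -addnn -addn1 leq_add2l expn_gt0.
  apply: leq_trans (leq_mul (leq_expl _ l1) (leqnn _)) _.
  rewrite -expnM -expnD leq_exp2l //.
  have e : (25 * j - 7 = (j - 7) + 24 * j)%N by lia.
  rewrite e expnD.
  (* After division by [k ^ 24], the union bound compares the logarithm of [|T|], linear in [j],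
     with [k = 2 ^ j]; this is where [j] has to be large. *)
  have jj : (2 * (3 * (36 * j + 1)) + 4 <= 2 * 2 ^ (j - 7))%N.
    have -> : (j = (j - 20) + 20)%N by lia.
    elim: (j - 20)%N => [|i IH]; first by [].
    have -> : (i.+1 + 20 - 7 = (i + 20 - 7).+1)%N by lia.
    by rewrite expnS; lia.
  have : (0 < 2 ^ (24 * j))%N by rewrite expn_gt0.
  move: (2 ^ (24 * j))%N (2 ^ (j - 7))%N jj => u v jj u0; nia.
exists S => I w tau t0 Stau.
have [t tS|t [t1 t2 t3]] := HS I w tau t0.
  by under eq_bigr do rewrite cobE; exact: Stau.
by exists t; split=> //; under eq_bigr do rewrite -cobE.
Qed.

End Tripartite.

(** * The complex *)

Lemma bigminn_le (I : eqType) (r : seq I) (P : pred I) (F : I -> nat) d j :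
  j \in r -> P j -> (\big[minn/d]_(i <- r | P i) F i <= F j)%N.
Proof.
move=> jr Pj; elim: r jr => // a r IH; rewrite inE big_cons => /orP[/eqP <-|jr].
  by rewrite Pj geq_minl.
by case: (P a); rewrite ?geq_min IH ?orbT.
Qed.

Section FillComplex.
Variables (n : nat) (X : {set {set 'I_n}}).
Implicit Types (z : chain X 1) (y : chain X 2).

Definition mk_simplex k (s : {set 'I_n}) (h : (s \in X) && (#|s| == k.+1)) : simplices X k :=
  exist _ s h.

Lemma fill_complex_le y : (fill_complex (chain_boundary y) <= chain_norm y)%N.
Proof. by apply: bigminn_le; rewrite ?mem_index_enum. Qed.

Lemma fill_complex_gt m z : z \in boundaries1 X ->
  (forall y, chain_boundary y = z -> (m < chain_norm y)%N) -> (m < fill_complex z)%N.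
Proof.
case/imsetP=> y0 _ zy0 lb; rewrite /fill_complex.
elim/big_ind: _ => [|a b ma mb|y /eqP /lb //]; last by rewrite leq_min ma.
(* The default value of the minimum is at least the norm of the filling [y0], hence exceeds [m]
   too. *)
by apply: leq_trans (lb y0 _) _; rewrite ?max_card.
Qed.

Lemma chain_boundary0 y : chain_norm y = 0%N -> chain_boundary y = 0.
Proof.
move/eqP; rewrite cards_eq0 => /eqP y0; apply/ffunP => s; rewrite !ffunE big1 // => u _.
by apply/eqP; have := in_set0 u; rewrite -y0 inE => /negbFE.
Qed.

End FillComplex.

Section Complex.
Variables (n q : nat).
Hypothesis qn : (3 * q <= n)%N.
Implicit Types (t : tritri q) (e : triedge q).

Lemma vx_lt (k : 'I_3) (i : 'I_q) : (k * q + i < n)%N.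
Proof. by case: k i => [k k3] [i iq] /=; apply: leq_trans qn; nia. Qed.

Definition vx k i : 'I_n := Ordinal (vx_lt k i).

Lemma vx_mono (k k' : 'I_3) i i' : (k < k')%N -> (vx k i < vx k' i')%N.
Proof. by case: i i' => [i iq] [i' iq'] /=; nia. Qed.

Lemma vx_eq k k' i i' : (vx k i == vx k' i') = (k == k') && (i == i').
Proof.
apply/eqP/andP => [e|[/eqP-> /eqP->] //].
have kk : k = k'.
  apply: val_inj; case: (ltngtP k k') => // h.
    by have := vx_mono i i' h; rewrite e ltnn.
  by have := vx_mono i' i h; rewrite e ltnn.
subst k'; split=> //; apply/eqP/val_inj.
by have := congr1 val e => /= /addnI.
Qed.

Definition tverts t : {set 'I_n} := [set vx 0 t.1.1; vx 1 t.1.2; vx 2%:R t.2].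

Definition everts e : {set 'I_n} :=
  if e.1 == 0 then [set vx 0 e.2.1; vx 1 e.2.2]
  else if e.1 == 1 then [set vx 1 e.2.1; vx 2%:R e.2.2]
  else [set vx 0 e.2.1; vx 2%:R e.2.2].

Lemma card_tverts t : #|tverts t| = 3%N.
Proof. by rewrite /tverts -setUA cardsU1 cards2 !inE !vx_eq. Qed.

Lemma card_everts e : #|everts e| = 2%N.
Proof. by rewrite /everts; do 2?[case: ifP => _]; rewrite cards2 vx_eq. Qed.

Lemma tverts_inj : injective tverts.
Proof.
case=> [[a b] c] [[a' b'] c'] e.
have := setU11 (vx 0 a) [set vx 1 b; vx 2%:R c]; rewrite setUA.
have : vx 1 b \in tverts (a, b, c) by rewrite !inE eqxx orbT.
have : vx 2%:R c \in tverts (a, b, c) by rewrite !inE eqxx orbT.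
rewrite -/(tverts (a, b, c)) e !inE !vx_eq /= ?orbF.
by move=> /eqP -> /eqP -> /eqP ->.
Qed.

Lemma everts_sub e t : (everts e \subset tverts t) = (e \in eds t).
Proof.
case: e t => k [u v] [[a b] c]; rewrite /everts /eds /ab /bc /ac /=.
have [->|k0] := eqVneq k 0.
  by rewrite !inE subUset !sub1set !inE !vx_eq !xpair_eqE /= ?orbF.
have [->|k1] := eqVneq k 1.
  by rewrite !inE subUset !sub1set !inE !vx_eq !xpair_eqE /= ?orbF.
have -> : k = 2%:R by apply: val_inj; case: k k0 k1 => -[|[|[|]]].
by rewrite !inE subUset !sub1set !inE !vx_eq !xpair_eqE /= ?orbF.
Qed.

Lemma sub_everts (s : {set 'I_n}) t : #|s| = 2%N -> s \subset tverts t ->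
  exists e, s = everts e.
Proof.
move=> /eqP/cards2P[x [y [xy ->]]]; case: t => [[a b] c].
rewrite subUset !sub1set !inE -!orbA => /andP[/or3P[]/eqP xE /or3P[]/eqP yE];
  rewrite xE yE ?eqxx // in xy *.
- by exists (0, (a, b)).
- by exists (2%:R, (a, c)).
- by exists (0, (a, b)); rewrite setUC.
- by exists (1, (b, c)).
- by exists (2%:R, (a, c)); rewrite setUC.
- by exists (1, (b, c)); rewrite setUC.
Qed.

Variable S : {set tritri q}.

Definition tricomplex : {set {set 'I_n}} :=
  [set s : {set 'I_n} | (0 < #|s| <= 2)%N || (s \in tverts @: S)].

Lemma tricomplex_simplicial : simplicial_complex tricomplex.
Proof.
split=> [|v|s u].
- rewrite inE cards0 /=; apply/imsetP => -[t _ e].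
  by have := card_tverts t; rewrite -e cards0.
- by rewrite inE cards1.
- rewrite inE => /orP[/andP[_ s2]|/imsetP[t tS ->]] us u0; rewrite inE.
    by rewrite card_gt0 u0 (leq_trans (subset_leq_card us)).
  have [->|ne] := eqVneq u (tverts t); first by rewrite imset_f ?orbT.
  rewrite card_gt0 u0 /= -ltnS -(card_tverts t) proper_card //.
  by rewrite properEneq ne.
Qed.

Lemma tricomplex_skeleton : complete_1skeleton tricomplex.
Proof. by move=> u v uv; rewrite inE cards2 uv. Qed.

Lemma tverts_tricomplex t : t \in S -> tverts t \in tricomplex.
Proof. by move=> tS; rewrite inE imset_f ?orbT. Qed.

Lemma tricomplex_dim t : t \in S -> complex_dim tricomplex = 2%N.
Proof.
move=> tS; rewrite /complex_dim; have -> // : (\max_(s in tricomplex) #|s| = 3)%N.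
apply/eqP; rewrite eqn_leq; apply/andP; split; last first.
  by rewrite -[3%N](card_tverts t)
    (leq_bigmax_cond (F := fun s : {set 'I_n} => #|s|)) ?tverts_tricomplex.
apply/bigmax_leqP => s; rewrite inE => /orP[/andP[_ /leqW //]|/imsetP[t' _ ->]].
by rewrite card_tverts.
Qed.

Lemma triangleP (u : simplices tricomplex 2) : exists2 t, t \in S & val u = tverts t.
Proof.
case: u => s /= /andP[]; rewrite inE => /orP[/andP[_ le] /eqP e|/imsetP[t tS ->] _].
  by rewrite e in le.
by exists t.
Qed.

Definition tchain (c : tritri q -> 'F_2) : chain tricomplex 2 :=
  [ffun u : simplices tricomplex 2 => \sum_(t in S | tverts t == val u) c t].

Lemma tchain_boundary c s : chain_boundary (tchain c) s = \sum_(t in S | val s \subset tverts t) c t.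
Proof.
rewrite ffunE; under eq_bigr do rewrite ffunE.
have tX t : t \in S -> (tverts t \in tricomplex) && (#|tverts t| == 3%N).
  by move=> tS; rewrite tverts_tricomplex // card_tverts.
rewrite (exchange_big_dep (fun t => (t \in S) && (val s \subset tverts t))) /=; last first.
  by move=> u t su /andP[-> /eqP ->].
apply: eq_bigr => t /andP[tS st].
rewrite (big_pred1 (mk_simplex (tX t tS))) // => u /=.
by rewrite tS -[RHS]val_eqE /= [RHS]eq_sym; case: eqP => [<-|_]; rewrite ?andbF ?andbT.
Qed.

Lemma tchain_surj y : exists2 c, y = tchain c &
  (#|[set t in S | (c t != 0)%R]| <= chain_norm y)%N.
Proof.
pose c t : 'F_2 := if insub (tverts t) is Some u then y u else 0.
have cE u t : val u = tverts t -> c t = y u.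
  by move=> ut; rewrite /c -ut valK.
exists c.
  apply/ffunP => u; rewrite ffunE; have [t tS ut] := triangleP u.
  rewrite (big_pred1 t) ?(cE u) // => t' /=; rewrite ut (inj_eq tverts_inj).
  by case: eqP => [->|_]; rewrite ?tS ?andbF.
rewrite -(card_imset _ tverts_inj).
have <- : #|[set val u | u in [set u | y u != 0]]| = chain_norm y by exact: card_imset val_inj.
apply/subset_leq_card/subsetP => _ /imsetP[t + ->]; rewrite inE => /andP[tS].
have uX : (tverts t \in tricomplex) && (#|tverts t| == 3%N) by rewrite tverts_tricomplex // card_tverts.
rewrite (cE (mk_simplex uX)) // => cu; apply/imsetP; exists (mk_simplex uX) => //.
by rewrite inE.
Qed.

Definition tcycle t : chain tricomplex 1 :=
  [ffun s : simplices tricomplex 1 => (val s \subset tverts t)%:R].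

Lemma tcycle_neq0 t : tcycle t <> 0.
Proof.
have sX : (everts (ab t) \in tricomplex) && (#|everts (ab t)| == 2%N) by rewrite inE card_everts.
move=> /(congr1 (fun z : chain tricomplex 1 => z (mk_simplex sX))) /eqP.
by rewrite !ffunE /= everts_sub !inE eqxx.
Qed.

(** A 1-simplex that is not of the form [everts e] lies in no transversal triple, so both chains
    vanish there and the equation only concerns [triedge]. *)
Lemma tchain_tcycle c t :
  reflect (\sum_(t' in S) c t' *: ev (@eds q) t' = ev (@eds q) t)
    (chain_boundary (tchain c) == tcycle t).
Proof.
have sumE e : (\sum_(t' in S) c t' *: ev (@eds q) t') e =
    \sum_(t' in S | everts e \subset tverts t') c t'.
  rewrite sum_ffunE [RHS]big_mkcondr; apply: eq_bigr => t' _.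
  rewrite !ffunE everts_sub; case: (e \in eds t'); first exact: mulr1.
  exact: mulr0.
apply: (iffP eqP) => [ct|ct]; apply/ffunP.
  move=> e; have sX : (everts e \in tricomplex) && (#|everts e| == 2%N) by rewrite inE card_everts.
  have := congr1 (fun z : chain tricomplex 1 => z (mk_simplex sX)) ct.
  by rewrite sumE tchain_boundary !ffunE /= everts_sub.
move=> s; rewrite tchain_boundary ffunE.
have [[e se]|none] := altP (@existsP _ (fun e => val s == everts e)).
  by rewrite (eqP se) -sumE ct ffunE everts_sub.
have ns t' : (val s \subset tverts t') = false.
  apply/negP => st; have [|e se] := sub_everts _ st; first by rewrite -card_simplex.
  by case/existsP: none; exists e; rewrite se.
by rewrite ns big_pred0 // => t'; rewrite ns andbF.
Qed.

Lemma tcycle_boundary t : ev (@eds q) t \in span_of (ev (@eds q)) (enum S) ->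
  tcycle t \in boundaries1 tricomplex.
Proof.
rewrite /span_of span_def big_map big_enum /= => /memv_sumP[v vS tv].
pose c t' := odflt 0 [pick k | v t' == k *: ev (@eds q) t'].
apply/imsetP; exists (tchain c) => //; apply/esym/eqP/tchain_tcycle; rewrite tv.
apply: eq_bigr => t' /vS/vlineP[k vk]; rewrite /c; case: pickP => [k' /eqP //|/(_ k)].
by rewrite vk eqxx.
Qed.

Lemma fill_tcycle1 t : t \in S -> fill_complex (tcycle t) = 1%N.
Proof.
move=> tS; pose c t' : 'F_2 := (t' == t)%:R.
have ct : chain_boundary (tchain c) = tcycle t.
  apply/eqP/tchain_tcycle; rewrite (bigD1 t) //= /c eqxx scale1r big1 ?addr0 // => t'.
  by case/andP=> _ /negbTE ->; rewrite scale0r.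
apply/eqP; rewrite eqn_leq; apply/andP; split.
  rewrite -ct; apply: leq_trans (fill_complex_le _) _.
  have tX : (tverts t \in tricomplex) && (#|tverts t| == 3%N) by rewrite tverts_tricomplex // card_tverts.
  rewrite -[leqRHS](cards1 (mk_simplex tX)); apply/subset_leq_card/subsetP => u.
  rewrite !inE ffunE; apply: contraR => ut; rewrite big1 // => t' /andP[_ /eqP t'u].
  rewrite /c; case: eqP => // tt; case/eqP: ut; apply: val_inj; by rewrite -t'u tt.
apply: fill_complex_gt; first by apply/imsetP; exists (tchain c).
move=> y yt; rewrite lt0n; apply/eqP => /chain_boundary0; rewrite yt; exact: tcycle_neq0.
Qed.

Lemma fill_tcycle_gt m t : tcycle t \in boundaries1 tricomplex -> ~~ fillable (@eds q) m S t ->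
  (m < fill_complex (tcycle t))%N.
Proof.
move=> tb nf; apply: fill_complex_gt => // y; have [c -> cy] := tchain_surj y.
move=> /eqP/tchain_tcycle ct; rewrite ltnNge; apply: contra nf => le.
apply/existsP; exists [set t in S | c t != 0]; apply/and3P; split.
- by apply/subsetP => t'; rewrite inE => /andP[].
- exact: leq_trans cy le.
rewrite -ct /bd; apply/eqP; rewrite big_mkcond [RHS]big_mkcond; apply: eq_bigr => t' _.
rewrite inE; case: (t' \in S) => //=; have [->|c0] := eqVneq (c t') 0; first by rewrite scale0r.
by have -> : c t' = 1; [apply: val_inj; case: (c t') c0 => -[|[|]]|rewrite scale1r].
Qed.

End Complex.

(* Loaded only now: it shadows the notations for finite sets used above. *)
From mathcomp Require Import all_classical all_reals all_analysis.
From mathcomp Require Import measurable_realfun simple_functions.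
Import Order.TTheory GRing.Theory Num.Theory.
Import numFieldNormedType.Exports.
Import HBNNSimple.

(** * Inner products and minors *)

Section InnerProduct.
Variables (R : realType) (H : hilbertType R).
Implicit Types x y z : H.

Definition ip (x y : H) : R := hdot H x y.

Lemma ipC x y : ip x y = ip y x.
Proof. by rewrite /ip hermC /= expr0 mul1r. Qed.

Lemma ipDr x y z : ip x (y + z) = ip x y + ip x z.
Proof. exact: linearDr. Qed.

Lemma ipDl x y z : ip (x + y) z = ip x z + ip y z.
Proof. by rewrite ipC ipDr !(ipC z). Qed.

Lemma ipZl (a : R) x y : ip (a *: x) y = a * ip x y.
Proof. exact: linearZl_LR. Qed.

Lemma ipZr (a : R) x y : ip x (a *: y) = a * ip x y.
Proof. by rewrite ipC ipZl ipC. Qed.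

Lemma ipNl x y : ip (- x) y = - ip x y.
Proof. by rewrite -scaleN1r ipZl mulN1r. Qed.

Lemma ipNr x y : ip x (- y) = - ip x y.
Proof. by rewrite ipC ipNl ipC. Qed.

Lemma ipBl x y z : ip (x - y) z = ip x z - ip y z.
Proof. by rewrite ipDl ipNl. Qed.

Lemma ipBr x y z : ip x (y - z) = ip x y - ip x z.
Proof. by rewrite ipDr ipNr. Qed.

Lemma ip0l x : ip 0 x = 0.
Proof. by rewrite -(scale0r (0 : H)) ipZl mul0r. Qed.

Lemma ip0r x : ip x 0 = 0.
Proof. by rewrite ipC ip0l. Qed.

Lemma ip_suml I (r : seq I) (P : pred I) (F : I -> H) y :
  ip (\sum_(i <- r | P i) F i) y = \sum_(i <- r | P i) ip (F i) y.
Proof.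
by elim/big_rec2: _ => [|i u v _ <-]; rewrite ?ip0l ?ipDl.
Qed.

Lemma ip_sumr I (r : seq I) (P : pred I) (F : I -> H) y :
  ip y (\sum_(i <- r | P i) F i) = \sum_(i <- r | P i) ip y (F i).
Proof. by rewrite ipC ip_suml; apply: eq_bigr => i _; rewrite ipC. Qed.

Lemma ip_norm x : ip x x = `|x| ^+ 2.
Proof. by rewrite hdot_norm. Qed.

Lemma ip_ge0 x : 0 <= ip x x.
Proof. by rewrite ip_norm exprn_ge0. Qed.

Lemma ip_eq0 x : (ip x x == 0) = (x == 0).
Proof. by rewrite ip_norm expf_eq0 /= normr_eq0. Qed.

Lemma norm_ip x : `|x| = Num.sqrt (ip x x).
Proof. by rewrite ip_norm sqrtr_sqr ger0_norm. Qed.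

Definition ipE := (ipDl, ipDr, ipBl, ipBr, ipNl, ipNr, ipZl, ipZr, ip0l, ip0r).

(* The squared area of the parallelogram spanned by [u] and [v]. *)
Definition gram (u v : H) : R := ip u u * ip v v - ip u v ^+ 2.

Lemma gram_ge0 u v : 0 <= gram u v.
Proof.
have [->|v0] := eqVneq v 0; first by rewrite /gram !ip0r; lra.
have vv : 0 < ip v v by rewrite lt_def ip_eq0 v0 ip_ge0.
rewrite -(pmulr_rge0 _ vv).
have -> : ip v v * gram u v = ip (ip v v *: u - ip u v *: v) (ip v v *: u - ip u v *: v).
  by rewrite /gram !ipE (ipC v u); ring.
exact: ip_ge0.
Qed.

Lemma gramC u v : gram u v = gram v u.
Proof. by rewrite /gram mulrC (ipC u). Qed.

End InnerProduct.

(** * Squared areas as sums of squares of coboundaries *)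

Section Minors.
Variables (R : realType) (H : hilbertType R).
Implicit Types (s es : seq H) (u v : H).

(** Parseval's identity on the span of [s]. Including the members of [es] expresses their
    orthonormality, which the induction needs. *)
Lemma gram_schmidt s : exists es,
  forall v, v \in s ++ es -> forall u, ip u v = \sum_(e <- es) ip u e * ip v e.
Proof.
elim: s => [|v s [es IH]]; first by exists [::].
pose w := v - \sum_(e <- es) ip v e *: e.
have ipw u : ip u w = ip u v - \sum_(e <- es) ip u e * ip v e.
  by rewrite ipBr ip_sumr; congr (_ - _); apply: eq_bigr => e _; rewrite ipZr mulrC.
have orth u : u \in s ++ es -> ip u w = 0.
  move=> us; rewrite ipw ipC (IH u us v); apply/eqP; rewrite subr_eq0; apply/eqP.
  by apply: eq_bigr => e _; rewrite mulrC.
have [w0|w0] := eqVneq w 0.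
  exists es => v'; rewrite inE => /orP[/eqP ->|/IH //] u.
  by apply/eqP; rewrite -subr_eq0 -ipw w0 ip0r.
have ww : ip v w = ip w w.
  rewrite [RHS]ipw [in RHS]ipC big_seq big1 ?subr0 // => e ees.
  by rewrite [ip w e]ipC orth ?mul0r // mem_cat ees orbT.
have ww0 : ip w w != 0 by rewrite ip_eq0.
have sq : Num.sqrt (ip w w) ^+ 2 = ip w w by rewrite sqr_sqrtr ?ip_ge0.
pose e' := (Num.sqrt (ip w w))^-1 *: w.
have ipe' u u' : ip u e' * ip u' e' = ip u w * ip u' w / ip w w.
  by rewrite !ipZr; move: (Num.sqrt _) sq => r <-; rewrite expr2 invfM; ring.
exists (e' :: es) => v'; rewrite mem_cat !inE => v's u; rewrite big_cons ipe'.
have [v'o|] := boolP (v' \in s ++ es).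
  by rewrite (orth v') // mulr0 mul0r add0r -IH.
rewrite mem_cat => v'n; move: v's v'n; case: eqP => [-> _ _|_].
  by rewrite ww mulfK // ipw; ring.
rewrite negb_or; case: (v' \in s) => //=; case: (v' \in es) => //=;
  rewrite ?orbT ?orbF ?andbF // => /eqP -> _.
rewrite big_seq big1 ?addr0 => [|e ees]; last first.
  by rewrite [ip e' e]ipZl [ip w e]ipC (orth e) ?mulr0 ?mulr0 // mem_cat ees orbT.
by rewrite [ip u e']ipZr [ip e' w]ipZl mulrA mulfK // mulrC.
Qed.

(** Lagrange's identity; ordered pairs account for the factor 2. *)
Lemma sum_minors (I : finType) (x y : I -> R) :
  \sum_(i : I * I) (x i.1 * y i.2 - x i.2 * y i.1) ^+ 2 =
  2 * ((\sum_i x i ^+ 2) * (\sum_i y i ^+ 2) - (\sum_i x i * y i) ^+ 2).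
Proof.
rewrite -(pair_big predT predT (fun i j => (x i * y j - x j * y i) ^+ 2)) /=.
transitivity (\sum_i (x i ^+ 2 * (\sum_j y j ^+ 2) + y i ^+ 2 * (\sum_j x j ^+ 2) -
    2 * (x i * y i) * (\sum_j x j * y j))).
  by apply: eq_bigr => i _; rewrite !mulr_sumr -big_split -sumrB; apply: eq_bigr => j _ /=; ring.
by rewrite sumrB big_split /= -!mulr_suml -mulr_sumr; ring.
Qed.

Definition minor_form (I : finType) (e : I -> H) (i : I * I) u v : R :=
  ip u (e i.1) * ip v (e i.2) - ip u (e i.2) * ip v (e i.1).

(** The minor of [b - a] and [c - a] expands, by bilinearity and antisymmetry, into the minors of
    the three pairs of points: it is the coboundary of a function of edges. *)
Lemma minor_coordinates s : exists (I : finType) (e : I -> H),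
  forall a b c, a \in s -> b \in s -> c \in s ->
  \sum_i (minor_form e i a b + minor_form e i b c - minor_form e i a c) ^+ 2 =
  2 * gram (b - a) (c - a).
Proof.
have [es es_ip] := gram_schmidt s.
exists 'I_(size es), (fun i => tnth (in_tuple es) i) => a b c a_s b_s c_s.
have ipE' u v : u \in s -> v \in s -> forall w, ip w (v - u) =
    \sum_(i < size es) ip w (tnth (in_tuple es) i) * ip (v - u) (tnth (in_tuple es) i).
  move=> us vs w; rewrite ipBr !es_ip ?mem_cat ?us ?vs // -sumrB.
  by rewrite (big_tnth _ _ es); apply: eq_bigr => i _; rewrite ipBl; ring.
rewrite /gram !(ipE' a) // -(sum_minors (fun i => ip (b - a) _) (fun i => ip (c - a) _)).
by apply: eq_bigr => i _; rewrite /minor_form !ipBl; congr (_ ^+ 2); ring.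
Qed.

End Minors.

(** [S] precedes [H] and [p]. The case [G t1 = 0] is set apart because [tripartite_triangles] needs
    a positive [tau]; it leads to an infinite distortion. *)
Lemma hilbert_triangles (R : realType) q j : (20 <= j)%N -> q = (2 ^ (12 * j))%N ->
  exists2 S : {set tritri q}, exists t, t \in S &
  forall (H : hilbertType R) (p : 'I_3 -> 'I_q -> H),
  let G t := gram (p 1 t.1.2 - p 0 t.1.1) (p (2%:R) t.2 - p 0 t.1.1) in
  exists2 t1, t1 \in S & G t1 = 0 \/
    exists t2, [/\ ev (@eds q) t2 \in span_of (ev (@eds q)) (enum S),
                   ~~ fillable (@eds q) (2 ^ (3 * j)) S t2 &
                   G t2 <= (65536%N)%:R * G t1].
Proof.
move=> j20 qE; have [S HS] := @tripartite_triangles q R j j20 qE; have [t0 t0S] : exists t, t \in S.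
  (* [S] is not empty: applied to the zero cochain, [HS] puts some nonzero [ev t] in its span. *)
  have [|t [t1 _ _]] := HS 'I_1 (fun _ => 0) 1 ltr01.
    by move=> t _; rewrite big1 // => i _; rewrite linear0 expr2 mul0r.
  apply/set0Pn; apply/eqP => S0; move: t1.
  rewrite S0 enum_set0 /span_of span_nil memv0 => /eqP/(congr1 (fun z : vec _ => z (ab t))).
  by rewrite !ffunE /eds !inE eqxx.
exists S => [|H p G]; first by exists t0.
case: (@Order.TotalTheory.arg_maxP _ _ _ t0 (mem S) G t0S) => t1 t1S max.
exists t1 => //; have [->|G0] := eqVneq (G t1) 0; [by left|right].
have Gp : 0 < G t1 by rewrite lt_def G0 gram_ge0.
have [I [e eG]] := minor_coordinates [seq p k.1 k.2 | k : 'I_3 * 'I_q].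
have ps (k : 'I_3) (i : 'I_q) : p k i \in [seq p k.1 k.2 | k : 'I_3 * 'I_q].
  by apply: (map_f (fun x => p x.1 x.2) (x := (k, i))); rewrite mem_enum.
pose w (i : I * I) : {ffun triedge q -> R^o} := [ffun x : triedge q =>
  if x.1 == 0 then minor_form e i (p 0 x.2.1) (p 1 x.2.2) : R^o
  else if x.1 == 1 then minor_form e i (p 1 x.2.1) (p 2%:R x.2.2)
  else minor_form e i (p 0 x.2.1) (p 2%:R x.2.2)].
have wG t : \sum_i coboundary t (w i) ^+ 2 = 2 * G t.
  by rewrite -eG //; apply: eq_bigr => i _; rewrite /coboundary !ffunE.
have [||t2 [s2 f2 G2]] := HS _ w (2 * G t1).
- by rewrite mulr_gt0.
- by move=> t tS; rewrite wG ler_pM2l //; exact: max.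
- exists t2; split=> //; move: G2; rewrite wG mulrCA ler_pM2l //.
Qed.

(** * Lipschitz maps into Hilbert spaces are differentiable almost everywhere *)

Lemma sum_nat_mul (V : nmodType) (N M : nat) (F : nat -> V) :
  \sum_(0 <= j < N * M) F j = \sum_(0 <= i < N) \sum_(0 <= l < M) F (i * M + l)%N.
Proof.
elim: N => [|N IH]; first by rewrite mul0n !big_geq.
rewrite big_nat_recr //= -IH mulSn addnC (@big_cat_nat _ _ _ (N * M)) ?leq_addr //=.
congr (_ + _); rewrite -[X in \sum_(X <= _ < _) _]add0n big_addn addKn.
by apply: eq_bigr => l _; rewrite addnC.
Qed.

(** * Energy of interpolations and variation of residuals *)

Section Variation.
Variables (R : realType) (H : hilbertType R).
Implicit Types (g : R -> H) (N M : nat).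

Definition inc N g (i : nat) : H := g (i.+1%:R / N%:R) - g (i%:R / N%:R).

(** The Dirichlet energy on [0, 1] of the interpolation [pl N g], whose slopes are
    [N%:R *: inc N g i]. *)
Definition energy N g : R := N%:R * \sum_(0 <= i < N) ip (inc N g i) (inc N g i).

Definition clamp (y : R) : R := Num.max 0 (Num.min 1 y).

(* The piecewise linear interpolation of [g] on [0, 1] with [N] pieces, minus [g 0]. *)
Definition pl N g (x : R) : H := \sum_(0 <= i < N) clamp (N%:R * x - i%:R) *: inc N g i.

Definition res N g (x : R) : H := g x - pl N g x.

Lemma clamp_le0 y : y <= 0 -> clamp y = 0.
Proof. by move=> y0; rewrite /clamp; apply/max_idPl; rewrite ge_min y0 orbT. Qed.

Lemma clamp_ge1 y : 1 <= y -> clamp y = 1.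
Proof. by move=> y1; rewrite /clamp (min_idPl y1); apply/max_idPr. Qed.

Lemma clamp_id y : 0 <= y <= 1 -> clamp y = y.
Proof. by case/andP=> y0 y1; rewrite /clamp (min_idPr y1); apply/max_idPr. Qed.

Lemma pl_cell N g (i : nat) x : (0 < N)%N -> (i < N)%N ->
  i%:R <= N%:R * x <= i.+1%:R ->
  pl N g x = \sum_(0 <= j < i) inc N g j + (N%:R * x - i%:R) *: inc N g i.
Proof.
move=> N0 iN /andP[ix xi]; rewrite /pl (@big_cat_nat _ _ _ i) ?(ltnW iN) //=.
rewrite [X in _ + X]big_ltn //= big_nat_cond [X in _ + (_ + X)]big_nat_cond.
rewrite [X in _ + (_ + X)]big1 => [|j /andP[/andP[ij _] _]]; last first.
  rewrite clamp_le0 ?scale0r // subr_le0 (le_trans xi) //.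
  by rewrite ler_nat.
rewrite addr0 clamp_id ?subr_ge0 ?ix ?lerBlDl ?natr1 //.
congr (_ + _); rewrite -big_nat_cond; apply: eq_big_nat => j /andP[_ ji].
rewrite clamp_ge1 ?scale1r // lerBrDl (le_trans _ ix) //.
by rewrite natr1 ler_nat.
Qed.

Lemma pl_diff N g (i : nat) x y : (0 < N)%N -> (i < N)%N ->
  i%:R <= N%:R * x <= i.+1%:R -> i%:R <= N%:R * y <= i.+1%:R ->
  pl N g y - pl N g x = (y - x) *: (N%:R *: inc N g i).
Proof.
move=> N0 iN xi yi; rewrite (pl_cell g N0 iN xi) (pl_cell g N0 iN yi).
rewrite opprD addrACA subrr add0r -scalerBl scalerA; congr (_ *: _).
by ring.
Qed.

Lemma inc_pl N M g (i l : nat) : (0 < N)%N -> (0 < M)%N -> (i < N)%N -> (l < M)%N ->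
  inc (N * M) (pl N g) (i * M + l) = M%:R^-1 *: inc N g i.
Proof.
move=> N0 M0 iN lM.
have NR : (N%:R : R) != 0 by rewrite pnatr_eq0 -lt0n.
have MR : (M%:R : R) != 0 by rewrite pnatr_eq0 -lt0n.
have E (k : nat) : N%:R * (k%:R / (N * M)%:R) = k%:R / M%:R :> R.
  by rewrite natrM; field; rewrite NR MR.
have Mp : (0 < M%:R :> R) by rewrite ltr0n.
rewrite /inc (@pl_diff N g i) //; last 2 first.
- rewrite E ler_pdivlMr // ler_pdivrMr // -!natrM !ler_nat mulSn; lia.
- rewrite E ler_pdivlMr // ler_pdivrMr // -!natrM !ler_nat mulSn; lia.
rewrite scalerA; congr (_ *: _); rewrite -natr1 natrM; field.
by rewrite NR MR.
Qed.

Lemma inc_sum N M g i : (0 < N)%N -> (0 < M)%N ->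
  \sum_(0 <= l < M) inc (N * M) g (i * M + l) = inc N g i.
Proof.
move=> N0 M0.
have NR : (N%:R : R) != 0 by rewrite pnatr_eq0 -lt0n.
have MR : (M%:R : R) != 0 by rewrite pnatr_eq0 -lt0n.
rewrite /inc (eq_bigr (fun l => g ((i * M + l.+1)%:R / (N * M)%:R) -
  g ((i * M + l)%:R / (N * M)%:R))); last by move=> l _; rewrite addnS.
rewrite (telescope_sumr (fun l => g ((i * M + l)%:R / (N * M)%:R))) //.
rewrite addn0 (_ : i * M + M = i.+1 * M)%N; last by rewrite mulSn addnC.
by congr (g _ - g _); rewrite !natrM; field; rewrite NR MR.
Qed.

(** Pythagoras: in each coarse cell the fine increments of [pl N g] are equal and those of [g] add
    up to the coarse one, so interpolation is an orthogonal projection for the energy. *)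
Lemma energy_res N M g : (0 < N)%N -> (0 < M)%N ->
  energy (N * M) (res N g) = energy (N * M) g - energy N g.
Proof.
move=> N0 M0.
have MR : (M%:R : R) != 0 by rewrite pnatr_eq0 -lt0n.
rewrite /energy !sum_nat_mul natrM -!mulrA -mulrBr; congr (_ * _).
rewrite !big_distrr /= -sumrB; apply: eq_big_nat => i /andP[_ iN].
set D := inc N g i.
rewrite (_ : \sum_(0 <= l < M) ip (inc (N * M) (res N g) (i * M + l)) _ =
  \sum_(0 <= l < M) (ip (inc (N * M) g (i * M + l)) (inc (N * M) g (i * M + l))
    - 2 * M%:R^-1 * ip (inc (N * M) g (i * M + l)) D + M%:R^-1 ^+ 2 * ip D D)).
  rewrite big_split sumrB /= -big_distrr /= -ip_suml inc_sum // -/D.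
  rewrite big_const_nat subn0 iter_addr_0 -mulr_natl; field.
  by [].
apply: eq_big_nat => l /andP[_ lM].
have -> : inc (N * M) (res N g) (i * M + l) =
   inc (N * M) g (i * M + l) - M%:R^-1 *: D.
  by rewrite -(inc_pl g N0 M0 iN lM) /inc /res !opprD !opprK addrACA.
by rewrite -/D; move: (inc _ _ _) D => u v; rewrite !ipE (ipC v u); ring.
Qed.

Lemma energy_le (L : R) N g : 0 <= L -> (0 < N)%N ->
  (forall x y, `|g x - g y| <= L * `|x - y|) -> energy N g <= L ^+ 2.
Proof.
move=> L0 N0 gL; have NR : (0 < N%:R :> R) by rewrite ltr0n.
rewrite -(ler_pM2l (_ : 0 < (N%:R)^-1)) ?invr_gt0 // mulrA mulVf ?gt_eqF // mul1r.
apply: le_trans (_ : \sum_(0 <= i < N) (L / N%:R) ^+ 2 <= _); last first.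
  rewrite big_const_nat subn0 iter_addr_0 -mulr_natl le_eqVlt; apply/orP; left.
  by apply/eqP; field; rewrite gt_eqF.
apply: ler_sum => i _; rewrite ip_norm lerXn2r ?nnegrE //; first by rewrite divr_ge0 ?ler0n.
apply: le_trans (gL _ _) _; rewrite -mulrBl -natr1 addrAC subrr add0r mul1r.
by rewrite ger0_norm // invr_ge0 ltW.
Qed.

Lemma sum_inc_le N g (e : R) : (0 < N)%N -> 0 < e -> energy N g <= e ^+ 2 ->
  \sum_(0 <= j < N) `|inc N g j| <= e.
Proof.
move=> N0 e0 Ee; have NR : (0 < N%:R :> R) by rewrite ltr0n.
apply: le_trans (_ : \sum_(0 <= j < N)
   (e / N%:R + N%:R * ip (inc N g j) (inc N g j) / e) / 2 <= _).
  apply: ler_sum => j _; rewrite ip_norm; set a := `|_|.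
  rewrite -subr_ge0 (_ : _ - a = (e / N%:R) / 2 * (1 - N%:R / e * a) ^+ 2).
    by rewrite mulr_ge0 ?sqr_ge0 // !divr_ge0 // ltW.
  by field; rewrite !gt_eqF.
rewrite -big_distrl big_split /= big_const_nat subn0 iter_addr_0.
rewrite (_ : \sum_(0 <= i < N) _ = energy N g / e); last first.
  by rewrite /energy mulr_sumr mulr_suml.
have -> : e / N%:R *+ N = e by rewrite -mulr_natr divfK // gt_eqF.
by rewrite ler_pdivrMr // mulr_natr mulr2n lerD2l ler_pdivrMr // -expr2.
Qed.

(** The energies are at most [L ^ 2]. An [N] whose energy is within [e ^ 2] of their supremum leaves
    a residual of energy at most [e ^ 2] on every refinement, and Cauchy-Schwarz bounds its
    variation. *)
Lemma res_variation (L : R) g (e : R) : 0 <= L ->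
  (forall x y, `|g x - g y| <= L * `|x - y|) -> 0 < e ->
  exists2 N, (0 < N)%N & forall M, (0 < M)%N ->
    \sum_(0 <= j < N * M) `|inc (N * M) (res N g) j| <= e.
Proof.
move=> L0 gL e0.
pose A := [set x : R | exists2 N, (0 < N)%N & x = energy N g]%classic.
have hsA : has_sup A.
  split; first by exists (energy 1 g); exists 1%N.
  by exists (L ^+ 2) => _ [N N0 ->]; exact: energy_le gL.
have [] := @sup_adherent _ A (e ^+ 2) (exprn_gt0 _ e0) hsA.
move=> _ [N N0 ->] Ne; exists N => // M M0.
apply: sum_inc_le; rewrite ?muln_gt0 ?N0 // energy_res // lerBlDl.
have : energy (N * M) g <= sup A.
  by apply: sup_upper_bound => //; exists (N * M)%N; rewrite ?muln_gt0 ?N0.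
by lra.
Qed.

End Variation.

Lemma sum_exclusive_le (R : realDomainType) (I : eqType) (s : seq I) (p : pred I) (x : R) :
  0 <= x -> uniq s ->
  {in s &, forall i j, p i -> p j -> i = j} ->
  \sum_(i <- s | p i) x <= x.
Proof.
move=> x0; elim: s => [|i s IH] /=; first by rewrite big_nil.
case/andP=> is_ us excl; rewrite big_cons.
have {}IH : \sum_(i <- s | p i) x <= x.
  by apply: IH => // a b as_ bs; apply: excl; rewrite inE ?as_ ?bs orbT.
case: ifPn => // pi; rewrite big_seq_cond big1 ?addr0 // => j /andP[js pj].
by move: is_; rewrite (excl i j) ?inE ?eqxx ?js ?orbT.
Qed.

Lemma measure_bigsetU_le (R : realType) d (T : measurableType d)
    (mu : {measure set T -> \bar R})
    (I : Type) (F : I -> set T) (G : I -> R) (s : seq I) :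
  (forall i, measurable (F i)) -> (forall i, mu (F i) <= (G i)%:E)%E ->
  (mu (\big[setU/set0]_(i <- s) F i) <= (\sum_(i <- s) G i)%:E)%E.
Proof.
move=> mF FG; elim: s => [|i s IH]; first by rewrite !big_nil measure0.
rewrite !big_cons EFinD; apply: le_trans (leeD (FG i) IH).
by apply: measureU2 => //; apply: bigsetU_measurable.
Qed.

(** * A maximal inequality for steep intervals *)

Section Intervals.
Variables (R : realType) (H : hilbertType R).

(* [(a, b, K)] stands for the rational interval from [a / K] to [b / K]. *)
Definition idx := (nat * nat * nat)%type.
Implicit Types i : idx.
Definition valid i := (i.1.1 < i.1.2 <= i.2)%N.
Definition lo i : R := i.1.1%:R / i.2%:R.
Definition hi i : R := i.1.2%:R / i.2%:R.

Lemma valid_gt0 i : valid i -> (0 < i.2)%N.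
Proof. by case/andP=> a b; apply: leq_trans b; apply: leq_trans a. Qed.

Lemma lo_lt_hi i : valid i -> lo i < hi i.
Proof.
move=> vi; have K0 := valid_gt0 vi; case/andP: vi => a b.
by rewrite ltr_pM2r ?invr_gt0 ?ltr0n // ltr_nat.
Qed.

Definition excluding i j := ~ exists x : R, lo i < x < hi i /\ lo j < x < hi j.

Lemma inc_between N (eta : R -> H) (a b : nat) : (a <= b)%N ->
  `|eta (b%:R / N%:R) - eta (a%:R / N%:R)| <= \sum_(a <= j < b) `|inc N eta j|.
Proof.
move=> ab; apply: le_trans (ler_norm_sum _ _ _).
by rewrite (telescope_sumr (fun j => eta (j%:R / N%:R))).
Qed.

(** All the ends lie on the grid of step [1 / (N M)], with [M] the product of the denominators, and
    each cell of the grid is in at most one of the intervals. *)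
Lemma variation_family N (eta : R -> H) (e : R) (s : seq idx) : (0 < N)%N ->
  (forall M, (0 < M)%N -> \sum_(0 <= j < N * M) `|inc (N * M) eta j| <= e) ->
  uniq s -> all valid s ->
  {in s &, forall i j, i != j -> excluding i j} ->
  \sum_(i <- s) `|eta (hi i) - eta (lo i)| <= e.
Proof.
move=> N0 Ne us vs excl.
pose M := (\prod_(i <- s) i.2)%N.
have M0 : (0 < M)%N.
  by rewrite /M big_seq prodn_cond_gt0 // => i /(allP vs) /valid_gt0.
have KM i : i \in s -> (i.2 %| N * M)%N.
  by move=> is_; rewrite dvdn_mull // /M (big_rem i) //= dvdn_mulr.
pose P := (N * M)%N.
have P0 : (0 < P)%N by rewrite muln_gt0 N0.
pose A i := (i.1.1 * (P %/ i.2))%N; pose B i := (i.1.2 * (P %/ i.2))%N.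
have conv (c : nat) i : i \in s -> c%:R / i.2%:R = (c * (P %/ i.2))%:R / P%:R :> R.
  move=> is_; have K0 := valid_gt0 (allP vs _ is_).
  have PE : P = (P %/ i.2 * i.2)%N by rewrite divnK // KM.
  have Pi0 : (0 < P %/ i.2)%N by rewrite divn_gt0 // dvdn_leq // KM.
  rewrite {2}PE !natrM; field.
  by rewrite !pnatr_eq0 -!lt0n K0 Pi0.
have loE i : i \in s -> lo i = (A i)%:R / P%:R by move=> is_; rewrite /lo conv.
have hiE i : i \in s -> hi i = (B i)%:R / P%:R by move=> is_; rewrite /hi conv.
have AB i : i \in s -> (A i <= B i <= P)%N.
  move=> is_; case/andP: (allP vs _ is_) => ab bK; rewrite leq_mul2r (ltnW ab) orbT /=.
  apply: leq_trans (_ : i.2 * (P %/ i.2) <= _)%N; first by rewrite leq_mul2r bK orbT.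
  by rewrite mulnC divnK // KM.
apply: le_trans (Ne M M0); rewrite -/P.
apply: le_trans (_ : \sum_(i <- s) \sum_(0 <= j < P | (A i <= j < B i)%N) `|inc P eta j| <= _).
  rewrite big_seq [X in _ <= X]big_seq; apply: ler_sum => i is_.
  rewrite (loE _ is_) (hiE _ is_); have /andP[ab bP] := AB i is_.
  apply: le_trans (inc_between _ _ ab) _; rewrite le_eqVlt; apply/orP; left; apply/eqP.
  rewrite (@big_nat_widenl _ _ _ (A i) 0) // (@big_nat_widen _ _ _ 0 (B i) P) //.
rewrite (exchange_big_dep predT) //=; apply: ler_sum => j _.
apply: sum_exclusive_le => // i1 i2 s1 s2 p1 p2; apply/eqP/negPn/negP => ne.
(* The midpoint of the cell [j] lies in both intervals. *)
apply: (excl i1 i2 s1 s2 ne); exists ((j%:R + 2^-1) / P%:R : R).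
have key (a b : nat) : (a <= j < b)%N ->
    ((a%:R / P%:R : R) < (j%:R + 2^-1) / P%:R) && ((j%:R + 2^-1) / P%:R < b%:R / P%:R :> R).
  move=> /andP[aj jb]; rewrite !ltr_pM2r ?invr_gt0 ?ltr0n //.
  have : (a%:R <= j%:R :> R) by rewrite ler_nat.
  have : (j%:R + 1 <= b%:R :> R) by rewrite natr1 ler_nat.
  by move=> ? ?; apply/andP; split; lra.
rewrite (loE _ s1) (loE _ s2) (hiE _ s1) (hiE _ s2); split; exact: key.
Qed.

Section Covering.
Variables (eta : R -> H) (lam : R).

Definition steep i := valid i /\ lam * (hi i - lo i) < `|eta (hi i) - eta (lo i)|.

Definition steep_set : set R :=
  (\bigcup_(i in [set i | steep i]) [set x | lo i < x < hi i])%classic.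

Let mid i : R := (lo i + hi i) / 2.
(** The radius 1 of an invalid triple only keeps its ball non-empty, as the covering lemma asks of
    every index. *)
Let rad i : R := if valid i then (hi i - lo i) / 2 else 1.

Let rad_gt0 i : 0 < rad i.
Proof. by rewrite /rad; case: ifP => // /lo_lt_hi h; lra. Qed.

Let ball_steep i : valid i -> ball (mid i) (rad i) = [set x | lo i < x < hi i]%classic.
Proof.
move=> vi; rewrite ball_itv /mid /rad vi; apply/seteqP.
by split=> x /=; rewrite in_itv /= => /andP[? ?]; apply/andP; split; lra.
Qed.

(** Vitali: disjoint members of the family, enlarged three times, cover the union. Each is shorter
    than the increment of [eta] over it divided by [lam], and these increments add up to at most
    [e]. *)
Lemma steep_finite N (e : R) (s : seq idx) : (0 < N)%N -> 0 < lam ->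
  (forall M, (0 < M)%N -> \sum_(0 <= j < N * M) `|inc (N * M) eta j| <= e) ->
  (forall i, i \in s -> steep i) ->
  (lebesgue_measure (\bigcup_(i in [set` s]) [set x : R | (lo i < x < hi i)%R])%classic
     <= (3 * e / lam)%:E)%E.
Proof.
move=> N0 lam0 Ne ss.
have [D [uD Ds tD cD]] := @vitali_lemma_finite_cover R idx (fun i => ball (mid i) (rad i))
  (fun i => is_ball_ball _ _) (fun i => ex_intro _ (mid i) (ballxx _ (rad_gt0 i))) s.
have vD i : i \in D -> valid i by move=> /Ds /ss[].
have sub : (\bigcup_(i in [set` s]) [set x : R | lo i < x < hi i] `<=`
            \big[setU/set0]_(i <- D) ball (mid i) (3 * rad i))%classic.
  rewrite -bigcup_seq => x [i /= is_ xi]; have [vi _] := ss _ is_.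
  have := cD x; rewrite /cover; case; first by exists i => //=; rewrite ball_steep.
  by move=> j /= jD; rewrite scale_ballE // => xj; exists j.
apply: le_trans (@le_measure _ _ _ lebesgue_measure _ _ _ _ sub) _.
- rewrite inE bigcup_seq; apply: bigsetU_measurable => i _.
  rewrite (_ : [set x | _]%classic = `]lo i, hi i[%classic); first exact: measurable_itv.
  by apply/seteqP; split=> x /=; rewrite in_itv.
- by rewrite inE; apply: bigsetU_measurable => i _; by rewrite ball_itv; exact: measurable_itv.
apply: le_trans (@measure_bigsetU_le _ _ _ lebesgue_measure _ _
   (fun i => 6 * rad i) D _ _) _.
- by move=> i; by rewrite ball_itv; exact: measurable_itv.
- move=> i; have h : 0 <= 3 * rad i by rewrite mulr_ge0 ?(ltW (rad_gt0 i)).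
  apply: le_trans (_ : ((3 * rad i) *+ 2)%:E <= _)%E.
    by rewrite -(lebesgue_measure_ball (mid i) h).
  by rewrite lee_fin; lra.
rewrite lee_fin ler_pdivlMr //.
apply: le_trans (_ : 3 * \sum_(i <- D) `|eta (hi i) - eta (lo i)| <= _).
  rewrite mulr_suml mulr_sumr big_seq [X in _ <= X]big_seq; apply: ler_sum => i iD.
  have [vi st] := ss _ (Ds _ iD); rewrite /rad vi; nra.
rewrite ler_pM2l //; apply: (variation_family N0 Ne) => //.
- by apply/allP => i; exact: vD.
- move=> i j iD jD /eqP ne [x [xi xj]]; apply: ne; apply: tD => //.
  by exists x; rewrite !ball_steep ?vD.
Qed.

Lemma steep_set_measurable : measurable steep_set.
Proof.
rewrite /steep_set bigcup_mkcond.
apply: countable_bigcupT_measurable => [|i]; first exact: countableP.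
case: ifP => _; last exact: measurable0.
rewrite (_ : [set x | _]%classic = `]lo i, hi i[%classic); first exact: measurable_itv.
by apply/seteqP; split=> x /=; rewrite in_itv.
Qed.

(** Continuity from below along an enumeration of the rational intervals. *)
Lemma steep_measure N (e : R) : (0 < N)%N -> 0 < lam ->
  (forall M, (0 < M)%N -> \sum_(0 <= j < N * M) `|inc (N * M) eta j| <= e) ->
  (lebesgue_measure steep_set <= (3 * e / lam)%:E)%E.
Proof.
move=> N0 lam0 Ne.
pose S n : seq idx := [seq i <- pmap unpickle (iota 0 n) | `[< steep i >]].
pose O n := (\bigcup_(i in [set` S n]) [set x : R | lo i < x < hi i])%classic.
have SP i n : i \in S n <-> steep i /\ exists2 k, (k < n)%N & unpickle k = Some i.
  rewrite mem_filter mem_pmap; split.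
    case/andP=> /asboolP st /mapP[k]; rewrite mem_iota /= => kn ik.
    by split=> //; exists k.
  case=> st [k kn ik]; apply/andP; split; first exact/asboolP.
  by apply/mapP; exists k; rewrite ?mem_iota.
have mO n : measurable (O n).
  rewrite /O bigcup_seq; apply: bigsetU_measurable => i _.
  rewrite (_ : [set x | _]%classic = `]lo i, hi i[%classic); first exact: measurable_itv.
  by apply/seteqP; split=> x /=; rewrite in_itv.
have EO : steep_set = (\bigcup_n O n)%classic.
  apply/seteqP; split=> x.
    move=> [i st xi]; exists (pickle i).+1 => //; exists i => //=.
    by apply/SP; split=> //; exists (pickle i) => //; rewrite pickleK.
  by move=> [n _ [i /= /SP[st _] xi]]; exists i.
have cv : ((lebesgue_measure \o O) x @[x --> \oo] --> lebesgue_measure steep_set)%classic.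
  rewrite EO; apply: nondecreasing_cvg_mu => //; first exact: bigcupT_measurable.
  move=> n m nm; apply/subsetPset => x [i /= /SP[st [k kn ki]] xi].
  by exists i => //=; apply/SP; split=> //; exists k => //; apply: leq_trans nm.
rewrite -(cvg_lim _ cv) //; apply: lime_le; first exact: cvgP cv.
near=> n; apply: (steep_finite N0 lam0 Ne) => i /SP[].
by [].
Unshelve. all: by end_near.
Qed.

End Covering.
End Intervals.

(** * Differentiability off the steep sets *)

Section Slope.
Variables (R : realType) (H : hilbertType R) (L : R) (g : R -> H).
Hypothesis L0 : 0 <= L.
Hypothesis gL : forall x y, `|g x - g y| <= L * `|x - y|.

Definition irrat (x : R) := forall a b : nat, (0 < b)%N -> x != a%:R / b%:R.

Lemma secantE (s : H) y z :
  g y - g z - (y - z) *: s = (g y - y *: s) - (g z - z *: s).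
Proof.
by rewrite scalerBl !opprB [z *: s - _]addrC addrACA [- g z + _]addrC.
Qed.

(** Off the steep set the residual has slope at most [lam] on every rational interval around [x],
    and within a cell [g] is the residual plus an affine map. Real ends are reached by rounding [u]
    down and [v] up; irrationality keeps [x] strictly inside. *)
Lemma res_slope (lam : R) N i u v x : 0 < lam -> (0 < N)%N -> (i < N)%N ->
  ~ steep_set (res N g) lam x -> irrat x ->
  i%:R / N%:R < u -> u <= x <= v -> v < i.+1%:R / N%:R ->
  `|g v - g u - (v - u) *: (N%:R *: inc N g i)| <= lam * (v - u).
Proof.
move=> lam0 N0 iN nst irr iu /andP[ux xv] vi; set s := N%:R *: inc N g i.
have NR : (0 < N%:R :> R) by rewrite ltr0n.
rewrite leNgt; apply/negP => bad.
pose gap := `|g v - g u - (v - u) *: s| - lam * (v - u).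
have gap0 : 0 < gap by rewrite subr_gt0.
pose C := 2 * (L + `|s| + lam) + 1.
have C0 : 0 < C by rewrite /C ltr_wpDl // mulr_ge0 // !addr_ge0 // ltW.
(* Rounding by less than [tau] stays in the cell, and costs at most [2 (L + |s|) tau] through the
   Lipschitz bound and [2 lam tau] through the length; [C tau <= gap] covers both. *)
pose tau := Num.min (gap / C) (Num.min (u - i%:R / N%:R) (i.+1%:R / N%:R - v)).
have tau0 : 0 < tau by rewrite !lt_min divr_gt0 //= !subr_gt0 iu vi.
pose K := (Num.truncn tau^-1).+1.
have K0 : (0 < K%:R :> R) by rewrite ltr0n.
have Ktau : K%:R^-1 < tau.
  by rewrite -[ltRHS]invrK ltf_pV2 ?posrE ?invr_gt0 // truncnS_gt.
have [tau1 tau2 tau3] : [/\ tau <= gap / C, tau <= u - i%:R / N%:R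
    & tau <= i.+1%:R / N%:R - v].
  by rewrite !ge_min !lexx !orbT.
have u0 : 0 < u by apply: le_lt_trans iu; rewrite divr_ge0 ?ler0n.
have v0 : 0 < v by apply: lt_le_trans u0 _; exact: le_trans xv.
pose al := Num.truncn (u * K%:R); pose be := (Num.truncn (v * K%:R)).+1.
have /andP[al1 al2] : al%:R <= u * K%:R < al.+1%:R by rewrite truncn_itv ?mulr_ge0 ?ltW.
have /andP[be1 be2] : be.-1%:R <= v * K%:R < be%:R by rewrite truncn_itv ?mulr_ge0 ?ltW.
have a1 : al%:R / K%:R <= u by rewrite ler_pdivrMr.
have a2 : u - tau < al%:R / K%:R.
  apply: lt_trans (_ : u - K%:R^-1 < _); first by rewrite ltrD2l ltrN2.
  by rewrite ltr_pdivlMr // mulrBl mulVf ?gt_eqF // ltrBlDr natr1.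
have b1 : v < be%:R / K%:R by rewrite ltr_pdivlMr.
have b2 : be%:R / K%:R < v + tau.
  apply: le_lt_trans (_ : v + K%:R^-1 < _); last by rewrite ltrD2l.
  by rewrite ler_pdivrMr // mulrDl mulVf ?gt_eqF // /be -natr1 lerD2r.
set a := al%:R / K%:R in a1 a2; set b := be%:R / K%:R in b1 b2.
have ax : a < x by rewrite lt_neqAle (le_trans a1 ux) andbT eq_sym irr.
have xb : x < b by apply: le_lt_trans b1.
have i1N : i.+1%:R / N%:R <= 1 :> R by rewrite ler_pdivrMr // mul1r ler_nat.
have vab : valid (al, be, K).
  apply/andP; split=> /=.
    rewrite -(ltr_nat R) -(ltr_pM2r (_ : 0 < K%:R^-1)) ?invr_gt0 //.
    exact: lt_trans xb.
  rewrite -(ler_nat R) -[leRHS]mul1r -ler_pdivrMr // -/b; lra.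
apply: nst; exists (al, be, K); last by rewrite /= /lo /hi /= -/a -/b ax xb.
split=> //; rewrite /lo /hi /= -/a -/b.
have cell (y : R) : i%:R / N%:R <= y <= i.+1%:R / N%:R -> i%:R <= N%:R * y <= i.+1%:R.
  by rewrite ler_pdivrMr // ler_pdivlMr // mulrC.
have E : res N g b - res N g a = g b - g a - (b - a) *: s.
  rewrite /s -(@pl_diff _ _ N g i a b N0 iN) ?cell //; last 2 first.
  - by apply/andP; split; lra.
  - by apply/andP; split; lra.
  by rewrite /res !opprD !opprK addrACA.
rewrite E ltNge; apply/negP => sm.
suff : gap < gap by rewrite ltxx.
have key : `|g v - g u - (v - u) *: s| <=
    `|g b - g a - (b - a) *: s| + (L + `|s|) * (b - v) + (L + `|s|) * (u - a).
  have lip y z : z <= y -> `|g y - g z - (y - z) *: s| <= (L + `|s|) * (y - z).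
    move=> zy; apply: le_trans (ler_normB _ _) _; rewrite mulrDl normrZ.
    have yz : `|y - z| = y - z by rewrite ger0_norm // subr_ge0.
    by rewrite lerD //; [apply: le_trans (gL _ _) _|]; rewrite yz // mulrC.
  have := lip _ _ (ltW b1); have := lip _ _ a1; rewrite !secantE => h1 h2.
  apply: le_trans (ler_distD (g b - b *: s) _ _) _.
  apply: le_trans (lerD (lexx _) (ler_distD (g a - a *: s) _ _)) _.
  by rewrite [leLHS]addrCA -[leRHS]addrA lerD2l lerD // distrC.
have s0 : 0 <= `|s| by exact: normr_ge0.
have Ctau : (2 * (L + `|s| + lam) + 1) * tau <= `|g v - g u - (v - u) *: s| - lam * (v - u).
  by rewrite mulrC -ler_pdivlMr.
have p1 : (L + `|s|) * (b - v) <= (L + `|s|) * tau.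
  by rewrite ler_wpM2l ?addr_ge0 // lerBlDl ltW.
have p2 : (L + `|s|) * (u - a) <= (L + `|s|) * tau.
  by rewrite ler_wpM2l ?addr_ge0 // lerBlDl -lerBlDr ltW.
have p3 : lam * (b - a) <= lam * (v - u + 2 * tau).
  rewrite ler_pM2l // ltW //; move: a2 b2; clear; move: (a) (b) (tau).
  by move=> a' b' t ? ?; lra.
move: key sm Ctau p1 p2 p3 tau0; clear.
move: (`|s|) (`|g v - g u - (v - u) *: s|) (`|g b - g a - (b - a) *: s|) (b - v) (u - a) (b - a) (v - u) (tau).
move=> ns G D bv ua ba vu t *; exfalso; nra.
Qed.

(** The difference quotients at [x] are eventually within any [e] of the slope of some
    interpolation, so they are Cauchy, and [H] is complete. *)
Lemma derivable_of_not_steep x : 0 < x < 1 -> irrat x ->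
  (forall lam, 0 < lam -> exists2 N, (0 < N)%N & ~ steep_set (res N g) lam x) ->
  derivable (g : R^o -> H) x 1.
Proof.
move=> /andP[x0 x1] irr nst; rewrite /derivable.
apply: cauchy_cvg; apply: cauchy_exP => e e0.
have e20 : 0 < e / 2 by rewrite divr_gt0.
have [N N0 ns] := nst _ e20.
have NR : (0 < N%:R :> R) by rewrite ltr0n.
pose i := Num.truncn (x * N%:R).
have /andP[i1 i2] : i%:R <= x * N%:R < i.+1%:R by rewrite truncn_itv ?mulr_ge0 ?ltW.
have ix : i%:R / N%:R < x.
  by rewrite lt_neqAle eq_sym irr // ler_pdivrMr.
have xi : x < i.+1%:R / N%:R by rewrite ltr_pdivlMr.
have iN : (i < N)%N.
  rewrite -(ltr_nat R); apply: le_lt_trans i1 _.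
  by rewrite -[ltRHS]mul1r ltr_pM2r.
exists (N%:R *: inc N g i); set s := N%:R *: _.
pose d := Num.min (x - i%:R / N%:R) (i.+1%:R / N%:R - x).
have d0 : 0 < d by rewrite lt_min !subr_gt0 ix xi.
have [d1 d2] : d <= x - i%:R / N%:R /\ d <= i.+1%:R / N%:R - x.
  by rewrite !ge_min !lexx orbT.
suff : (\forall h \near (0 : R^o)^', ball s e (h^-1 *: (g (h *: 1 + x) - g x)))%classic by [].
near=> h.
have h0 : h != 0 by near: h; exact: nbhs_dnbhs_neq.
have hd : `|h| < d.
  near: h; apply: dnbhs0_lt; exact: d0.
rewrite -ball_normE /ball_ /= distrC.
have -> : h^-1 *: (g (h *: 1 + x) - g x) - s = h^-1 *: (g (x + h) - g x - h *: s).
  rewrite [RHS]scalerBr scalerA mulVf // scale1r; congr (_ *: (g _ - _) - _).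
  by rewrite addrC /GRing.scale /= mulr1.
rewrite normrZ normfV ltr_pdivrMl ?normr_gt0 //.
apply: le_lt_trans (_ : e / 2 * `|h| < _); last first.
  by rewrite mulrC ltr_pM2l ?normr_gt0 //; lra.
have [hp|hn] := ltP 0 h.
  have := @res_slope (e / 2) N i x (x + h) x e20 N0 iN ns irr.
  rewrite gtr0_norm // [x + h - x]addrC addKr; apply => //.
  - by rewrite lexx lerDl ltW.
  - by move: hd; rewrite gtr0_norm //; lra.
have hn' : h < 0 by rewrite lt_neqAle h0.
have := @res_slope (e / 2) N i (x + h) x x e20 N0 iN ns irr.
rewrite ltr0_norm // opprD addrA subrr add0r scaleNr opprK -normrN opprD opprB; apply => //.
- by move: hd; rewrite ltr0_norm //; lra.
- by rewrite lexx gerDl ltW.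
Unshelve. all: by end_near.
Qed.

End Slope.

Local Open Scope classical_set_scope.

(** * Null sets of the plane *)

Section NullSet.
Variables (R : realType) (H : hilbertType R).

Definition fractions : set R := [set x | ~ irrat x].

Lemma fractions_countable : countable fractions.
Proof.
apply: (@sub_countable _ _ _ ((fun p : nat * nat => p.1%:R / p.2%:R) @` setT)); last first.
  exact: card_le_trans (card_image_le _ _) (countableP _).
apply: subset_card_le => x nx; apply: contrapT => nex; have {}nx : ~ irrat x := nx; apply: nx => a b b0.
by apply/eqP => xab; apply: nex; exists (a, b).
Qed.

Lemma fractions_measurable : measurable fractions.
Proof. by apply: countable_measurable fractions_countable => t; exact: measurable_set1. Qed.

Lemma steep_inter_measurable (g : R -> H) lam :
  measurable (\bigcap_N steep_set (res N.+1 g) lam).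
Proof. by apply: bigcapT_measurable => N; exact: steep_set_measurable. Qed.

Lemma steep_inter_null (L : R) (g : R -> H) lam : 0 <= L ->
  (forall x y, `|g x - g y| <= L * `|x - y|) -> 0 < lam ->
  lebesgue_measure (\bigcap_N steep_set (res N.+1 g) lam) = 0%E.
Proof.
move=> L0 gL lam0; apply/eqP; rewrite eq_le measure_ge0 andbT.
apply/lee_addgt0Pr => e e0; rewrite add0e.
have d0 : 0 < e * lam / 3 by rewrite !mulr_gt0.
have [[//|N] N0 Ne] := res_variation L0 gL d0.
apply: le_trans (_ : lebesgue_measure (steep_set (res N.+1 g) lam) <= _)%E.
  apply: le_measure; rewrite ?inE; [exact: steep_inter_measurable|exact: steep_set_measurable|].
  by move=> x; apply.
apply: le_trans (steep_measure N0 lam0 Ne) _; rewrite lee_fin le_eqVlt.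
by apply/orP; left; apply/eqP; field; rewrite gt_eqF.
Qed.

Variables (L : R) (f : R -> R -> H).
Hypothesis L0 : 0 <= L.
Hypothesis fL : forall x x' y y', `|f x y - f x' y'| <= L * (`|x - x'| + `|y - y'|).

(** A set outside which [f x] is derivable at [y], for [0 < y < 1]. Being given by countable
    operations on steep sets, it is visibly measurable, so Fubini applies. *)
Definition exceptional : set (R * R) :=
  (setT `*` fractions) `|`
  \bigcup_m \bigcap_N [set p | steep_set (res N.+1 (f p.1)) m.+1%:R^-1 p.2].

Let f_cts y : continuous (f ^~ y : R -> H).
Proof.
move=> x; apply/cvgrPdist_lt => e e0.
have L1 : 0 < L + 1 by rewrite ltr_wpDl.
near=> t; apply: le_lt_trans (fL _ _ _ _) _; rewrite subrr normr0 addr0.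
apply: le_lt_trans (_ : (L + 1) * `|x - t| < _); first by rewrite ler_wpM2r // lerDl.
rewrite -ltr_pdivlMl //; near: t; apply/nbhs_ballP.
exists ((L + 1)^-1 * e); first by rewrite /= mulr_gt0 ?invr_gt0.
by move=> t.
Unshelve. all: by end_near.
Qed.

Let res_cts N (a : R) : continuous ((fun x => res N (f x) a) : R -> H).
Proof.
move=> x; rewrite /res; apply: cvgB; first exact: f_cts.
rewrite /pl; apply: cvg_big => [|i _]; first exact: add_continuous.
by apply: cvgZr; rewrite /inc; apply: cvgB; exact: f_cts.
Qed.

(** Steepness on a given rational interval is an open condition on [x], so this is a countable union
    of measurable rectangles. *)
Lemma steep_measurable2 N lam :
  measurable [set p : R * R | steep_set (res N (f p.1)) lam p.2].
Proof.
rewrite (_ : [set p | _] = \bigcup_i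
   ([set x | steep (res N (f x)) lam i] `*` [set x : R | lo R i < x < hi R i])); last first.
  by apply/seteqP; split=> -[x y] /= [i]; [move=> st yi; exists i|move=> _ [st yi]; exists i].
apply: countable_bigcupT_measurable => [|i]; first exact: countableP.
apply: measurableX; last first.
  rewrite (_ : [set x | _] = `]lo R i, hi R i[); first exact: measurable_itv.
  by apply/seteqP; split=> x /=; rewrite in_itv.
have [vi|nvi] := boolP (valid i); last first.
  rewrite (_ : [set x | _] = set0); first exact: measurable0.
  by apply/seteqP; split=> x // [vi]; rewrite vi in nvi.
pose h x : R := `|res N (f x) (hi R i) - res N (f x) (lo R i)|.
rewrite (_ : [set x | _] = h @^-1` `]lam * (hi R i - lo R i), +oo[); last first.
  by apply/seteqP; split=> x /=; rewrite in_itv /= andbT /steep /h; [case|].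
apply: open_measurable; apply: open_comp; last exact: rray_open.
move=> x _; apply: cvg_norm; apply: cvgB; exact: res_cts.
Qed.

Lemma exceptional_measurable : measurable exceptional.
Proof.
apply: measurableU; first by apply: measurableX => //; exact: fractions_measurable.
apply: bigcupT_measurable => m; apply: bigcapT_measurable => N; exact: steep_measurable2.
Qed.

Lemma exceptional_section x : lebesgue_measure (xsection exceptional x) = 0%E.
Proof.
apply: measure_negligible; first exact: measurable_xsection exceptional_measurable.
have E : xsection exceptional x = fractions `|`
    \bigcup_m \bigcap_N steep_set (res N.+1 (f x)) m.+1%:R^-1.
  apply/seteqP; split=> y; rewrite /xsection /= inE.
    by case=> [[_ fy]|]; [left|right].
  by case=> [fy|]; [left|right].
rewrite E; apply: negligibleU.
  apply/negligibleP; first exact: fractions_measurable.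
  by apply: countable_lebesgue_measure0; exact: fractions_countable.
apply: negligible_bigcup => m; apply/negligibleP; first exact: steep_inter_measurable.
apply: (steep_inter_null L0) => // y y'.
by have := fL x x y y'; rewrite subrr normr0 add0r.
Qed.

Lemma exceptional_null : (lebesgue_measure \x lebesgue_measure)%E exceptional = 0%E.
Proof. by apply: integral0_eq => x _; exact: exceptional_section. Qed.

Lemma swap_exceptional_null :
  measurable [set p : R * R | exceptional (p.2, p.1)] /\
  (lebesgue_measure \x lebesgue_measure)%E [set p : R * R | exceptional (p.2, p.1)] = 0%E.
Proof.
have mS : measurable [set p : R * R | exceptional (p.2, p.1)].
  rewrite -[X in measurable X]setTI; apply: (@measurable_swap _ _ R R) => //.
  exact: exceptional_measurable.
split=> //; rewrite (@product_measure_unique _ _ _ _ _ _ _ (lebesgue_measure \x^ lebesgue_measure)%E) //.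
  apply: integral0_eq => y _ /=.
  rewrite (_ : ysection _ y = xsection exceptional y); first exact: exceptional_section.
  by apply/seteqP; split=> x; rewrite /ysection /xsection /= !inE.
by move=> A B mA mB; exact: product_measure2E.
Qed.

Lemma derivable_off_exceptional x y : ~ exceptional (x, y) -> 0 < y < 1 ->
  derivable (f x : R^o -> H) y 1.
Proof.
move=> nE y01; apply: (derivable_of_not_steep L0) => //.
- by move=> u v; have := fL x x u v; rewrite subrr normr0 add0r.
- by apply: contrapT => ni; apply: nE; left.
move=> lam lam0; pose m := Num.truncn lam^-1.
have ml : m.+1%:R^-1 <= lam.
  by rewrite -[leRHS]invrK lef_pV2 ?posrE ?invr_gt0 // ltW // truncnS_gt.
have : ~ (\bigcap_N [set p | steep_set (res N.+1 (f p.1)) m.+1%:R^-1 p.2]) (x, y).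
  by move=> h; apply: nE; right; exists m.
move=> /existsNP[N /not_implyP[_ ns]]; exists N.+1 => //.
apply: contra_not ns => -[i [vi st] yi]; exists i => //; split=> //.
apply: le_lt_trans st; rewrite ler_pM2r // subr_gt0; exact: lo_lt_hi.
Qed.

End NullSet.

(** * Partial derivatives almost everywhere on the triangle *)

Section Rademacher.
Variables (R : realType) (H : hilbertType R).

Lemma dist_max0 (a b : R) : `|Num.max 0 a - Num.max 0 b| <= `|a - b|.
Proof.
have := ler_norm (a - b); have := ler_norm (b - a); rewrite (distrC b a) => h1 h2.
by rewrite ler_norml; case: (leP 0 a) => ?; case: (leP 0 b) => ?; apply/andP; split; lra.
Qed.

Lemma dist_min (a b c d : R) :
  `|Num.min a b - Num.min c d| <= `|a - c| + `|b - d|.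
Proof.
have := ler_norm (a - c); have := ler_norm (c - a); rewrite (distrC c a) => h1 h2.
have := ler_norm (b - d); have := ler_norm (d - b); rewrite (distrC d b) => h3 h4.
by rewrite ler_norml; case: (leP a b) => ?; case: (leP c d) => ?; apply/andP; split; lra.
Qed.

(** A Lipschitz retraction of the plane onto the triangle: it extends to the plane a map that is
    only controlled on the simplex. *)
Definition retract (x y : R) : R^o * R^o :=
  (clamp x, Num.max 0 (Num.min (1 - clamp x) y)).

Lemma clamp_itv (x : R) : 0 <= clamp x <= 1.
Proof. by rewrite /clamp le_max lexx /= ge_max ler01 ge_min lexx. Qed.

Lemma retract_id x y : 0 <= x -> 0 <= y -> x + y <= 1 -> retract x y = (x, y).
Proof.
move=> x0 y0 xy; rewrite /retract clamp_id; last by apply/andP; split; lra.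
congr (_, _); rewrite min_r; last by lra.
exact/max_idPr.
Qed.

Lemma barycentric_in (p : R^o * R^o) : 0 <= p.1 -> 0 <= p.2 -> p.1 + p.2 <= 1 ->
  @std_simplex R 2 (barycentric p).
Proof.
case: p => x y /= x0 y0 xy; split=> [i||i]; last by rewrite inE.
  by rewrite mxE; case: i => -[|[|[|]]] //= _; lra.
by rewrite !big_ord_recl big_ord0 !mxE /=; lra.
Qed.

Lemma retract_in x y : @std_simplex R 2 (barycentric (retract x y)).
Proof.
have /andP[c0 c1] := clamp_itv x; apply: barycentric_in => //=.
  by rewrite le_max lexx.
by rewrite -lerBrDl ge_max ge_min lexx /= andbT subr_ge0.
Qed.

Lemma barycentric_dist (p q : R^o * R^o) :
  `|barycentric p - barycentric q| <= `|p.1 - q.1| + `|p.2 - q.2|.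
Proof.
rewrite -[leLHS]/(mx_norm _) mx_normrE; apply: bigmax_le => /=.
  by rewrite addr_ge0.
case=> i j _ /=; rewrite !mxE; case: j => -[|[|[|]]] //= _.
- apply: le_trans (ler_normD _ _); rewrite -normrN le_eqVlt; apply/orP; left.
  by apply/eqP; congr `|_|; ring.
- by rewrite lerDl.
- by rewrite lerDr.
Qed.

Lemma lipschitzP (V W : normedModType R) (f : V -> W) (A : set V) :
  [lipschitz f x | x in A] ->
  exists2 M : R, 0 < M & forall x y, A x -> A y -> `|f x - f y| <= M * `|x - y|.
Proof.
move=> [M0 [_ lip]]; exists (Num.max M0 0 + 1).
  by rewrite ltr_wpDl // le_max lexx orbT.
move=> x y Ax Ay; apply: (lip _ _ (x, y)) => //.
by apply: le_lt_trans (_ : Num.max M0 0 < _); rewrite ?ltrDl // le_max lexx.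
Qed.

Lemma near_derivable (V : normedModType R) (f : V -> H) (p v : V) (g : R -> H) x :
  derivable (g : R^o -> H) x 1 ->
  (\forall h \near (0 : R), f (h *: v + p) = g (h + x)) ->
  derivable f p v.
Proof.
move=> /cvg_ex[l cl] fg; apply/cvg_ex; exists l; apply: cvg_trans cl.
apply: near_eq_cvg; have fg0 := nbhs_singleton fg.
have fg' : \forall h \near (0 : R)^', f (h *: v + p) = g (h + x) by apply: cvg_within.
near=> h; rewrite /= [h *: (1 : R^o)]mulr1.
have -> : f (h *: v + p) = g (h + x) by near: h.
by move: fg0; rewrite scale0r !add0r => ->.
Unshelve. all: by end_near.
Qed.

(** The area only involves two partial derivatives, so the one-dimensional theorem on horizontal and
    vertical lines suffices. *)
Lemma ae_derivable (sigma : 'rV[R]_3 -> H) :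
  [lipschitz sigma x | x in @std_simplex R 2] ->
  exists G : set (R * R), [/\ measurable G,
    (lebesgue_measure \x lebesgue_measure)%E G = 0%E &
    forall p : R^o * R^o, open_triangle p -> ~ G p ->
      derivable (sigma \o @barycentric R) p (1, 0) /\
      derivable (sigma \o @barycentric R) p (0, 1)].
Proof.
move=> /lipschitzP[M M0 lip].
pose F x y := sigma (barycentric (retract x y)).
have FL x x' y y' : `|F x y - F x' y'| <= (2 * M) * (`|x - x'| + `|y - y'|).
  apply: le_trans (lip _ _ (retract_in _ _) (retract_in _ _)) _.
  rewrite [2 * M]mulrC -mulrA ler_pM2l //; apply: le_trans (barycentric_dist _ _) _ => /=.
  have cx : `|clamp x - clamp x'| <= `|x - x'|.
    apply: le_trans (dist_max0 _ _) _; apply: le_trans (dist_min _ _ _ _) _.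
    by rewrite subrr normr0 add0r.
  have cy := le_trans (dist_max0 _ _) (dist_min (1 - clamp x) y (1 - clamp x') y').
  have E : `|1 - clamp x - (1 - clamp x')| = `|clamp x - clamp x'|.
    by rewrite distrC; congr `|_|; ring.
  rewrite E in cy; have n2 : 0 <= `|y - y'| by [].
  lra.
have FL' x x' y y' : `|F y x - F y' x'| <= (2 * M) * (`|x - x'| + `|y - y'|).
  by rewrite [`|x - x'| + _]addrC.
have M2 : 0 <= 2 * M by lra.
have [mS S0] := swap_exceptional_null M2 FL'.
exists (exceptional F `|` [set p | exceptional (fun x y => F y x) (p.2, p.1)]).
split.
- by apply: measurableU => //; exact: exceptional_measurable FL.
- apply: null_set_setU => //; first exact: exceptional_measurable FL.
  exact: exceptional_null FL.
case=> x y [/= x0 y0 xy] nE.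
have x1 : 0 < x < 1 by apply/andP; split; lra.
have y1 : 0 < y < 1 by apply/andP; split; lra.
have n1 : ~ exceptional (fun x y => F y x) (y, x) by move=> h; apply: nE; right.
have n2 : ~ exceptional F (x, y) by move=> h; apply: nE; left.
have d0 : 0 < Num.min (1 - x - y) (Num.min x y) by rewrite !lt_min x0 y0 !andbT; lra.
have small : \forall h \near (0 : R), `|h| < Num.min (1 - x - y) (Num.min x y).
  by apply/nbhs_ballP; exists (Num.min (1 - x - y) (Num.min x y)) => //= h; rewrite /ball /= sub0r normrN.
split.
  apply: near_derivable (derivable_off_exceptional M2 FL' n1 x1) _.
  apply: filterS small => h; rewrite !lt_min !ltr_norml => /and3P[/andP[? ?] /andP[? ?] /andP[? ?]].
  rewrite /F retract_id /=; [|lra|lra|lra].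
  congr (sigma (barycentric _)).
  by rewrite -[LHS]/(h * 1 + x, h * 0 + y) mulr1 mulr0 add0r.
apply: near_derivable (derivable_off_exceptional M2 FL n2 y1) _.
apply: filterS small => h; rewrite !lt_min !ltr_norml => /and3P[/andP[? ?] /andP[? ?] /andP[? ?]].
rewrite /F retract_id /=; [|lra|lra|lra].
congr (sigma (barycentric _)).
by rewrite -[LHS]/(h * 0 + x, h * 1 + y) mulr1 mulr0 add0r.
Qed.

End Rademacher.

(** * Chains and filling areas under similarities *)

(* No measurability of [f] and [g] is assumed: for non-negative functions the
   library's integral is the lower integral. *)
Lemma lower_integral_le d (T : measurableType d) (R : realType)
    (mu : {measure set T -> \bar R}) (D E N : set T) (f g : T -> R) (k : R) :
  0 < k -> measurable N -> mu N = 0%E -> D `<=` E ->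
  (forall x, E x -> 0 <= f x) -> (forall x, E x -> 0 <= g x) ->
  (forall x, D x -> ~ N x -> f x <= k * g x) ->
  (\int[mu]_(x in D) (f x)%:E <= k%:E * \int[mu]_(x in E) (g x)%:E)%E.
Proof.
move=> k0 mN N0 DE f0 g0 fg.
rewrite ge0_integralE; last by move=> x /DE Ex; rewrite lee_fin f0.
apply: ge_ereal_sup => _ [h /= hf <-].
have k1 : 0 <= k^-1 by rewrite invr_ge0 ltW.
(* A simple function below [f] on [D], cut off on [N] and divided by [k], lies below [g] on [E], and
   its integral is only divided by [k]. *)
pose h2 := scale_nnsfun (proj_nnsfun h (measurableC mN)) k1.
have h2E x : h2 x = k^-1 * (h x * \1_(~` N) x) by [].
have -> : sintegral mu h = (k%:E * sintegral mu h2)%E.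
  rewrite /h2 sintegralrM muleA -EFinM divff ?gt_eqF // mul1e -!integralT_nnsfun.
  apply: ae_eq_integral => //.
  - by apply: measurableT_comp.
  - by apply: measurableT_comp.
  exists N; split=> // x /= nx; apply: contrapT => Nx; apply: nx => _.
  by rewrite /= -[mindic _ _ _]/(\1_(~` N) x) indicE mem_set //= mulr1.
rewrite lee_pmul2l ?lte_fin //.
rewrite ge0_integralE; last by move=> x Ex; rewrite lee_fin g0.
apply: ereal_sup_ubound => /=; exists h2 => // x; rewrite h2E.
have := hf x; rewrite !patchE.
have hx0 : 0 <= h x by [].
have [Nx|nNx] := pselect (N x).
  move=> _; rewrite indicE memNset /=; last by apply.
  by rewrite !mulr0; case: ifPn => // /set_mem Ex; rewrite lee_fin g0.
rewrite indicE (mem_set (nNx : (~` N) x)) mulr1; case: ifPn => [/set_mem Dx|_].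
  rewrite lee_fin => hfx; rewrite mem_set; last exact: DE.
  by rewrite lee_fin ler_pdivrMl //; apply: le_trans hfx (fg _ _ _).
rewrite lee_fin => hx; have -> : h x = 0 by apply/le_anti; rewrite hx hx0.
by rewrite mulr0; case: ifPn => // /set_mem Ex; rewrite lee_fin g0.
Qed.

Section Area.
Variables (R : realType) (H : hilbertType R).
Implicit Types (sigma tau : 'rV[R]_3 -> H).

Lemma area_density_ge0 sigma p : 0 <= area_density sigma p.
Proof. exact: sqrtr_ge0. Qed.

Lemma area_ge0 sigma : (0 <= area sigma)%E.
Proof. by apply: integral_ge0 => p _; rewrite lee_fin area_density_ge0. Qed.

Lemma area_densityE sigma p : area_density sigma p =
  Num.sqrt (gram ('D_((1, 0) : R^o * R^o) (sigma \o @barycentric R) p)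
                 ('D_((0, 1) : R^o * R^o) (sigma \o @barycentric R) p)).
Proof. by []. Qed.

Lemma derive_near (V : normedModType R) (f g : V -> H) (p v : V) (l : H) :
  is_derive p v f l -> (\forall q \near p, g q = f q) -> 'D_v g p = l.
Proof.
move=> [df fl] gf; rewrite -fl /derive; apply: cvg_lim => //.
apply: cvg_trans df; apply: near_eq_cvg.
have gf0 := nbhs_singleton gf.
have gf' : \forall h \near (0 : R)^', g (h *: v + p) = f (h *: v + p).
  apply: cvg_within.
  have : h *: v + p @[h --> (0 : R)] --> p.
    rewrite -[X in _ --> X]add0r -[X in _ --> X + _](scale0r v).
    by apply: cvgD; [apply: cvgZl|apply: cvg_cst].
  by move=> /(_ _ gf).
near=> h; rewrite /= gf0; congr (_ *: (_ - _)); symmetry.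
by near: h.
Unshelve. all: by end_near.
Qed.

Lemma open_triangle_nbhs (p : R^o * R^o) : open_triangle p ->
  \forall q \near p, open_triangle (q : R^o * R^o).
Proof.
case: p => x y [/= x0 y0 xy].
have d0 : 0 < Num.min ((1 - x - y) / 2) (Num.min x y) by rewrite !lt_min x0 y0 !andbT; lra.
apply/nbhs_ballP; exists (Num.min ((1 - x - y) / 2) (Num.min x y)) => //.
move=> [a b] [] /=; rewrite -!ball_normE /ball_ /= !lt_min !ltr_norml.
move=> /and3P[/andP[? ?] /andP[? ?] /andP[? ?]] /and3P[/andP[? ?] /andP[? ?] /andP[? ?]].
by split=> /=; lra.
Qed.

Section Similarity.
Variables (U : {linear H -> H}) (k : R).
Hypothesis k0 : 0 < k.
Hypothesis Uip : forall x y, ip (U x) (U y) = k * ip x y.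

Lemma sim_norm x : `|U x| = Num.sqrt k * `|x|.
Proof. by rewrite !norm_ip Uip sqrtrM // ltW. Qed.

Lemma sim_gram u v : gram (U u) (U v) = k ^+ 2 * gram u v.
Proof. by rewrite /gram !Uip; ring. Qed.

Lemma sim_continuous : continuous U.
Proof.
move=> x; apply/cvgrPdist_lt => e e0.
have s0 : 0 < Num.sqrt k by rewrite sqrtr_gt0.
near=> y; rewrite -linearB sim_norm -ltr_pdivlMl //.
near: y; apply/nbhs_ballP; exists ((Num.sqrt k)^-1 * e).
  by rewrite /= mulr_gt0 // invr_gt0.
by move=> y; rewrite -ball_normE.
Unshelve. all: by end_near.
Qed.

Lemma sim_is_derive (V : normedModType R) (f : V -> H) (c : H) (p v : V) :
  derivable f p v -> is_derive p v (fun q => U (f q) + c) (U ('D_v f p)).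
Proof.
move=> df.
have cv : h^-1 *: (((fun q => U (f q) + c) \o shift p) (h *: v) - (U (f p) + c)) @[h --> 0^']
    --> U ('D_v f p).
  rewrite (_ : (fun h => _) = fun h => U (h^-1 *: ((f \o shift p) (h *: v) - f p))).
    by apply: continuous_cvg df; exact: sim_continuous.
  apply/funext => h; rewrite linearZ_LR (linearB U) /=; congr (_ *: _).
  by rewrite opprD addrACA subrr addr0.
by split; [apply/cvg_ex; eexists; exact: cv|apply: cvg_lim cv].
Qed.

(** Where [sigma] has partial derivatives, those of [tau] are their images by [U], and [gram] is
    multiplied by [k ^ 2]; the other points form a null set. *)
Lemma area_sim (sigma tau : 'rV[R]_3 -> H) (c : H) : lipschitz_simplex sigma ->
  (forall x, std_simplex x -> tau x = U (sigma x) + c) ->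
  (area tau <= k%:E * area sigma)%E.
Proof.
move=> [lip _] Us; have [G [mG G0 dG]] := ae_derivable lip.
apply: (@lower_integral_le _ _ R (@lebesgue_measure R \x @lebesgue_measure R)%E
  (@open_triangle R) (@open_triangle R) G (area_density tau) (area_density sigma)
  k k0 mG G0) => [//|p _|p _|p tp nGp].
- exact: area_density_ge0.
- exact: area_density_ge0.
have [d1 d2] := dG p tp nGp.
have near_tau : \forall q \near (p : R^o * R^o), (tau \o @barycentric R) q =
    U ((sigma \o @barycentric R) q) + c.
  apply: filterS (open_triangle_nbhs tp) => q [q1 q2 q3]; rewrite /= Us //.
  by apply: barycentric_in; rewrite ltW.
rewrite !area_densityE (derive_near (sim_is_derive c d1) near_tau).
rewrite (derive_near (sim_is_derive c d2) near_tau) sim_gram.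
by rewrite sqrtrM ?sqr_ge0 // sqrtr_sqr ger0_norm // ltW.
Qed.

End Similarity.
End Area.

Section Chains.
Variables (R : realType) (H : hilbertType R).

Definition sing k := 'rV[R]_k.+1 -> H.
Definition chn k := sing k -> 'F_2.

Definition dl k (sigma : sing k) : chn k := fun tau => (sigma == tau)%:R.

Lemma suppD k (c1 c2 : chn k) :
  chain_supp (c1 \+ c2) `<=` chain_supp c1 `|` chain_supp c2.
Proof.
move=> s /=; rewrite /chain_supp /=; have [->|n1] := eqVneq (c1 s) 0; last by left.
by rewrite add0r; right.
Qed.

Lemma lip_boundaryE k (c : chn k.+1) (A : set (sing k.+1)) tau : finite_set A ->
  chain_supp c `<=` A ->
  lip_boundary c tau = \sum_(sigma \in A) \sum_(i < k.+2 | simplex_face i sigma == tau) c sigma.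
Proof.
move=> fA cA; apply: fsbig_widen => // s [_ /=]; rewrite /chain_supp /= => /negP.
by rewrite negbK => /eqP ->; rewrite big1.
Qed.

Lemma lip_boundaryD k (c1 c2 : chn k.+1) :
  finite_set (chain_supp c1) -> finite_set (chain_supp c2) ->
  lip_boundary (c1 \+ c2) = lip_boundary c1 \+ lip_boundary c2.
Proof.
move=> f1 f2; apply/funext => tau /=.
have fA : finite_set (chain_supp c1 `|` chain_supp c2) by rewrite finite_setU.
rewrite (lip_boundaryE tau fA (@suppD _ _ _)).
rewrite (lip_boundaryE tau fA (@subsetUl _ _ _)) (lip_boundaryE tau fA (@subsetUr _ _ _)).
by rewrite -fsbig_split //; apply: eq_fsbigr => s _; rewrite -big_split.
Qed.

Lemma lipschitz_chainD k (c1 c2 : chn k) :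
  lipschitz_chain c1 -> lipschitz_chain c2 -> lipschitz_chain (c1 \+ c2).
Proof.
move=> [f1 l1] [f2 l2]; split.
  by apply: sub_finite_set (@suppD _ _ _) _; rewrite finite_setU.
by move=> s /suppD[]; [exact: l1|exact: l2].
Qed.

Lemma vol2E (c : chn 2) (A : set (sing 2)) : finite_set A -> chain_supp c `<=` A ->
  vol2 c = (\sum_(sigma \in A) (if c sigma != 0%R then area sigma else 0%R))%E.
Proof.
move=> fA cA; rewrite /vol2 -(@fsbig_widen _ _ _ _ (chain_supp c) A) //.
  by apply: eq_fsbigr => s /set_mem /= ->.
by move=> s [_ /=]; rewrite /chain_supp /= => /negP; rewrite negbK => ->.
Qed.

Lemma vol2_ge0 (c : chn 2) : (0 <= vol2 c)%E.
Proof.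
by apply: fsume_ge0 => s _; exact: area_ge0.
Qed.

Lemma vol2D (c1 c2 : chn 2) :
  finite_set (chain_supp c1) -> finite_set (chain_supp c2) ->
  (vol2 (c1 \+ c2)%R <= vol2 c1 + vol2 c2)%E.
Proof.
move=> f1 f2.
have fA : finite_set (chain_supp c1 `|` chain_supp c2) by rewrite finite_setU.
rewrite (vol2E fA (@suppD _ _ _)).
rewrite (vol2E fA (@subsetUl _ _ _)) (vol2E fA (@subsetUr _ _ _)).
rewrite -fsbig_split // !fsbig_finite //; apply: lee_sum => s _ /=.
have a0 := area_ge0 s.
have [->|n1] := eqVneq (c1 s) 0; first by rewrite !add0r.
rewrite -[X in (_ <= X)%E]/(area s + (if c2 s != 0%R then area s else 0))%E.
by case: ifPn => _; case: ifPn => _; rewrite ?adde0 //; [exact: leeDl|exact: adde_ge0].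
Qed.

Lemma dl_supp k (s : sing k) : chain_supp (dl s) = [set s].
Proof.
apply/seteqP; split=> t; rewrite /chain_supp /dl /=; first by have [->|_] := eqVneq s t; rewrite ?eqxx.
by move=> ->; rewrite eqxx.
Qed.

Lemma dl_lipschitz k (s : sing k) : lipschitz_simplex s -> lipschitz_chain (dl s).
Proof.
by move=> ls; split; rewrite dl_supp; [exact: finite_set1|move=> _ ->].
Qed.

Lemma vol2_dl (s : sing 2) : vol2 (dl s) = area s.
Proof. by rewrite /vol2 dl_supp fsbig_set1. Qed.

Lemma boundary_dl (s : sing 2) : lip_boundary (dl s) =
  dl (simplex_face (inord 0) s) \+ dl (simplex_face (inord 1) s) \+
  dl (simplex_face (inord 2) s).
Proof.
apply/funext => tau; rewrite /lip_boundary dl_supp fsbig_set1.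
rewrite /dl eqxx big_mkcond !big_ord_recl big_ord0 /= addr0 addrA.
have -> : inord 0 = ord0 :> 'I_3 by apply/val_inj; rewrite /= inordK.
have -> : inord 1 = lift ord0 ord0 :> 'I_3 by apply/val_inj; rewrite /= inordK.
have -> : inord 2 = lift ord0 (lift ord0 ord0) :> 'I_3 by apply/val_inj; rewrite /= inordK.
by do 3 case: ifP.
Qed.

Lemma fill_le (y : chn 2) : lipschitz_chain y ->
  (fill_hilbert (lip_boundary y) <= vol2 y)%E.
Proof. by move=> ly; apply: ereal_inf_lbound; exists y. Qed.

Lemma fill_ge0 (w : chn 1) : (0 <= fill_hilbert w)%E.
Proof. by apply: le_ereal_inf_tmp => _ [y _ <-]; exact: vol2_ge0. Qed.

Lemma fillD (w1 w2 : chn 1) :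
  (fill_hilbert (w1 \+ w2)%R <= fill_hilbert w1 + fill_hilbert w2)%E.
Proof.
have [->|n1] := eqVneq (fill_hilbert w1) +oo%E.
  by rewrite addye ?leey // gt_eqF // (lt_le_trans _ (fill_ge0 _)).
have [->|n2] := eqVneq (fill_hilbert w2) +oo%E.
  by rewrite addey ?leey // gt_eqF // (lt_le_trans _ (fill_ge0 _)).
have fin1 : fill_hilbert w1 \is a fin_num by rewrite ge0_fin_numE ?fill_ge0 // ltey.
have fin2 : fill_hilbert w2 \is a fin_num by rewrite ge0_fin_numE ?fill_ge0 // ltey.
apply/lee_addgt0Pr => e e0; have e20 : 0 < e / 2 by rewrite divr_gt0.
have [_ [y1 [l1 b1] <-] v1] := lb_ereal_inf_adherent e20 fin1.
have [_ [y2 [l2 b2] <-] v2] := lb_ereal_inf_adherent e20 fin2.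
have -> : w1 \+ w2 = lip_boundary (y1 \+ y2).
  by rewrite lip_boundaryD ?b1 ?b2 //; [case: l1|case: l2].
apply: le_trans (fill_le (lipschitz_chainD l1 l2)) _.
apply: le_trans (vol2D (proj1 l1) (proj1 l2)) _.
apply: le_trans (leeD (ltW v1) (ltW v2)) _.
by rewrite addeACA -EFinD -splitr.
Qed.

End Chains.

Lemma fsume_le_scale (R : realType) (I : choiceType) (A : set I) (f g : I -> \bar R) (k : R) :
  finite_set A -> (forall i, A i -> 0 <= g i)%E -> (forall i, A i -> f i <= k%:E * g i)%E ->
  (\sum_(i \in A) f i <= k%:E * \sum_(i \in A) g i)%E.
Proof.
move=> fA g0 fg; rewrite (fsbig_finite _ f fA) (fsbig_finite _ g fA).
rewrite big_seq [X in (_ <= _ * X)%E]big_seq ge0_sume_distrr; last first.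
  by move=> i; rewrite in_fset_set // => /set_mem; exact: g0.
by apply: lee_sum => i; rewrite in_fset_set // => /set_mem; exact: fg.
Qed.

Section VertexMaps.
Variables (R : realType).

Lemma vertex_mapE m n (v : 'I_m -> 'I_n) (x : 'rV[R]_m) i :
  vertex_map v x 0 i = \sum_(j < m | v j == i) x 0 j.
Proof.
rewrite /vertex_map summxE [RHS]big_mkcond; apply: eq_bigr => j _.
by rewrite !mxE eqxx /= eq_sym; case: eqP => _; rewrite ?mulr1 ?mulr0.
Qed.

Lemma vertex_map_simplex m n (v : 'I_m.+1 -> 'I_n) (s : {set 'I_n}) (x : 'rV[R]_m.+1) :
  (forall j, v j \in s) -> std_simplex x -> geom_simplex s (vertex_map v x).
Proof.
move=> vs [x0 x1 _]; split=> [i||i].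
- by rewrite vertex_mapE sumr_ge0.
- under eq_bigr do rewrite vertex_mapE.
  rewrite -x1 (exchange_big_dep predT) //=; apply: eq_bigr => j _.
  by rewrite (big_pred1 (v j)) // => i; rewrite eq_sym.
- move=> ns; rewrite vertex_mapE big1 // => j /eqP vj.
  by move: ns; rewrite -vj vs.
Qed.

Lemma face_simplex k (i : 'I_k.+2) (x : 'rV[R]_k.+1) :
  std_simplex x -> std_simplex (vertex_map (lift i) x).
Proof. by apply: vertex_map_simplex => j; rewrite inE. Qed.

End VertexMaps.

Section Similarities.
Variables (R : realType) (H : hilbertType R).
Variables (U : {linear H -> H}) (V : H -> H) (k : R) (c : H).
Hypothesis k0 : 0 < k.
Hypothesis Uip : forall x y, ip (U x) (U y) = k * ip x y.
Hypothesis UK : cancel U V.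
Hypothesis VK : cancel V U.

(** Singular simplices are extended by 0 off the simplex, so a translation must act on the simplex
    only. *)
Definition cst_on m (c : H) : sing H m := on_simplex (fun=> c).

Definition act m (sigma : sing H m) : sing H m := fun x => U (sigma x) + cst_on c x.
Definition deact m (tau : sing H m) : sing H m := fun x => V (tau x - cst_on c x).

Lemma on_simplex_in m (f : sing H m) x : std_simplex x -> on_simplex f x = f x.
Proof. by move=> sx; rewrite /on_simplex /patch mem_set. Qed.

Lemma on_simplex_out m (f : sing H m) x : ~ std_simplex x -> on_simplex f x = 0.
Proof. by move=> sx; rewrite /on_simplex /patch memNset. Qed.

Lemma actK m : cancel (@act m) (@deact m).
Proof. by move=> s; apply/funext => x; rewrite /act /deact addrK UK. Qed.

Lemma deactK m : cancel (@deact m) (@act m).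
Proof. by move=> s; apply/funext => x; rewrite /act /deact VK subrK. Qed.

Lemma face_act m (i : 'I_m.+2) (s : sing H m.+1) :
  simplex_face i (act s) = act (simplex_face i s).
Proof.
apply/funext => x; rewrite /act /simplex_face.
have [sx|nsx] := pselect (std_simplex x).
  rewrite !on_simplex_in //= /cst_on !on_simplex_in //; exact: face_simplex.
by rewrite !on_simplex_out // /cst_on on_simplex_out // linear0 addr0.
Qed.

Definition push m (w : chn H m) : chn H m := w \o @deact m.

Lemma push_supp m (w : chn H m) : chain_supp (push w) = @act m @` chain_supp w.
Proof.
apply/seteqP; split=> [t|_ [s ws <-]]; rewrite /chain_supp /push /=.
  by move=> wt; exists (deact t) => //; rewrite deactK.
by rewrite actK.
Qed.

Lemma act_lipschitz m (s : sing H m) : lipschitz_simplex s -> lipschitz_simplex (act s).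
Proof.
move=> [/lipschitzP[M M0 lip] s0]; split; last first.
  by move=> x nx; rewrite /act s0 // linear0 /cst_on on_simplex_out // addr0.
exists (Num.sqrt k * M); split=> [|M' /ltW MM' [x y] [/= sx sy]]; first exact: num_real.
apply: le_trans (ler_wpM2r (normr_ge0 _) MM').
rewrite /act /cst_on !on_simplex_in // opprD addrACA subrr addr0 -linearB.
by rewrite (sim_norm k0 Uip) -mulrA ler_wpM2l ?sqrtr_ge0 // lip.
Qed.

Lemma push_lipschitz m (w : chn H m) : lipschitz_chain w -> lipschitz_chain (push w).
Proof.
move=> [fw lw]; rewrite /lipschitz_chain push_supp; split; first exact: finite_image.
by move=> _ [s ws <-]; apply: act_lipschitz; exact: lw.
Qed.

Lemma push_bij m (w : chn H m) : set_bij (chain_supp w) (chain_supp (push w)) (@act m).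
Proof.
rewrite push_supp; apply: inj_bij; exact: in2W (can_inj (@actK m)).
Qed.

Lemma push_boundary m (w : chn H m.+1) : lip_boundary (push w) = push (lip_boundary w).
Proof.
apply/funext => tau; rewrite /push /= /lip_boundary.
rewrite (reindex_fsbig _ _ _ _ (push_bij w)); apply: eq_fsbigr => s _.
rewrite /push /= actK; apply: eq_bigl => i; rewrite face_act.
by rewrite -[in LHS](deactK tau) (can_eq (@actK m)).
Qed.

Lemma push_vol2 (y : chn H 2) : lipschitz_chain y -> (vol2 (push y) <= k%:E * vol2 y)%E.
Proof.
move=> [fy ly]; rewrite /vol2 (reindex_fsbig _ _ _ _ (push_bij y)).
apply: fsume_le_scale => // s ys; first exact: area_ge0.
apply: (area_sim k0 Uip (ly _ ys)) => x sx.
by rewrite /act /cst_on on_simplex_in.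
Qed.

(** An inequality is enough: the inverse similarity gives the reverse one. *)
Lemma fill_push (w : chn H 1) : (fill_hilbert (push w) <= k%:E * fill_hilbert w)%E.
Proof.
rewrite -lee_pdivrMl //; apply: le_ereal_inf_tmp => _ [y [ly <-] <-].
rewrite lee_pdivrMl //; apply: le_trans (push_vol2 ly).
rewrite -push_boundary; apply: fill_le; exact: push_lipschitz.
Qed.

End Similarities.

(** * The filling area of affine triangles *)

Section Affine.
Variables (R : realType) (H : hilbertType R).

Definition aff k (p : 'I_k.+1 -> H) : sing H k :=
  on_simplex (fun x => \sum_j x 0 j *: p j).

Definition seg (a b : H) : sing H 1 := aff (fun j : 'I_2 => [:: a; b]`_j).
Definition tri (a b c : H) : sing H 2 := aff (fun j : 'I_3 => [:: a; b; c]`_j).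

Lemma face_aff k (i : 'I_k.+2) (p : 'I_k.+2 -> H) :
  simplex_face i (aff p) = aff (p \o lift i).
Proof.
apply/funext => x; rewrite /simplex_face /aff.
have [sx|nsx] := pselect (std_simplex x); last by rewrite !on_simplex_out.
rewrite (on_simplex_in _ sx) /= (on_simplex_in _ (face_simplex i sx)) (on_simplex_in _ sx).
under eq_bigr do rewrite vertex_mapE scaler_suml.
rewrite (exchange_big_dep predT) //=; apply: eq_bigr => j _.
by rewrite (big_pred1 (lift i j)) // => l; rewrite eq_sym.
Qed.

Lemma aff_lipschitz k (p : 'I_k.+1 -> H) : lipschitz_simplex (aff p).
Proof.
split; last by move=> x nx; rewrite /aff on_simplex_out.
exists (\sum_j `|p j|); split=> [|M /ltW lM [x y] [/= sx sy]]; first exact: num_real.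
apply: le_trans (ler_wpM2r (normr_ge0 _) lM).
rewrite /aff !on_simplex_in // -sumrB mulr_suml; apply: le_trans (ler_norm_sum _ _ _) _.
apply: ler_sum => j _; rewrite -scalerBl normrZ mulrC ler_wpM2l //.
have -> : x 0 j - y 0 j = (x - y) 0 j by rewrite !mxE.
by rewrite -[leRHS]/(mx_norm _) mx_normrE; apply: (le_bigmax _ _ (0, j)).
Qed.

Lemma triE (a b c : H) p : open_triangle p ->
  tri a b c (barycentric p) = a + (p.1 *: (b - a) + p.2 *: (c - a)).
Proof.
case: p => x y [/= x0 y0 xy]; rewrite /tri /aff on_simplex_in; last first.
  by apply: barycentric_in => /=; rewrite ltW.
rewrite !big_ord_recl big_ord0 !mxE /= addr0.
have -> : (1 - x - y) *: a = a - (x *: a + y *: a) by rewrite !scalerBl scale1r opprD addrA.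
by rewrite !scalerBr -addrA; congr (_ + _); rewrite [RHS]addrACA -opprD addrC.
Qed.

Lemma is_derive_linear_pair (u v a : H) (p w : R^o * R^o) :
  is_derive p w (fun q : R^o * R^o => a + (q.1 *: u + q.2 *: v)) (w.1 *: u + w.2 *: v).
Proof.
have cv : h^-1 *: (((fun q : R^o * R^o => a + (q.1 *: u + q.2 *: v)) \o shift p) (h *: w)
    - (a + (p.1 *: u + p.2 *: v))) @[h --> (0 : R)^'] --> w.1 *: u + w.2 *: v.
  have cc : cst (w.1 *: u + w.2 *: v) @ (0 : R)^' --> w.1 *: u + w.2 *: v by exact: cvg_cst.
  apply: cvg_trans cc; apply: near_eq_cvg; near=> h.
  have h0 : h != 0 by near: h; exact: nbhs_dnbhs_neq.
  rewrite /= opprD addrACA subrr add0r opprD addrACA -!scalerBl !addrK.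
  by rewrite scalerDr !scalerA !mulrA mulVf // !mul1r.
by split; [apply/cvg_ex; eexists; exact: cv|apply: cvg_lim cv].
Unshelve. all: by end_near.
Qed.

(** The constant density is integrated over the unit square instead of the triangle. The lost factor
    2 is harmless: the bound serves for finiteness, for degenerate triangles and for remainders that
    tend to 0. *)
Lemma area_tri_le (a b c : H) : (area (tri a b c) <= (Num.sqrt (gram (b - a) (c - a)))%:E)%E.
Proof.
have s0 : 0 <= Num.sqrt (gram (b - a) (c - a)) by exact: sqrtr_ge0.
pose B : set (R * R) := `[0, 1] `*` `[0, 1].
have mB : measurable B by apply: measurableX; exact: measurable_itv.
apply: le_trans (_ : 1%:E * \int[lebesgue_measure \x lebesgue_measure]_(p in B)
   (Num.sqrt (gram (b - a) (c - a)))%:E <= _)%E.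
  apply: (@lower_integral_le _ _ R (@lebesgue_measure R \x @lebesgue_measure R)%E
    (@open_triangle R) B set0) => //.
  - by case=> x y [/= x0 y0 xy]; split; rewrite /= in_itv /=; apply/andP; split; lra.
  - by move=> p _; exact: area_density_ge0.
  move=> p tp _; rewrite mul1r area_densityE.
  have near_tri : \forall q \near (p : R^o * R^o), (tri a b c \o @barycentric R) q =
    a + (q.1 *: (b - a) + q.2 *: (c - a)).
    by apply: filterS (open_triangle_nbhs tp) => q tq; rewrite /= triE.
  rewrite (derive_near (is_derive_linear_pair _ _ _ _ _) near_tri).
  rewrite (derive_near (is_derive_linear_pair _ _ _ _ _) near_tri) /=.
  by rewrite !scale1r !scale0r addr0 add0r.
rewrite mul1e integral_cst //= product_measure1E; [|exact: measurable_itv|exact: measurable_itv].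
have E1 : lebesgue_measure (`[0%R, 1%R]%classic : set R) = 1%E.
  by rewrite lebesgue_measure_itv /= lte01 oppr0 adde0.
suff : ((Num.sqrt (gram (b - a) (c - a)))%:E * (lebesgue_measure (`[0%R, 1%R]%classic : set R) *
    lebesgue_measure (`[0%R, 1%R]%classic : set R)) <= (Num.sqrt (gram (b - a) (c - a)))%:E)%E by [].
by rewrite E1 !mule1.
Qed.

Definition bdtri (a b c : H) : chn H 1 := dl (seg b c) \+ dl (seg a c) \+ dl (seg a b).

Lemma boundary_tri a b c : lip_boundary (dl (tri a b c)) = bdtri a b c.
Proof.
rewrite boundary_dl /bdtri /tri /seg !face_aff.
congr (dl (aff _) \+ dl (aff _) \+ dl (aff _)); apply/funext => -[j jlt] /=;
 rewrite /bump !inordK //; by case: j jlt => [|[|]].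
Qed.

(** The diagonal [seg a c] cancels mod 2. *)
Definition bdquad (a b c d : H) : chn H 1 := bdtri a b c \+ bdtri a c d.

Definition finfill (w : chn H 1) := (fill_hilbert w < +oo)%E.
Definition fillR (w : chn H 1) : R := fine (fill_hilbert w).

Lemma finfillE w : finfill w -> fill_hilbert w = (fillR w)%:E.
Proof. by move=> fw; rewrite fineK // ge0_fin_numE ?fill_ge0. Qed.

Lemma fillR_ge0 w : 0 <= fillR w.
Proof. by rewrite fine_ge0 // fill_ge0. Qed.

Lemma finfillD w1 w2 : finfill w1 -> finfill w2 -> finfill (w1 \+ w2).
Proof.
by move=> f1 f2; apply: le_lt_trans (fillD _ _) _; rewrite lte_add_pinfty.
Qed.

Lemma fillRD w1 w2 : finfill w1 -> finfill w2 -> fillR (w1 \+ w2) <= fillR w1 + fillR w2.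
Proof.
move=> f1 f2; have := fillD w1 w2.
by rewrite !finfillE ?lee_fin //; exact: finfillD.
Qed.

Lemma fill_tri_le a b c :
  (fill_hilbert (bdtri a b c) <= (Num.sqrt (gram (b - a) (c - a)))%:E)%E.
Proof.
rewrite -boundary_tri; apply: le_trans (area_tri_le a b c).
by rewrite -vol2_dl; apply: fill_le; apply: dl_lipschitz; exact: aff_lipschitz.
Qed.

Lemma finfill_tri a b c : finfill (bdtri a b c).
Proof. by apply: le_lt_trans (fill_tri_le a b c) _; rewrite ltry. Qed.

Lemma finfill_quad a b c d : finfill (bdquad a b c d).
Proof. by apply: finfillD; exact: finfill_tri. Qed.

Lemma fillR_tri_le a b c : fillR (bdtri a b c) <= Num.sqrt (gram (b - a) (c - a)).
Proof. by rewrite -lee_fin -finfillE ?fill_tri_le //; exact: finfill_tri. Qed.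

Lemma fillR_sim (U : {linear H -> H}) (V : H -> H) (k : R) (c : H) w :
  0 < k -> (forall x y, ip (U x) (U y) = k * ip x y) -> cancel U V -> cancel V U ->
  finfill w -> fillR (push V c w) <= k * fillR w.
Proof.
move=> k0 Uip UK VK fw; have le := fill_push c k0 Uip UK VK w.
rewrite -lee_fin EFinM -(finfillE fw) -finfillE //.
by apply: le_lt_trans le _; rewrite finfillE // -EFinM ltry.
Qed.

Lemma act_aff (U : {linear H -> H}) c k (p : 'I_k.+1 -> H) :
  act U c (aff p) = aff (fun j => U (p j) + c).
Proof.
apply/funext => x; rewrite /act /aff /cst_on.
have [sx|nsx] := pselect (std_simplex x); last by rewrite !on_simplex_out // linear0 addr0.
rewrite !on_simplex_in // linear_sum /=.
under [RHS]eq_bigr do rewrite scalerDr.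
rewrite big_split -scaler_suml /=; case: sx => _ -> _; rewrite scale1r; congr (_ + _).
by apply: eq_bigr => j _; rewrite linearZ.
Qed.

Lemma push_dl (U : {linear H -> H}) (V : H -> H) c k (s : sing H k) :
  cancel U V -> cancel V U -> push V c (dl s) = dl (act U c s).
Proof.
move=> UK VK; apply/funext => t; rewrite /push /dl /=.
by rewrite -[in RHS](deactK c VK t) (can_eq (@actK _ _ U V c UK k)).
Qed.

Lemma act_seg (U : {linear H -> H}) c a b : act U c (seg a b) = seg (U a + c) (U b + c).
Proof.
by rewrite /seg act_aff; congr aff; apply/funext => -[[|[|]] //=].
Qed.

Lemma push_tri (U : {linear H -> H}) (V : H -> H) c0 a b c :
  cancel U V -> cancel V U ->
  push V c0 (bdtri a b c) = bdtri (U a + c0) (U b + c0) (U c + c0).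
Proof.
move=> UK VK; have pD w1 w2 : push V c0 (w1 \+ w2) = push V c0 w1 \+ push V c0 w2 by [].
by rewrite /bdtri !pD !(push_dl _ _ UK VK) !act_seg.
Qed.

Lemma fillR_tri_sim (U : {linear H -> H}) (V : H -> H) (k : R) c0 a b c :
  0 < k -> (forall x y, ip (U x) (U y) = k * ip x y) -> cancel U V -> cancel V U ->
  fillR (bdtri (U a + c0) (U b + c0) (U c + c0)) <= k * fillR (bdtri a b c).
Proof.
move=> k0 Uip UK VK; rewrite -(push_tri _ _ _ _ UK VK).
by apply: fillR_sim => //; exact: finfill_tri.
Qed.

Lemma fillR_quad_sim (U : {linear H -> H}) (V : H -> H) (k : R) c0 a b c d :
  0 < k -> (forall x y, ip (U x) (U y) = k * ip x y) -> cancel U V -> cancel V U ->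
  fillR (bdquad (U a + c0) (U b + c0) (U c + c0) (U d + c0)) <= k * fillR (bdquad a b c d).
Proof.
move=> k0 Uip UK VK; rewrite /bdquad -!(push_tri _ _ _ _ UK VK).
by apply: (@fillR_sim U V k c0 (bdquad a b c d)) => //; exact: finfill_quad.
Qed.

Lemma bdtriE a b c tau :
  bdtri a b c tau = (seg b c == tau)%:R + (seg a c == tau)%:R + (seg a b == tau)%:R.
Proof. by []. Qed.

Lemma bdquadE a b c d tau : bdquad a b c d tau = bdtri a b c tau + bdtri a c d tau.
Proof. by []. Qed.

End Affine.

Global Opaque bdtri bdquad finfill fillR.

Lemma natr_xorb (a b : bool) : a%:R + b%:R = (xorb a b)%:R :> 'F_2.
Proof. by apply/eqP; case: a; case: b. Qed.

(** At each singular simplex [tau], an identity of chains mod 2 is a tautology on exclusive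
    disjunctions of the atoms [seg x y == tau]. *)
Ltac chain_eq := let tau := fresh "tau" in
  apply/funext; intro tau; rewrite /= ?bdquadE !bdtriE !natr_xorb;
  apply: (f_equal (fun b : bool => b%:R)); btauto.

Ltac finfill := repeat match goal with
  | h : is_true (finfill ?w) |- is_true (finfill ?w) => exact h
  | |- is_true (finfill (bdtri _ _ _)) => exact (finfill_tri _ _ _)
  | |- is_true (finfill (bdquad _ _ _ _)) => exact (finfill_quad _ _ _ _)
  | w := _ |- is_true (finfill ?w) => unfold w
  | |- is_true (finfill _) => apply finfillD
  end.

(** * Symmetries of the filling area *)

Section Symmetries.
Variables (R : realType) (H : hilbertType R).
Implicit Types a b c d : H.

(* Reflection in the hyperplane orthogonal to [w]; the identity for [w = 0]. *)
Definition refl (w x : H) : H := x - (2 * ip x w / ip w w) *: w.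

Fact refl_linear w : linear (refl w).
Proof.
move=> k x y; rewrite /refl ipDl ipZl scalerBr scalerA addrACA -opprD -scalerDl.
by congr (_ - _ *: _); ring.
Qed.

HB.instance Definition _ w := GRing.isLinear.Build R H H *:%R (refl w) (refl_linear w).

Lemma refl_ip w x y : ip (refl w x) (refl w y) = ip x y.
Proof.
rewrite /refl; have [->|w0] := eqVneq w 0; first by rewrite !scaler0 !subr0.
rewrite !ipE (ipC w y); field; by rewrite ip_eq0.
Qed.

Lemma reflK w : involutive (refl w).
Proof.
move=> x; have [->|w0] := eqVneq w 0; first by rewrite /refl !scaler0 !subr0.
rewrite {1}/refl (_ : ip (refl w x) w = - ip x w).
  by rewrite /refl mulrN mulNr scaleNr opprK subrK.
by rewrite /refl !ipE; field; rewrite ip_eq0.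
Qed.

Lemma refl_swap a b : ip a a = ip b b -> refl (a - b) a = b.
Proof.
move=> ab; have [->|n] := eqVneq a b; first by rewrite /refl subrr scaler0 subr0.
have w0 : ip (a - b) (a - b) != 0 by rewrite ip_eq0 subr_eq0.
rewrite /refl (_ : 2 * _ / _ = 1) ?scale1r ?subKr //.
have -> : 2 * ip a (a - b) = ip (a - b) (a - b) by rewrite !ipE (ipC b a) -ab; ring.
by rewrite divff.
Qed.

Lemma refl_fix w x : ip x w = 0 -> refl w x = x.
Proof. by move=> xw; rewrite /refl xw mulr0 mul0r scale0r subr0. Qed.

Lemma fillR_tri_trans c0 a b c : fillR (bdtri (a + c0) (b + c0) (c + c0)) = fillR (bdtri a b c).
Proof.
have le c1 x y z : fillR (bdtri (x + c1) (y + c1) (z + c1)) <= fillR (bdtri x y z).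
  have := @fillR_tri_sim _ _ idfun idfun 1 c1 x y z ltr01; rewrite mul1r; apply => //.
  by move=> ? ?; rewrite mul1r.
apply/le_anti; rewrite le /=.
by have := le (- c0) (a + c0) (b + c0) (c + c0); rewrite !addrK.
Qed.

Lemma fillR_quad_trans c0 a b c d :
  fillR (bdquad (a + c0) (b + c0) (c + c0) (d + c0)) = fillR (bdquad a b c d).
Proof.
have le c1 x y z t : fillR (bdquad (x + c1) (y + c1) (z + c1) (t + c1)) <= fillR (bdquad x y z t).
  have := @fillR_quad_sim _ _ idfun idfun 1 c1 x y z t ltr01; rewrite mul1r; apply => //.
  by move=> ? ?; rewrite mul1r.
apply/le_anti; rewrite le /=.
by have := le (- c0) (a + c0) (b + c0) (c + c0) (d + c0); rewrite !addrK.
Qed.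

Lemma scale_ip (l : R) (x y : H) : ip (l *: x) (l *: y) = l ^+ 2 * ip x y.
Proof. by rewrite ipZl ipZr; ring. Qed.

Lemma fillR_tri_scale (l : R) a b c : 0 < l ->
  fillR (bdtri (l *: a) (l *: b) (l *: c)) = l ^+ 2 * fillR (bdtri a b c).
Proof.
have le (k : R) (x y z : H) : 0 < k ->
    fillR (bdtri (k *: x) (k *: y) (k *: z)) <= k ^+ 2 * fillR (bdtri x y z).
  move=> k0; have := @fillR_tri_sim R H ( *:%R k) ( *:%R k^-1) (k ^+ 2) 0 x y z.
  rewrite !addr0; apply; first exact: exprn_gt0.
  - by move=> ? ?; exact: scale_ip.
  - by move=> ?; rewrite /= scalerA mulVf ?scale1r ?gt_eqF.
  - by move=> ?; rewrite /= scalerA mulfV ?scale1r ?gt_eqF.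
move=> l0; apply/le_anti; rewrite le //=.
have := le l^-1 (l *: a) (l *: b) (l *: c); rewrite !scalerA mulVf ?gt_eqF // !scale1r invr_gt0.
by move=> /(_ l0); rewrite exprVn ler_pdivlMl ?exprn_gt0.
Qed.

Lemma fillR_quad_scale (l : R) a b c d : 0 < l ->
  fillR (bdquad (l *: a) (l *: b) (l *: c) (l *: d)) = l ^+ 2 * fillR (bdquad a b c d).
Proof.
have le (k : R) (x y z t : H) : 0 < k ->
    fillR (bdquad (k *: x) (k *: y) (k *: z) (k *: t)) <= k ^+ 2 * fillR (bdquad x y z t).
  move=> k0; have := @fillR_quad_sim R H ( *:%R k) ( *:%R k^-1) (k ^+ 2) 0 x y z t.
  rewrite !addr0; apply; first exact: exprn_gt0.
  - by move=> ? ?; exact: scale_ip.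
  - by move=> ?; rewrite /= scalerA mulVf ?scale1r ?gt_eqF.
  - by move=> ?; rewrite /= scalerA mulfV ?scale1r ?gt_eqF.
move=> l0; apply/le_anti; rewrite le //=.
have := le l^-1 (l *: a) (l *: b) (l *: c) (l *: d).
rewrite !scalerA mulVf ?gt_eqF // !scale1r invr_gt0.
by move=> /(_ l0); rewrite exprVn ler_pdivlMl ?exprn_gt0.
Qed.

Lemma fillR_quad_refl w a b c d :
  fillR (bdquad (refl w a) (refl w b) (refl w c) (refl w d)) = fillR (bdquad a b c d).
Proof.
have le x y z t : fillR (bdquad (refl w x) (refl w y) (refl w z) (refl w t)) <= fillR (bdquad x y z t).
  have := @fillR_quad_sim _ _ (refl w : {linear H -> H}) (refl w) 1 0 x y z t ltr01.
  rewrite mul1r !addr0; apply; [by move=> ? ?; rewrite mul1r refl_ip|exact: reflK|exact: reflK].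
apply/le_anti; rewrite le /=.
by have := le (refl w a) (refl w b) (refl w c) (refl w d); rewrite !reflK.
Qed.

Lemma fillR_degenerate a b c : gram (b - a) (c - a) = 0 -> fillR (bdtri a b c) = 0.
Proof.
move=> g0; apply/le_anti; rewrite fillR_ge0 andbT.
by have := fillR_tri_le a b c; rewrite g0 sqrtr0.
Qed.

Lemma fillR_absorb w1 w2 : finfill w1 -> finfill w2 -> fillR w2 = 0 :> R -> @fillR R H (w1 \+ w2) <= fillR w1.
Proof. by move=> f1 f2 w20; have := fillRD f1 f2; rewrite w20 addr0. Qed.

(** Opposite orientations of an edge are distinct singular simplices; flat triangles exchange them,
    up to constant edges, at no cost. *)
Lemma fillR_flat a b : fillR (bdtri a b a) = 0.
Proof. by apply: fillR_degenerate; rewrite subrr /gram !ip0r; ring. Qed.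

Lemma fillR_absorb_flat w a b : finfill w -> fillR (w \+ bdtri a b a) <= fillR w.
Proof. by move=> fw; apply: fillR_absorb => //; [exact: finfill_tri|exact: fillR_flat]. Qed.

Lemma fillR_triC12 a b c : fillR (bdtri b a c) = fillR (bdtri a b c).
Proof.
have le (x y z : H) : fillR (bdtri y x z) <= fillR (bdtri x y z).
  have -> : bdtri y x z = bdtri x y z \+ bdtri x y x \+ bdtri x x x :> chn H 1 by chain_eq.
  apply: le_trans (fillR_absorb_flat _ _ _) _; first by apply: finfillD; exact: finfill_tri.
  by apply: fillR_absorb_flat; exact: finfill_tri.
by apply/le_anti; rewrite !le.
Qed.

Lemma fillR_triC23 a b c : fillR (bdtri a c b) = fillR (bdtri a b c).
Proof.
have le (x y z : H) : fillR (bdtri x z y) <= fillR (bdtri x y z).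
  have -> : bdtri x z y = bdtri x y z \+ bdtri y z y \+ bdtri y y y :> chn H 1 by chain_eq.
  apply: le_trans (fillR_absorb_flat _ _ _) _; first by apply: finfillD; exact: finfill_tri.
  by apply: fillR_absorb_flat; exact: finfill_tri.
by apply/le_anti; rewrite !le.
Qed.

End Symmetries.

Local Close Scope classical_set_scope.

(** * Rectangles and right triangles *)

Section Plane.
Variables (R : realType) (H : hilbertType R).

Definition orthonormal_pair (e1 e2 : H) := [/\ ip e1 e1 = 1, ip e2 e2 = 1 & ip e1 e2 = 0].

Definition plane_pt (e1 e2 : H) (x y : R) : H := x *: e1 + y *: e2.

Lemma ptD e1 e2 x y x' y' : plane_pt e1 e2 x y + plane_pt e1 e2 x' y' = plane_pt e1 e2 (x + x') (y + y').
Proof. by rewrite /plane_pt addrACA -!scalerDl. Qed.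

Lemma ptB e1 e2 x y x' y' : plane_pt e1 e2 x y - plane_pt e1 e2 x' y' = plane_pt e1 e2 (x - x') (y - y').
Proof. by rewrite /plane_pt opprD addrACA -!scalerBl. Qed.

Lemma ptZ e1 e2 l x y : l *: plane_pt e1 e2 x y = plane_pt e1 e2 (l * x) (l * y).
Proof. by rewrite /plane_pt scalerDr !scalerA. Qed.

Lemma gram_pt e1 e2 x y x' y' : orthonormal_pair e1 e2 ->
  gram (plane_pt e1 e2 x y) (plane_pt e1 e2 x' y') = (x * y' - x' * y) ^+ 2.
Proof.
by case=> e11 e22 e12; rewrite /gram /plane_pt !ipE (ipC e2 e1) e11 e22 e12; ring.
Qed.

Lemma fillR_pt_le e1 e2 x y x' y' x'' y'' : orthonormal_pair e1 e2 ->
  fillR (bdtri (plane_pt e1 e2 x y) (plane_pt e1 e2 x' y') (plane_pt e1 e2 x'' y'')) <=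
  `|(x' - x) * (y'' - y) - (x'' - x) * (y' - y)|.
Proof.
move=> on; apply: le_trans (fillR_tri_le _ _ _) _.
by rewrite !ptB gram_pt // sqrtr_sqr.
Qed.

Lemma fillR_pt0 e1 e2 x y x' y' x'' y'' : orthonormal_pair e1 e2 ->
  (x' - x) * (y'' - y) = (x'' - x) * (y' - y) ->
  fillR (bdtri (plane_pt e1 e2 x y) (plane_pt e1 e2 x' y') (plane_pt e1 e2 x'' y'')) = 0.
Proof.
move=> on e; apply: fillR_degenerate; rewrite !ptB gram_pt // e subrr; ring.
Qed.

Definition rect_fill (e1 e2 : H) (p q : R) : R :=
  fillR (bdquad (plane_pt e1 e2 0 0) (plane_pt e1 e2 p 0) (plane_pt e1 e2 p q) (plane_pt e1 e2 0 q)).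

Lemma rect_refl w e1 e2 p q : rect_fill (refl w e1) (refl w e2) p q = rect_fill e1 e2 p q.
Proof.
have E x y : plane_pt (refl w e1) (refl w e2) x y = refl w (plane_pt e1 e2 x y).
  by rewrite /plane_pt (linearD (refl w)) !(linearZ_LR (refl w)).
by rewrite /rect_fill !E fillR_quad_refl.
Qed.

(* A product of at most two reflections carries one orthonormal pair to another. *)
Lemma rect_orthonormal e1 e2 e1' e2' p q : orthonormal_pair e1 e2 -> orthonormal_pair e1' e2' ->
  rect_fill e1 e2 p q = rect_fill e1' e2' p q.
Proof.
move=> [a1 a2 a3] [b1 b2 b3].
rewrite -(rect_refl (e1 - e1')) refl_swap ?a1 ?b1 //; set e := refl _ e2.
have ee : ip e e = 1 by rewrite refl_ip.
have e1e : ip e1' e = 0 by rewrite -(refl_swap (a := e1) (b := e1')) ?a1 ?b1 // refl_ip.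
rewrite -(rect_refl (e - e2')) (refl_swap (a := e)) ?ee ?b2 // refl_fix //.
by rewrite ipBr e1e b3 subrr.
Qed.

Variables e1 e2 : H.
Hypothesis on : orthonormal_pair e1 e2.
Notation pt := (plane_pt e1 e2).
Notation rect := (rect_fill e1 e2).

Lemma rect_ge0 p q : 0 <= rect p q. Proof. exact: fillR_ge0. Qed.

Lemma rect_le p q : 0 <= p -> 0 <= q -> rect p q <= 2 * (p * q).
Proof.
move=> p0 q0; apply: le_trans (fillRD _ _) _; try exact: finfill_tri.
apply: le_trans (lerD (fillR_pt_le _ _ _ _ _ _ on) (fillR_pt_le _ _ _ _ _ _ on)) _.
rewrite !subr0 !mul0r mulr0 !subr0 ger0_norm ?mulr_ge0 //; lra.
Qed.

Lemma rect_scale l p q : 0 < l -> rect (l * p) (l * q) = l ^+ 2 * rect p q.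
Proof. by move=> l0; rewrite /rect_fill -fillR_quad_scale // !ptZ !mulr0. Qed.

Lemma rect_hsub p p' q : rect (p + p') q <= rect p q + rect p' q.
Proof.
have -> : rect p' q = fillR (bdquad (pt p 0) (pt (p + p') 0) (pt (p + p') q) (pt p q)).
  rewrite /rect_fill -(fillR_quad_trans (pt p 0)) !ptD.
  by rewrite !add0r !addr0 ![_ + p]addrC.
apply: le_trans (fillRD (finfill_quad _ _ _ _) (finfill_quad _ _ _ _)).
set w := (X in _ <= fillR X).
have fw : finfill w by finfill.
rewrite /rect_fill.
set W := bdquad _ _ _ _.
have -> : W = w \+ bdtri (pt 0 0) (pt p 0) (pt (p + p') 0)
   \+ bdtri (pt (p + p') q) (pt p q) (pt 0 q) by rewrite /W /w; chain_eq.
apply: le_trans (fillR_absorb _ _ _) _; rewrite ?fillR_pt0 //; try ring.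
- by finfill.
- exact: finfill_tri.
apply: fillR_absorb => //; first exact: finfill_tri.
by rewrite fillR_pt0 //; ring.
Qed.

Lemma rect_vsub p q q' : rect p (q + q') <= rect p q + rect p q'.
Proof.
have -> : rect p q' = fillR (bdquad (pt 0 q) (pt p q) (pt p (q + q')) (pt 0 (q + q'))).
  rewrite /rect_fill -(fillR_quad_trans (pt 0 q)) !ptD.
  by rewrite !add0r !addr0 ![_ + q]addrC.
apply: le_trans (fillRD (finfill_quad _ _ _ _) (finfill_quad _ _ _ _)).
set w := (X in _ <= fillR X).
have fw : finfill w by finfill.
rewrite /rect_fill.
set W := bdquad _ _ _ _.
have -> : W = w \+ bdtri (pt p q) (pt 0 q) (pt p q) \+ bdtri (pt p q) (pt p q) (pt p q)
   \+ bdtri (pt p 0) (pt p q) (pt p (q + q'))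
   \+ bdtri (pt 0 0) (pt 0 q) (pt 0 (q + q')) by rewrite /W /w; chain_eq.
have ft := finfill_tri.
apply: le_trans (fillR_absorb _ _ _) _; rewrite ?fillR_pt0 //; try ring.
  by finfill.
apply: le_trans (fillR_absorb _ _ _) _; rewrite ?fillR_pt0 //; try ring.
  by finfill.
apply: le_trans (fillR_absorb_flat _ _ _) _; first by finfill.
exact: fillR_absorb_flat.
Qed.

Lemma rect_hmul p q m : rect (m%:R * p) q <= m%:R * rect p q.
Proof.
elim: m => [|m IH].
  rewrite !mul0r; apply: le_trans (fillRD _ _) _; try exact: finfill_tri.
  by rewrite !fillR_pt0 ?addr0 //; ring.
rewrite -natr1 !mulrDl !mul1r; apply: le_trans (rect_hsub _ _ _) _.
by rewrite lerD2r.
Qed.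

Lemma rect_vmul p q m : rect p (m%:R * q) <= m%:R * rect p q.
Proof.
elim: m => [|m IH].
  rewrite !mul0r; apply: le_trans (fillRD _ _) _; try exact: finfill_tri.
  by rewrite !fillR_pt0 ?addr0 //; ring.
rewrite -natr1 !mulrDl !mul1r; apply: le_trans (rect_vsub _ _ _) _.
by rewrite lerD2r.
Qed.

Let s := rect 1 1.

(** By scaling [q = 1]. A strip of width [1 / n] splits into [n] squares, so it costs at most
    [s / n]; [p] is filled by such strips up to a remainder costing at most [2 / n]. *)
Lemma rect_upper p q : 0 <= p -> 0 <= q -> rect p q <= s * (p * q).
Proof.
have s0 : 0 <= s := rect_ge0 1 1.
move=> p0; rewrite le_eqVlt => /orP[/eqP <-|q0].
  by have := rect_le p0 (lexx 0); rewrite !mulr0.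
suff key x : 0 <= x -> rect x 1 <= s * x.
  have := rect_scale (p / q) 1 q0; rewrite mulrCA divff ?gt_eqF // !mulr1 => ->.
  apply: le_trans (ler_wpM2l (sqr_ge0 _) (key _ _)) _; first by rewrite divr_ge0 // ltW.
  rewrite le_eqVlt; apply/orP; left; apply/eqP; field; by rewrite gt_eqF.
move=> x0; apply/ler_addgt0Pr => e e0.
pose n := (Num.truncn (2 / e)).+1.
have n0 : 0 < n%:R :> R by rewrite ltr0n.
have ne : 2 / n%:R <= e.
  rewrite ler_pdivrMr // mulrC -ler_pdivrMr //; exact: ltW (truncnS_gt _).
pose m := Num.truncn (x * n%:R).
have /andP[m1 m2] : m%:R <= x * n%:R < m.+1%:R by rewrite truncn_itv // mulr_ge0 // ltW.
have r1 : rect (n%:R^-1) 1 <= s / n%:R.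
  have := rect_vmul n%:R^-1 n%:R^-1 n; rewrite mulfV ?gt_eqF // => h.
  apply: le_trans h _; have := rect_scale 1 1 (_ : 0 < n%:R^-1); rewrite mulr1 => -> ; last by rewrite invr_gt0.
  by rewrite -/s le_eqVlt; apply/orP; left; apply/eqP; field; rewrite gt_eqF.
have xE : m%:R * n%:R^-1 + (x - m%:R / n%:R) = x by rewrite addrC subrK.
rewrite -{1}xE; apply: le_trans (rect_hsub _ _ _) _.
have d0 : 0 <= x - m%:R / n%:R by rewrite subr_ge0 ler_pdivrMr.
have d1 : x - m%:R / n%:R <= n%:R^-1.
  by rewrite lerBlDl -[X in _ + X]mul1r -mulrDl natr1 ler_pdivlMr // ltW.
apply: le_trans (lerD (le_trans (rect_hmul _ _ _) (ler_wpM2l (ler0n _ _) r1)) (rect_le d0 ler01)) _.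
rewrite mulr1 mulrA [m%:R * s]mulrC -mulrA; apply: lerD; last first.
  by apply: le_trans ne; rewrite ler_pM2l.
by rewrite ler_wpM2l // ler_pdivrMr.
Qed.

Lemma rect_square p : 0 < p -> rect p p = s * p ^+ 2.
Proof. by move=> p0; have := rect_scale 1 1 p0; rewrite mulr1 mulrC. Qed.

(** The value on squares is exact. Completing the rectangle to a square turns the upper bound on the
    complement into a lower bound on the rectangle. *)
Lemma rectE (p q : R) : 0 <= p -> 0 <= q -> rect p q = s * (p * q).
Proof.
move=> p0 q0; apply/le_anti; rewrite rect_upper //=.
have [pq|qp] := leP q p.
- have [p1|pn] := ltP 0 p; last first.
    by have -> : p = 0; [apply/le_anti; rewrite pn|rewrite mul0r mulr0 rect_ge0].
  have := rect_vsub p q (p - q); rewrite [q + _]addrC subrK rect_square //.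
  have := @rect_upper p (p - q) p0; rewrite subr_ge0 => /(_ pq).
  by move: (s) (rect p q) (rect p (p - q)) => s' r1 r2; nra.
have q1 : 0 < q by apply: le_lt_trans qp.
have := rect_hsub p (q - p) q; rewrite [p + _]addrC subrK rect_square //.
have := @rect_upper (q - p) q; rewrite subr_ge0 => /(_ (ltW qp) q0).
by move: (s) (rect p q) (rect (q - p) q) => s' r1 r2; nra.
Qed.

(** The midpoint of the hypotenuse cuts the triangle into two copies at half scale and a rectangle,
    so [t <= t / 2 + s p q / 4]. *)
Lemma right_triangle (p q : R) : 0 <= p -> 0 <= q ->
  fillR (bdtri (pt 0 0) (pt p 0) (pt 0 q)) <= s * (p * q) / 2.
Proof.
move=> p0 q0; set t := fillR _.
suff : t <= 2 * (2^-1 ^+ 2 * t) + rect (2^-1 * p) (2^-1 * q).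
  by rewrite rect_scale // rectE //; nra.
have half : 0 < 2^-1 :> R by lra.
have E : 2^-1 ^+ 2 * t = fillR (bdtri (pt 0 0) (pt (2^-1 * p) 0) (pt 0 (2^-1 * q))).
  by rewrite /t -fillR_tri_scale // !ptZ !mulr0.
set p' := 2^-1 * p in E *; set q' := 2^-1 * q in E *.
have Ep : p = p' + p' by rewrite /p'; lra.
have Eq : q = q' + q' by rewrite /q'; lra.
have E1 : 2^-1 ^+ 2 * t = fillR (bdtri (pt p' 0) (pt p 0) (pt p' q')).
  by rewrite E -(fillR_tri_trans (pt p' 0)) !ptD !add0r addr0 Ep.
have E2 : 2^-1 ^+ 2 * t = fillR (bdtri (pt 0 q') (pt p' q') (pt 0 q)).
  by rewrite E -(fillR_tri_trans (pt 0 q')) !ptD !add0r addr0 Eq.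
rewrite [2 * _]mulr_natl mulr2n {1}E1 E2 /t.
have ft := finfill_tri.
apply: le_trans (lerD (fillRD _ _) (lexx _)) => //.
apply: le_trans (fillRD _ _) => //; [|by finfill..].
set w := (X in _ <= fillR X).
have fw : finfill w by finfill.
set W := bdtri _ _ _.
have -> : W = w \+ bdtri (pt p' q') (pt 0 q') (pt p' q') \+ bdtri (pt p' q') (pt p' q') (pt p' q')
   \+ bdtri (pt 0 0) (pt p' 0) (pt p 0) \+ bdtri (pt p 0) (pt p' q') (pt 0 q)
   \+ bdtri (pt 0 0) (pt 0 q') (pt 0 q) by rewrite /W /w; chain_eq.
apply: le_trans (fillR_absorb _ _ _) _; rewrite ?fillR_pt0 //; try ring.
  by finfill.
apply: le_trans (fillR_absorb _ _ _) _; rewrite ?fillR_pt0 // ?Ep ?Eq; try ring.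
  by finfill.
apply: le_trans (fillR_absorb _ _ _) _; rewrite ?fillR_pt0 //; try ring.
  by finfill.
apply: le_trans (fillR_absorb_flat _ _ _) _; first by finfill.
exact: fillR_absorb_flat.
Qed.

End Plane.

(** * Arbitrary triangles *)

Section Triangles.
Variables (R : realType) (H : hilbertType R).

Section Coordinates.
Variables e1 e2 : H.
Hypothesis on : orthonormal_pair e1 e2.
Let s : R := rect_fill e1 e2 1 1.
Notation pt := (plane_pt e1 e2).

Lemma corner (u v : H) x y a b x' y' p q : orthonormal_pair u v -> 0 <= p -> 0 <= q ->
  p *: u = pt (a - x) (b - y) -> q *: v = pt (x' - x) (y' - y) ->
  fillR (bdtri (pt x y) (pt a b) (pt x' y')) <= s * (p * q) / 2.
Proof.
move=> uv p0 q0 pu qv; rewrite /s (rect_orthonormal 1 1 on uv).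
have E0 : plane_pt u v 0 0 = 0 by rewrite /plane_pt !scale0r addr0.
have E1 : plane_pt u v p 0 = pt (a - x) (b - y) by rewrite -pu /plane_pt scale0r addr0.
have E2 : plane_pt u v 0 q = pt (x' - x) (y' - y) by rewrite -qv /plane_pt scale0r add0r.
have := right_triangle uv p0 q0; rewrite -(fillR_tri_trans (pt x y)) E0 E1 E2.
by rewrite add0r !ptD !subrK.
Qed.

(** Upper bound: the altitude cuts the triangle into two right ones. Lower bound: two right
    triangles complete it to the rectangle of sides [b] and [h], whose filling is known exactly. *)
Lemma triangle_coordinates b d h : 0 <= d <= b -> 0 <= h ->
  fillR (bdtri (pt 0 0) (pt b 0) (pt d h)) = s * (b * h) / 2.
Proof.
move=> /andP[d0 db] h0; have [e11 e22 e12] := on.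
have ft := finfill_tri; have b0 := le_trans d0 db.
have bd : 0 <= b - d by rewrite subr_ge0.
have on1 : orthonormal_pair (- e1) e2 by split; rewrite ?ipNl ?ipNr ?e12 ?opprK ?oppr0.
have on2 : orthonormal_pair e1 (- e2) by split; rewrite ?ipNl ?ipNr ?e12 ?opprK ?oppr0.
have on3 : orthonormal_pair (- e1) (- e2) by split; rewrite ?ipNl ?ipNr ?e12 ?opprK ?oppr0.
apply/le_anti/andP; split.
- have t1 : fillR (bdtri (pt d 0) (pt b 0) (pt d h)) <= s * ((b - d) * h) / 2.
    apply: (corner on) => //; rewrite /plane_pt ?subrr ?scale0r ?addr0 ?add0r ?subr0 //.
  have t2 : fillR (bdtri (pt d 0) (pt 0 0) (pt d h)) <= s * (d * h) / 2.
    apply: (corner on1) => //; rewrite /plane_pt ?subrr ?scale0r ?addr0 ?add0r ?subr0 //.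
    by rewrite scalerN scaleNr.
  apply: le_trans (_ : fillR (bdtri (pt d 0) (pt b 0) (pt d h)) +
     fillR (bdtri (pt d 0) (pt 0 0) (pt d h)) <= _); last by nra.
  apply: le_trans (fillRD _ _) => //.
  set w := (X in _ <= fillR X); have fw : finfill w by finfill.
  set W := bdtri _ _ _.
  have -> : W = w \+ bdtri (pt d 0) (pt 0 0) (pt d 0) \+ bdtri (pt d 0) (pt d 0) (pt d 0)
    \+ bdtri (pt 0 0) (pt d 0) (pt b 0) by rewrite /W /w; chain_eq.
  apply: le_trans (fillR_absorb _ _ _) _; rewrite ?fillR_pt0 //; try ring.
    by finfill.
  apply: le_trans (fillR_absorb_flat _ _ _) _; first by finfill.
  exact: fillR_absorb_flat.
have t1 : fillR (bdtri (pt b h) (pt d h) (pt b 0)) <= s * ((b - d) * h) / 2.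
  apply: (corner on3) => //; rewrite /plane_pt ?subrr ?scale0r ?addr0 ?add0r ?subr0 //.
    by rewrite scalerN -scaleNr opprB.
  by rewrite scalerN scaleNr.
have t2 : fillR (bdtri (pt 0 h) (pt d h) (pt 0 0)) <= s * (d * h) / 2.
  apply: (corner on2) => //; rewrite /plane_pt ?subrr ?scale0r ?addr0 ?add0r ?subr0 //.
  by rewrite scalerN scaleNr.
have RE : rect_fill e1 e2 b h = s * (b * h) by rewrite rectE.
suff : rect_fill e1 e2 b h <= fillR (bdtri (pt 0 0) (pt b 0) (pt d h)) +
    fillR (bdtri (pt b h) (pt d h) (pt b 0)) + fillR (bdtri (pt 0 h) (pt d h) (pt 0 0)) by nra.
rewrite -(fillR_triC23 (pt b h)) -(fillR_triC12 (pt b h)) -(fillR_triC23 (pt 0 h)) -(fillR_triC12 (pt 0 h)).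
apply: le_trans (lerD (fillRD _ _) (lexx _)) => //.
apply: le_trans (fillRD _ _) => //; last by finfill.
set w := (X in _ <= fillR X); have fw : finfill w by finfill.
rewrite /rect_fill; set W := bdquad _ _ _ _.
have -> : W = w \+ bdtri (pt b h) (pt 0 h) (pt d h) by rewrite /W /w; chain_eq.
by apply: fillR_absorb; rewrite ?fillR_pt0 //; ring.
Qed.

End Coordinates.

(** After a permutation [a b] is a longest side, so that the foot of the altitude from [c] falls
    between [a] and [b], as [triangle_coordinates] requires. *)
Lemma fillR_tri_gram (e1 e2 a b c : H) : orthonormal_pair e1 e2 ->
  fillR (bdtri a b c) = rect_fill e1 e2 1 1 / 2 * Num.sqrt (gram (b - a) (c - a)).
Proof.
move=> on.
wlog : a b c / (ip (c - a) (c - a) <= ip (b - a) (b - a)) &&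
               (ip (c - b) (c - b) <= ip (b - a) (b - a)).
  move=> wl.
  have sym (x y : H) : ip (x - y) (x - y) = ip (y - x) (y - x) by rewrite -opprB ipNl ipNr opprK.
  have g12 x y z : gram (y - x) (z - x) = gram (x - y) (z - y).
    by rewrite /gram !ipE (ipC x y) (ipC z x) (ipC z y); ring.
  have AC : ip (b - a) (b - a) <= ip (c - a) (c - a) -> ip (c - b) (c - b) <= ip (c - a) (c - a) ->
      fillR (bdtri a b c) = rect_fill e1 e2 1 1 / 2 * Num.sqrt (gram (b - a) (c - a)).
    by move=> l1 l2; rewrite gramC -fillR_triC23; apply: wl; rewrite l1 (sym b c) l2.
  have BC : ip (b - a) (b - a) <= ip (c - b) (c - b) -> ip (c - a) (c - a) <= ip (c - b) (c - b) ->
      fillR (bdtri a b c) = rect_fill e1 e2 1 1 / 2 * Num.sqrt (gram (b - a) (c - a)).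
    move=> l1 l2; rewrite g12 gramC -fillR_triC12 -fillR_triC23; apply: wl.
    by rewrite (sym a b) l1 (sym a c) l2.
  have [l1|/ltW l1] := leP (ip (c - a) (c - a)) (ip (b - a) (b - a));
  have [l2|/ltW l2] := leP (ip (c - b) (c - b)) (ip (b - a) (b - a)).
  - by apply: wl; rewrite l1 l2.
  - by apply: BC => //; exact: le_trans l2.
  - by apply: AC => //; exact: le_trans l1.
  have [l3|/ltW l3] := leP (ip (c - b) (c - b)) (ip (c - a) (c - a)); first exact: AC.
  exact: BC.
move=> /andP[ca cb].
have [ba|nba] := eqVneq b a.
  by rewrite fillR_degenerate ba subrr /gram !ip0l ?expr0n ?mul0r ?subr0 ?sqrtr0 ?mulr0.
have unit_multiple (x : H) : x != 0 -> exists l (u : H), [/\ 0 < l, ip u u = 1 & x = l *: u].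
  move=> x0; have l0 : `|x| != 0 by rewrite normr_eq0.
  exists `|x|, (`|x|^-1 *: x); rewrite normr_gt0 scale_ip ip_norm scalerA divff // scale1r.
  by split=> //; field.
have [L [u [L0 uu baE]]] : exists l (u : H), [/\ 0 < l, ip u u = 1 & b - a = l *: u].
  by apply: unit_multiple; rewrite subr_eq0.
have LL : ip (b - a) (b - a) = L ^+ 2 by rewrite baE scale_ip uu mulr1.
have [d [w [wu caE]]] : exists d (w : H), ip w u = 0 /\ c - a = d *: u + w.
  exists (ip (c - a) u), ((c - a) - ip (c - a) u *: u).
  split; first by rewrite (ipBl (c - a)) ipZl uu mulr1 subrr.
  by rewrite [RHS]addrC subrK.
have caca : ip (c - a) (c - a) = d ^+ 2 + ip w w.
  by rewrite caE !ipE uu wu (ipC u w) wu; ring.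
have ww := ip_ge0 w.
have d2 : d ^+ 2 <= L ^+ 2 by rewrite -LL (le_trans _ ca) // caca lerDl.
have dL : d <= L.
  have [|/ltW dn] := leP 0 d; last by apply: le_trans dn (ltW L0).
  by move=> d0; rewrite -(@ler_pXn2r _ 2) ?nnegrE // ltW.
have d0 : 0 <= d.
  have : ip (c - b) (c - b) = ip (c - a) (c - a) - 2 * L * d + L ^+ 2.
    have -> : c - b = (c - a) - (b - a) by rewrite opprB addrA subrK.
    by rewrite baE caE !ipE uu wu (ipC u w) wu; ring.
  move: cb; rewrite LL => /[swap] ->; have := ip_ge0 (c - a); nra.
have [w0|nw0] := eqVneq w 0.
  have g0 : gram (b - a) (c - a) = 0.
    by rewrite baE caE w0 addr0 /gram !ipE uu; ring.
  by rewrite g0 sqrtr0 mulr0 fillR_degenerate.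
have [h [v [h0 vv wE]]] := unit_multiple _ nw0.
have uv : ip u v = 0.
  move: wu; rewrite wE ipZl ipC => /eqP.
  by rewrite mulf_eq0 gt_eqF //= => /eqP.
have on' : orthonormal_pair u v by [].
have E1 : bdtri a b c = bdtri (plane_pt u v 0 0 + a) (plane_pt u v L 0 + a) (plane_pt u v d h + a).
  by rewrite /plane_pt -baE -wE -caE !scale0r addr0 add0r addr0 !subrK.
rewrite E1 fillR_tri_trans triangle_coordinates ?d0 ?dL ?ltW // (rect_orthonormal 1 1 on on').
have -> : b - a = plane_pt u v L 0 by rewrite /plane_pt scale0r addr0.
have -> : c - a = plane_pt u v d h by rewrite /plane_pt -wE.
by rewrite gram_pt // mulr0 subr0 sqrtr_sqr ger0_norm ?mulr_ge0 ?ltW //; ring.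
Qed.

Theorem fillR_tri_area : exists2 s : R, 0 <= s & forall a b c : H,
  fillR (bdtri a b c) = s * Num.sqrt (gram (b - a) (c - a)).
Proof.
have [[e1 [e2 on]]|none] := pselect (exists e1 e2 : H, orthonormal_pair e1 e2).
  exists (rect_fill e1 e2 1 1 / 2); first by rewrite divr_ge0 ?rect_ge0.
  by move=> a b c; apply: fillR_tri_gram.
(* Without an orthonormal pair all triangles are degenerate: two sides with nonzero [gram] would
   yield such a pair. *)
exists 0 => // a b c; rewrite mul0r; apply: fillR_degenerate.
apply: contrapT => /eqP g0; apply: none.
move: (b - a) (c - a) g0 => u v g0.
have v0 : ip v v != 0.
  by apply: contra_neq g0 => /eqP; rewrite ip_eq0 => /eqP ->; rewrite /gram !ip0r; ring.
have vp : 0 < ip v v by rewrite lt_def v0 ip_ge0.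
pose w := u - (ip u v / ip v v) *: v.
have wv : ip w v = 0 by rewrite /w !ipE divfK // subrr.
have ww : ip w w * ip v v = gram u v by rewrite /w /gram !ipE (ipC v u); field.
have w0 : ip w w != 0 by apply: contra_neq g0 => w0; rewrite -ww w0 mul0r.
have nn (x : H) : ip x x != 0 -> ip (`|x|^-1 *: x) (`|x|^-1 *: x) = 1.
  move=> x0; rewrite scale_ip ip_norm exprVn mulVf // -ip_norm //.
exists (`|w|^-1 *: w), (`|v|^-1 *: v); split; rewrite ?nn //.
by rewrite ipZl ipZr wv !mulr0.
Qed.

End Triangles.

(** * The distortion *)

Lemma enum_set2_lt n (u v : 'I_n) : (u < v)%N -> enum [set u; v]%SET = [:: u; v].
Proof.
move=> uv; pose r := relpre (val : 'I_n -> nat) ltn.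
have tr : transitive r by move=> x y z; apply: ltn_trans.
apply: (@irr_sorted_eq _ r) => //.
- by move=> x; rewrite /r /= ltnn.
- rewrite /enum_mem; apply: sorted_filter => //.
  by rewrite -sorted_map -enumT val_enum_ord iota_ltn_sorted.
- by rewrite /= /r /= uv.
- by move=> x; rewrite mem_enum !inE.
Qed.

Section Push.
Variables (R : realType) (H : hilbertType R) (n : nat) (X : {set {set 'I_n}}).
Variable phi : 'rV[R]_n -> H.
Hypothesis phi_affine : affine_map X phi.

Definition vertex_image (v : 'I_n) : H := phi (delta_mx 0 v).

Lemma delta_simplex (s : {set 'I_n}) v : v \in s -> geom_simplex s (delta_mx 0 v : 'rV[R]_n).
Proof.
move=> vs; split=> [i||i nis]; rewrite ?mxE ?eqxx ?ler0n //=.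
  rewrite (bigD1 v) //= mxE !eqxx big1 ?addr0 // => i iv.
  by rewrite mxE (negbTE iv).
by case: eqP => // e; rewrite e vs in nis.
Qed.

Lemma push_edge (s : simplices X 1) (u v : 'I_n) : (u < v)%N -> val s = [set u; v]%SET ->
  push_simplex phi s = seg (vertex_image u) (vertex_image v).
Proof.
move=> uv sE; have sX : val s \in X by case/andP: (valP s).
have sv j : simplex_vertex s j = nth u [:: u; v] j.
  by rewrite /simplex_vertex (enum_val_nth u) /= sE enum_set2_lt.
apply/funext => x; rewrite /push_simplex /seg /aff.
have [sx|nsx] := pselect (std_simplex x); last by rewrite !on_simplex_out.
have [x0 x1 _] := sx; rewrite !on_simplex_in //= /vertex_map !big_ord_recl !big_ord0 !addr0 !sv /=.
rewrite !big_ord_recl big_ord0 addr0 in x1.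
have -> : x 0 (lift ord0 ord0) = 1 - x 0 ord0 by move: x1 => /= <-; ring.
rewrite (phi_affine sX) //.
- by rewrite sE; apply: delta_simplex; rewrite !inE eqxx.
- by rewrite sE; apply: delta_simplex; rewrite !inE eqxx orbT.
- by rewrite x0 -x1 lerDl x0.
Qed.

End Push.

Section Cycles.
Variables (R : realType) (H : hilbertType R) (n q : nat).
Hypothesis qn : (3 * q <= n)%N.
Variables (S : {set tritri q}) (phi : 'rV[R]_n -> H).
Hypothesis phi_affine : affine_map (tricomplex qn S) phi.

Let p k i := vertex_image phi (vx qn k i).

(** The classes occupy successive blocks of vertices, so the order of the vertices, which orients
    each edge, is that of the classes, as in [bdtri]. *)
Lemma push_tcycle t : push_chain phi (tcycle qn S t) =
  bdtri (p 0 t.1.1) (p 1 t.1.2) (p 2%:R t.2).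
Proof.
apply/funext => tau; rewrite bdtriE /push_chain.
have eX e : (everts qn e \in tricomplex qn S) && (#|everts qn e| == 2%N).
  by rewrite inE card_everts.
pose s e := mk_simplex (eX e).
have tE u : tcycle qn S t u = (u == s (bc t))%:R + (u == s (ac t))%:R + (u == s (ab t))%:R.
  have sE e : (u == s e) = (sval u == everts qn e) by rewrite -[LHS](inj_eq val_inj).
  rewrite ffunE !{}sE /=.
  move: (sval u) (esym (card_simplex u) : #|sval u| = 2%N) => v cv.
  have ne k i (A B : {set 'I_n}) : vx qn k i \in A -> vx qn k i \notin B -> (A == B) = false.
    by move=> kA kB; apply: contraNF kB => /eqP <-.
  have bcac : (everts qn (bc t) == everts qn (ac t)) = false.
    by apply: (@ne 1 t.1.2); rewrite !inE !vx_eq ?eqxx.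
  have bcab : (everts qn (bc t) == everts qn (ab t)) = false.
    by apply: (@ne 2%:R t.2); rewrite !inE !vx_eq ?eqxx.
  have acab : (everts qn (ac t) == everts qn (ab t)) = false.
    by apply: (@ne 2%:R t.2); rewrite !inE !vx_eq ?eqxx.
  have acbc : (everts qn (ac t) == everts qn (bc t)) = false by rewrite eq_sym.
  have abbc : (everts qn (ab t) == everts qn (bc t)) = false by rewrite eq_sym.
  have abac : (everts qn (ab t) == everts qn (ac t)) = false by rewrite eq_sym.
  have [sub|nsub] := boolP (v \subset tverts qn t); last first.
    suff no e : e \in eds t -> (v == everts qn e) = false.
      by rewrite !no ?addr0 // !inE eqxx ?orbT.
    by move=> et; apply: contraNF nsub => /eqP ->; rewrite everts_sub.
  have [e ue] := sub_everts cv sub.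
  move: sub; rewrite ue everts_sub !inE -orbA => /or3P[]/eqP ->;
    by rewrite eqxx ?bcac ?bcab ?acab ?acbc ?abbc ?abac ?addr0 ?add0r.
have sum1 e (a b : H) : push_simplex phi (s e) = seg a b ->
    \sum_(u : simplices (tricomplex qn S) 1 | push_simplex phi u == tau) (u == s e)%:R =
    (seg a b == tau)%:R :> 'F_2.
  move=> <-; case: (boolP (push_simplex phi (s e) == tau)) => pe.
    rewrite (bigD1 (s e)) //= eqxx big1 ?addr0 // => u /andP[_ /negbTE ->] //.
  by rewrite big1 // => u pu; case: eqP => // us; rewrite us (negbTE pe) in pu.
under eq_bigr do rewrite tE.
rewrite !big_split /=; congr (_ + _ + _); apply: sum1; apply: push_edge => //; exact: vx_mono.
Qed.

End Cycles.

(** [z1] bounds the first supremum below by [a1] and [z2] the second by [m / a2]. A vanishing [a1]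
    or [a2], in particular when the constant [s] of [fillR_tri_area] is 0, falls in the infinite
    case. *)
Lemma distortion_ge (R : realType) (H : hilbertType R) n (X : {set {set 'I_n}})
  (phi : 'rV[R]_n -> H) (z1 z2 : chain X 1) (a1 a2 C m : R) :
  nonzero_boundaries1 z1 -> nonzero_boundaries1 z2 ->
  fill_hilbert (push_chain phi z1) = a1%:E -> fill_hilbert (push_chain phi z2) = a2%:E ->
  0 <= a1 -> 0 <= a2 -> a2 <= C * a1 -> 0 < C -> 0 < m ->
  fill_complex z1 = 1%N -> m <= (fill_complex z2)%:R ->
  ((m / C)%:E <= filling_distortion X phi)%E.
Proof.
move=> nz1 nz2 F1 F2 a10 a20 a12 C0 m0 f1 f2; rewrite /filling_distortion.
case: asboolP => [_|none]; first by rewrite leey.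
have a1p : 0 < a1.
  rewrite lt_neqAle a10 andbT eq_sym; apply/eqP => a1z; apply: none; exists z1 => //.
  by rewrite F1 a1z.
have a2p : 0 < a2.
  rewrite lt_neqAle a20 andbT eq_sym; apply/eqP => a2z; apply: none; exists z2 => //.
  by rewrite F2 a2z.
apply: (@le_trans _ _ (a1%:E * (m / a2)%:E)%E).
  rewrite -EFinM lee_fin mulrCA ler_pM2l // ler_pdivlMr // mulrC ler_pdivrMr //.
  by rewrite [leRHS]mulrC.
apply: lee_pmul; rewrite ?lee_fin ?divr_ge0 ?(ltW m0) //.
  apply: ereal_sup_ubound; exists z1 => //.
  by rewrite F1 f1 inve1 mule1.
apply: (@le_trans _ _ (((fill_complex z2)%:R / a2)%:E)); last first.
  by apply: ereal_sup_ubound; exists z2 => //; rewrite F2 inver gt_eqF // EFinM.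
by rewrite lee_fin ler_pM2r ?invr_gt0.
Qed.

Section Main.
Variables (R : realType) (n q j : nat).
Hypothesis qn : (3 * q <= n)%N.
Hypothesis j20 : (20 <= j)%N.
Hypothesis qE : q = (2 ^ (12 * j))%N.

Lemma exists_complex : exists X : {set {set 'I_n}},
  [/\ simplicial_complex X, complex_dim X = 2%N, complete_1skeleton X &
    forall (H : hilbertType R) (phi : 'rV[R]_n -> H), affine_map X phi ->
      (((2 ^ (3 * j))%:R / 256)%:E <= filling_distortion X phi)%E].
Proof.
have [S [t tS] HS] := @hilbert_triangles R q j j20 qE; exists (tricomplex qn S).
split; [exact: tricomplex_simplicial|exact: tricomplex_dim tS|exact: tricomplex_skeleton|move=> H phi aff].
have [s s0 area] := fillR_tri_area H.
have [t1 t1S] := HS H (fun k i => vertex_image phi (vx qn k i)).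
pose G t := Num.sqrt (gram (vertex_image phi (vx qn 1 t.1.2) - vertex_image phi (vx qn 0 t.1.1))
  (vertex_image phi (vx qn 2%:R t.2) - vertex_image phi (vx qn 0 t.1.1))).
have FE t' : fill_hilbert (push_chain phi (tcycle qn S t')) = (s * G t')%:E.
  by rewrite (push_tcycle aff) finfillE ?area //; exact: finfill_tri.
have b1 t' : t' \in S -> nonzero_boundaries1 (tcycle qn S t').
  move=> t'S; split; last exact: tcycle_neq0.
  by apply/tcycle_boundary/memv_span/map_f; rewrite mem_enum.
case=> [G0|[t2 [t2s nf G2]]].
  rewrite /filling_distortion asboolT ?leey //; exists (tcycle qn S t1); first exact: b1.
  by rewrite FE /G G0 sqrtr0 mulr0.
apply: (@distortion_ge _ _ _ _ _ (tcycle qn S t1) (tcycle qn S t2) (s * G t1) (s * G t2)) => //.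
- exact: b1.
- by split; [exact: tcycle_boundary|exact: tcycle_neq0].
- by rewrite mulr_ge0 ?sqrtr_ge0.
- by rewrite mulr_ge0 ?sqrtr_ge0.
- rewrite mulrCA ler_wpM2l //.
  (* [65536] compares squared areas, so areas are compared up to its square root. *)
  have -> : 256 = Num.sqrt ((65536%N)%:R : R).
    by rewrite (_ : 65536 = 256 ^ 2)%N // natrX sqrtr_sqr ger0_norm.
  by rewrite -sqrtrM ?ler0n // ler_wsqrtr.
- exact: fill_tcycle1.
- by rewrite ler_nat ltnW // fill_tcycle_gt //; exact: tcycle_boundary.
Qed.

End Main.

Unset Implicit Arguments.

Theorem theorem1p2 (R : realType) :
  forall eps : R, 0 < eps ->
  exists (C : R) (n0 : nat), 0 < C /\
    forall n : nat, (n0 <= n)%N ->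
    exists X : {set {set 'I_n}},
      [/\ simplicial_complex X, complex_dim X = 2%N, complete_1skeleton X
        & forall (H : hilbertType R) (phi : 'rV[R]_n -> H),
            affine_map X phi ->
            ((C * n%:R `^ ((1 - 2 * eps) / 4))%:E
               <= filling_distortion X phi)%E].
Proof.
move=> eps eps0; have [b bE] : {b | b = (2 ^ 12)%N} by eexists.
have [N NE] : {N | N = (b ^ 20)%N} by eexists.
(* [4096 = 256 * 16]: 256 is lost in [exists_complex], and 16 because [n] is at most the fourth
   power of [2 ^ (3 * j + 4)]. The bound [3 * N] ensures [20 <= j]. *)
exists ((4096%N)%:R^-1), (3 * N)%N; split; first by rewrite invr_gt0 ltr0n.
move=> n n0n; pose j := trunc_log b (n %/ 3).
have b1 : (1 < b)%N by rewrite bE -{1}(expn0 2) ltn_exp2l.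
have n3 : (N <= n %/ 3)%N by rewrite leq_divRL // mulnC.
have n30 : (0 < n %/ 3)%N by apply: leq_trans n3; rewrite NE expn_gt0 ltnW.
have j20 : (20 <= j)%N by apply: trunc_log_max => //; rewrite -NE.
have qn : (3 * 2 ^ (12 * j) <= n)%N.
  by rewrite mulnC -leq_divRL // expnM -bE trunc_logP.
(* By maximality of [j], [n] is below [3 * 2 ^ (12 * j.+1)]; the factor 3 is rounded up to
   [2 ^ 2]. *)
have nq : (n <= (2 ^ (3 * j + 4)) ^ 4)%N.
  have := trunc_log_ltn (n %/ 3) b1; rewrite -/j ltn_divLR // bE -expnM => /ltnW le.
  apply: leq_trans le _; apply: (@leq_trans (2 ^ (12 * j.+1) * 2 ^ 2)).
    by rewrite leq_mul2l orbT.
  by rewrite -[leqRHS]expnM -expnD leq_exp2l //; lia.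
have [X [sX dX cX hX]] := @exists_complex R n _ j qn j20 erefl.
exists X; split=> // H phi aff; apply: le_trans (hX H phi aff); rewrite lee_fin.
have n1 : 1 <= (n%:R : R).
  by rewrite ler1n; case: (n) n30 => //; rewrite div0n.
apply: (@le_trans _ _ ((4096%N)%:R^-1 * (2 ^ (3 * j + 4))%:R)).
  rewrite ler_pM2l ?invr_gt0 ?ltr0n //.
  apply: (@le_trans _ _ (n%:R `^ 4^-1)).
    by apply: ler_powR => //; rewrite ler_pdivrMr // mulVf ?pnatr_eq0 //; lra.
  apply: (@le_trans _ _ (((2 ^ (3 * j + 4)) ^ 4)%N%:R `^ 4^-1)).
    by apply: ge0_ler_powR; rewrite ?nnegrE ?invr_ge0 ?ler0n ?ler_nat.
  by rewrite natrX -powR_mulrn ?ler0n // -powRrM mulfV ?pnatr_eq0 // powRr1 ?ler0n.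
rewrite expnD natrM mulrCA [in leRHS]mulrC [leLHS]mulrC.
rewrite ler_pM2r ?ltr0n ?expn_gt0 //.
have -> : (2 ^ 4 = 16)%N by [].
by lra.
Qed.
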